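(* Let $\Omega=B_1$ be the unit disk in $\mathbb{R}^2$. Then there exists a nonnegative smooth function $\omega_0$ with a single critical point and $\omega_0|_{\partial B_1}=c$ for some constant $c>0$, such that the kinetic energy functional $E$ admits no smooth minimizer in the orbit $\mathcal{O}_{\omega_0}$.
   Context: $\Delta^{-1}$ denotes the solution operator of the Laplace equation with zero Dirichlet boundary condition on $\partial\Omega$. The kinetic energy functional is $E(\omega):=\frac12\int_\Omega|\nabla\Delta^{-1}\omega|^2\,dx$. The coadjoint orbit of $\omega_0$ is $\mathcal{O}_{\omega_0}:=\{\omega_0\circ\eta^{-1}:\eta\in\mathcal{D}_{\mathrm{vol}}(\Omega)\}$, where $\mathcal{D}_{\mathrm{vol}}(\Omega)$ is the group of volume-preserving diffeomorphisms from $\Omega$ to $\Omega$. *)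

(* Defs.v *)
From HB Require Import structures.
From mathcomp Require Import all_boot all_order all_algebra.
From mathcomp Require Import all_classical all_reals all_analysis.

Set Implicit Arguments.
Unset Strict Implicit.
Unset Printing Implicit Defensive.

Import Order.TTheory GRing.Theory Num.Theory.
Import numFieldNormedType.Exports.

Local Open Scope classical_set_scope.
Local Open Scope ring_scope.

Section planar_domain.
Variable R : realType.

Let plane := (R * R)%type.

(* [R * R] carries the sup norm in the library, so the Euclidean disk is not
   one of its balls. *)
Definition unit_disk : set plane := [set x | x.1 ^+ 2 + x.2 ^+ 2 < 1].

Definition partial1 (f : plane -> R) : plane -> R := 'D_((1, 0) : plane) f.

Definition partial2 (f : plane -> R) : plane -> R := 'D_((0, 1) : plane) f.

Definition laplacian (f : plane -> R) : plane -> R :=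
  partial1 (partial1 f) \+ partial2 (partial2 f).

(* [U] is meant to be open: all partial derivatives of order at most [k] exist
   and are continuous on [U]. *)
Fixpoint Ck (k : nat) (U : set plane) (f : plane -> R) : Prop :=
  (forall x, U x -> {for x, continuous f}) /\
  match k with
  | 0%N => True
  | k'.+1 =>
      [/\ forall x, U x -> derivable f x (1, 0),
          forall x, U x -> derivable f x (0, 1),
          Ck k' U (partial1 f) & Ck k' U (partial2 f)]
  end.

(* Functions on the closure of [Omega] are represented by total functions
   whose values outside of the closure are irrelevant; [smooth_ext Omega f g]
   says that [g] is a smooth function on the whole plane that agrees with [f]
   on the closure. *)
Definition smooth_ext (Omega : set plane) (f g : plane -> R) : Prop :=
  (forall k, Ck k setT g) /\ (forall x, closure Omega x -> g x = f x).

Definition smooth (Omega : set plane) (f : plane -> R) : Prop :=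
  exists g, smooth_ext Omega f g.

(* On the boundary the gradient has to be read off a smooth extension; when
   [Omega] is open it does not depend on the extension, at any point of the
   closure, by continuity of the partial derivatives. *)
Definition critical_point (Omega : set plane) (f : plane -> R) (x : plane)
    : Prop :=
  closure Omega x /\
  exists g, [/\ smooth_ext Omega f g, partial1 g x = 0 & partial2 g x = 0].

Definition area : set plane -> \bar R :=
  (@lebesgue_measure R \x @lebesgue_measure R)%E.

Definition smooth_map (Omega : set plane) (eta : plane -> plane) : Prop :=
  smooth Omega (fst \o eta) /\ smooth Omega (snd \o eta).

(* Diffeomorphisms are smooth up to the boundary, together with their
   inverse. *)
Definition diffeo (Omega : set plane) (eta : plane -> plane) : Prop :=
  [/\ set_bij (closure Omega) (closure Omega) eta, smooth_map Omega eta
    & smooth_map Omega (pinv (closure Omega) eta)].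

(* Orientation-reversing maps are allowed. *)
Definition volume_preserving (Omega : set plane) (eta : plane -> plane)
    : Prop :=
  forall A : set plane, measurable A -> A `<=` closure Omega ->
    area (closure Omega `&` eta @^-1` A) = area A.

Definition Dvol (Omega : set plane) : set (plane -> plane) :=
  [set eta | diffeo Omega eta /\ volume_preserving Omega eta].

Definition coadjoint_orbit (Omega : set plane) (omega0 : plane -> R)
    : set (plane -> R) :=
  [set omega | exists2 eta, Dvol Omega eta &
    forall x, closure Omega x ->
      omega x = (omega0 \o pinv (closure Omega) eta) x].

(* Classical solutions of the Dirichlet problem on the open set [Omega]. *)
Definition dirichlet_solution (Omega : set plane) (omega psi : plane -> R)
    : Prop :=
  [/\ Ck 2 Omega psi,
      {within closure Omega, continuous psi},
      forall x, Omega x -> laplacian psi x = omega x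
    & forall x, (closure Omega `\` Omega) x -> psi x = 0].

(* On a bounded open set, the restriction of the solution to the closure is
   unique; the default value [0] is only used when there is no solution. *)
Definition inv_laplacian (Omega : set plane) (omega : plane -> R)
    : plane -> R :=
  xget (cst 0) [set psi | dirichlet_solution Omega omega psi].

Definition energy (Omega : set plane) (omega : plane -> R) : \bar R :=
  let psi := inv_laplacian Omega omega in
  ((2^-1)%:E * \int[area]_(x in Omega)
     (partial1 psi x ^+ 2 + partial2 psi x ^+ 2)%:E)%E.

Definition smooth_energy_minimizer (Omega : set plane)
    (omega0 omega : plane -> R) : Prop :=
  [/\ smooth Omega omega, coadjoint_orbit Omega omega0 omega
    & forall omega', coadjoint_orbit Omega omega0 omega' ->
        (energy Omega omega <= energy Omega omega')%E].

End planar_domain.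

Arguments unit_disk R : clear implicits.

(* Main.v *)
From HB Require Import structures.
Require Import Defs.
From mathcomp Require Import all_boot all_order all_algebra.
From mathcomp Require Import all_classical all_reals all_analysis.
From mathcomp Require Import measurable_realfun.
From mathcomp Require Import ring lra.

Set Implicit Arguments.
Unset Strict Implicit.
Unset Printing Implicit Defensive.

Import Order.TTheory GRing.Theory Num.Theory.
Import numFieldNormedType.Exports.

Local Open Scope classical_set_scope.
Local Open Scope ring_scope.

(* Take [omega0 x = 2 - |x|^2].  Let [omega] lie in its orbit, with stream function
   [psi].  Since [laplacian psi = 2] where [omega] is maximal, there is a point [q] with
   [grad omega . grad psi < 0].  Near [q] use the commutator [T] of two small shears:
   it preserves area, has compact support, and replacing [omega] by [omega \o T] or by
   [omega \o T^-1] changes the energy at first order by integrals of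
   [psi * (omega \o T^{+-1} - omega)] whose sum is
   [- int (psi \o T - psi) * (omega \o T - omega)], which is at least [c * e^4] for a
   commutator of size [e].  By convexity of the energy it is enough to compare with the
   stream function of the new vorticity, which differs from [psi] by [O(e^2)] (barrier
   argument), hence changes the gain by [O(e^5)] only.  So one of the two competitors
   has a smaller energy, and no minimizer exists.

   The energy of a vorticity is only meaningful once the Dirichlet problem is solved:
   for polynomial right-hand sides the solution is explicit, and the general case
   follows by approximation in C^2 from interior gradient estimates of Bernstein
   type. *)

(** * Calculus in the plane *)

(** Minimizing the energy over rearrangements would force the stream function to be largest where
    the vorticity is largest. But the vorticity is positive, so its stream function is strictly
    subharmonic and has no local maximum at the interior point where the vorticity peaks. This
    conflict produces [q].

    The competitors must be smooth with smooth inverse, preserve area exactly and fix everything off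
    a small box. Shears have all this except the last: a single shear moves a whole strip. In a
    commutator, a shear that acts alone is undone by its inverse.

    The two differences in the gain are of order [e] on an area of order [e^2], hence [e^4]; an
    error [O(e^2)] in the stream function is multiplied by a vorticity change [O(e)] on area
    [O(e^2)], hence [e^5]. Shears follow the axes, so the condition at [q] is used in the form that
    one of the two coordinate products of the gradients is negative, and the box is made thin in the
    other direction.

    Nothing is known about gradients of stream functions at the boundary, so energies are first
    compared with weights that vanish near it. *)

Lemma differential_unique (K : numFieldType) (V W : normedModType K)
    (f : V -> W) (df : {linear V -> W}) (x : V) :
  continuous df ->
  (forall e, 0 < e -> \forall h \near (0 : V),
     `|f (h + x) - (f x + df h)| <= e * `|h|) ->
  differentiable f x /\ 'd f x = df :> (V -> W).
Proof.
move=> cdf H.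
have fdf : f \o shift x = cst (f x) + df +o_ 0 id.
  by apply/eqaddoP => e e0; exact: H.
have E := diff_unique cdf fdf.
by split=> //; apply/diff_locallyP; rewrite E; split.
Qed.

Section partial_derivatives.
Variable R : realType.
Local Notation plane := (R * R)%type.
Implicit Types (f g : plane -> R) (x : plane).

Lemma shift_e1 (h : R) x : h *: ((1, 0) : plane) + x = (h *: (1 : R) + x.1, x.2).
Proof. by case: x => a b; congr pair; rewrite /= scaler0 add0r. Qed.

Lemma shift_e2 (h : R) x : h *: ((0, 1) : plane) + x = (x.1, h *: (1 : R) + x.2).
Proof. by case: x => a b; congr pair; rewrite /= scaler0 add0r. Qed.

Lemma derivable_e1 f x :
  derivable f x (1, 0) = derivable (fun t => f (t, x.2)) x.1 1.
Proof.
rewrite /derivable; set g1 := fun h => h^-1 *: _; set g2 := fun h => h^-1 *: _.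
suff -> : g1 = g2 by [].
apply/funext => h; rewrite /g1 /g2 /= shift_e1; by case: x {g1 g2}.
Qed.

Lemma derivable_e2 f x :
  derivable f x (0, 1) = derivable (fun t => f (x.1, t)) x.2 1.
Proof.
rewrite /derivable; set g1 := fun h => h^-1 *: _; set g2 := fun h => h^-1 *: _.
suff -> : g1 = g2 by [].
apply/funext => h; rewrite /g1 /g2 /= shift_e2; by case: x {g1 g2}.
Qed.

Lemma partial1E f x : partial1 f x = 'D_1 (fun t => f (t, x.2)) x.1.
Proof.
rewrite /partial1 /derive; set g1 := fun h => h^-1 *: _.
set g2 := fun h => h^-1 *: _; suff -> : g1 = g2 by [].
apply/funext => h; rewrite /g1 /g2 /= shift_e1; by case: x {g1 g2}.
Qed.

Lemma partial2E f x : partial2 f x = 'D_1 (fun t => f (x.1, t)) x.2.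
Proof.
rewrite /partial2 /derive; set g1 := fun h => h^-1 *: _.
set g2 := fun h => h^-1 *: _; suff -> : g1 = g2 by [].
apply/funext => h; rewrite /g1 /g2 /= shift_e2; by case: x {g1 g2}.
Qed.

Lemma mean_value (g : R -> R) (a b : R) :
  (forall t, Num.min a b <= t <= Num.max a b -> derivable g t 1) ->
  exists2 c, Num.min a b <= c <= Num.max a b & g b - g a = 'D_1 g c * (b - a).
Proof.
wlog ab : a b / a <= b => [H|].
  have /orP[ab|ba] := le_total a b; first exact: H.
  move=> dg; have [|c cab E] := H _ _ ba.
    by move=> t; rewrite minC maxC; exact: dg.
  exists c; first by rewrite minC maxC.
  by rewrite -(opprB (g a)) E -mulrN opprB.
rewrite (min_idPl ab) (max_idPr ab) => dg.
have [c cab E] : exists2 c, c \in `[a, b] & g b - g a = 'D_1 g c * (b - a).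
  apply: (@MVT_segment _ g ('D_1 g)) => // [t tab|].
    by apply/derivableP/dg; move: tab; rewrite in_itv /= => /andP[/ltW-> /ltW->].
  apply: derivable_within_continuous => t; rewrite in_itv /= => tab.
  exact: dg.
by exists c => //; move: cab; rewrite in_itv.
Qed.

Lemma mean_value_bound (g : R -> R) (a b l e : R) :
  (forall t, Num.min a b <= t <= Num.max a b -> derivable g t 1) ->
  (forall t, Num.min a b <= t <= Num.max a b -> `|'D_1 g t - l| <= e) ->
  `|g b - g a - l * (b - a)| <= e * `|b - a|.
Proof.
move=> dg le; have [c cab ->] := mean_value dg.
by rewrite -mulrBl normrM ler_wpM2r// le.
Qed.

Lemma in_ball_plane (x y : plane) (e : R) :
  ball x e y <-> `|x.1 - y.1| < e /\ `|x.2 - y.2| < e.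
Proof. by split=> [[]|[]]. Qed.

Lemma between_norm (a k t : R) : Num.min a (k + a) <= t <= Num.max a (k + a) ->
  `|a - t| <= `|k|.
Proof.
move=> /andP[h1 h2]; rewrite ler_norml.
have := ler_norm k; have := ler_norm (- k); rewrite normrN.
by move: h1 h2; case: (leP a (k + a)) => ?; lra.
Qed.

(** The increment is split at the corner [(x.1, h.2 + x.2)], so that each half is a mean value
    estimate in one variable with the derivative close to its value at [x]. *)
Lemma C1_differential (U : set plane) f x : open U -> U x -> Ck 1 U f ->
  differentiable f x /\
  forall v, 'd f x v = v.1 * partial1 f x + v.2 * partial2 f x.
Proof.
move=> oU Ux [_ [d1 d2 [c1 _] [c2 _]]].
pose df (v : plane) := v.1 * partial1 f x + v.2 * partial2 f x.
have lin_df : linear df.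
  by move=> k u v; rewrite /df /= /GRing.scale /=; ring.
pose dfM := GRing.isLinear.Build _ _ _ _ _ lin_df.
pose dfL : {linear plane -> R} := HB.pack df dfM.
have cdf : continuous dfL.
  move=> v; rewrite /= /df.
  by apply: cvgD; apply: cvgM; [exact: cvg_fst|exact: cvg_cst|exact: cvg_snd|exact: cvg_cst].
suff [? E] : differentiable f x /\ 'd f x = dfL :> (plane -> R).
  by split=> // v; rewrite E.
apply: differential_unique => // e e0.
  have e20 : 0 < e / 2 by rewrite divr_gt0.
  have := c1 x Ux => /cvgrPdist_lt /(_ _ e20) /nbhs_ballP[r1 r10 H1].
  have := c2 x Ux => /cvgrPdist_lt /(_ _ e20) /nbhs_ballP[r2 r20 H2].
  have := open_nbhs_nbhs (conj oU Ux) => /nbhs_ballP[r3 r30 H3].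
  apply/nbhs_ballP; exists (Num.min r1 (Num.min r2 r3)) => /=.
    by rewrite !lt_min r10 r20 r30.
  move=> h /in_ball_plane; rewrite /= !sub0r !normrN !lt_min => -[].
  move=> /and3P[h11 h12 h13] /and3P[h21 h22 h23].
  have Hx y : `|x.1 - y.1| <= `|h.1| -> `|x.2 - y.2| <= `|h.2| ->
    [/\ U y, `|partial1 f y - partial1 f x| <= e/2 &
      `|partial2 f y - partial2 f x| <= e/2].
    move=> y1 y2; split.
    - by apply: H3; apply/in_ball_plane; split; apply: le_lt_trans; eassumption.
    - rewrite distrC; apply/ltW/H1; apply/in_ball_plane.
      by split; apply: le_lt_trans; eassumption.
    - rewrite distrC; apply/ltW/H2; apply/in_ball_plane.
      by split; apply: le_lt_trans; eassumption.
  have H1x t : Num.min x.1 (h.1 + x.1) <= t <= Num.max x.1 (h.1 + x.1) ->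
      U (t, h.2 + x.2) /\ `|partial1 f (t, h.2 + x.2) - partial1 f x| <= e/2.
    move=> /between_norm tt.
    have h0 : `|x.2 - (h.2 + x.2)| <= `|h.2| by rewrite opprD addrCA subrr addr0 normrN.
    by have [? ? _] := Hx (t, h.2 + x.2) tt h0.
  have H2x t : Num.min x.2 (h.2 + x.2) <= t <= Num.max x.2 (h.2 + x.2) ->
      U (x.1, t) /\ `|partial2 f (x.1, t) - partial2 f x| <= e/2.
    move=> /between_norm tt; have h0 : `|x.1 - x.1| <= `|h.1| by rewrite subrr normr0.
    by have [? _ ?] := Hx (x.1, t) h0 tt.
  have E1 : `|f (h.1 + x.1, h.2 + x.2) - f (x.1, h.2 + x.2)
               - partial1 f x * h.1| <= e/2 * `|h.1|.
    have := @mean_value_bound (fun t => f (t, h.2 + x.2)) x.1 (h.1 + x.1) (partial1 f x) (e/2).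
    rewrite addrK /=; apply => t /H1x[Ut ht].
      by rewrite -(derivable_e1 f (t, h.2 + x.2)); exact: d1.
    by rewrite -(partial1E f (t, h.2 + x.2)).
  have E2 : `|f (x.1, h.2 + x.2) - f (x.1, x.2)
               - partial2 f x * h.2| <= e/2 * `|h.2|.
    have := @mean_value_bound (fun t => f (x.1, t)) x.2 (h.2 + x.2) (partial2 f x) (e/2).
    rewrite addrK /=; apply => t /H2x[Ut ht].
      by rewrite -(derivable_e2 f (x.1, t)); exact: d2.
    by rewrite -(partial2E f (x.1, t)).
  have -> : f (h + x) - (f x + dfL h) =
      (f (h.1 + x.1, h.2 + x.2) - f (x.1, h.2 + x.2) - partial1 f x * h.1)
      + (f (x.1, h.2 + x.2) - f (x.1, x.2) - partial2 f x * h.2).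
    rewrite /= /df.
    have -> : f (h + x) = f (h.1 + x.1, h.2 + x.2) by [].
    have -> : f x = f (x.1, x.2) by case: (x).
    ring.
  have hn1 : `|h.1| <= `|h| by rewrite prod_normE le_max lexx.
  have hn2 : `|h.2| <= `|h| by rewrite prod_normE le_max lexx orbT.
  apply: (le_trans (ler_normD _ _)); apply: (le_trans (lerD E1 E2)).
  rewrite -mulrDr (splitr e) mulrDl -mulrDr; nra.
Qed.
End partial_derivatives.

Lemma derive_comp_pair (K : numFieldType) (U V W X : normedModType K)
    (F : V * W -> X) (f : U -> V) (g : U -> W) (x v : U) :
  differentiable f x -> differentiable g x -> differentiable F (f x, g x) ->
  derivable (fun y => F (f y, g y)) x v /\
  'D_v (fun y => F (f y, g y)) x = 'd F (f x, g x) ('D_v f x, 'D_v g x).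
Proof.
move=> df dg dF.
have dp : differentiable (fun y => (f y, g y)) x by exact: differentiable_pair.
have dc : differentiable (F \o (fun y => (f y, g y))) x.
  exact: differentiable_comp.
split; first exact: diff_derivable dc.
rewrite -[LHS]/('D_v (F \o (fun y => (f y, g y))) x) (deriveE v dc).
by rewrite (diff_comp dp dF) /= (diff_pair df dg) (deriveE v df) (deriveE v dg).
Qed.

Lemma is_deriveP (K : numFieldType) (V W : normedModType K) (f : V -> W)
    (x v : V) (d : W) :
  is_derive x v f d -> derivable f x v /\ 'D_v f x = d.
Proof. by case. Qed.

(** * Stability of C^k functions and symmetry of second derivatives *)

Section smooth_calculus.
Variable R : realType.
Local Notation plane := (R * R)%type.
Implicit Types (f g : plane -> R) (x : plane).

Lemma Ck_continuous k U f x : Ck k U f -> U x -> {for x, continuous f}.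
Proof. by case: k => [[H _]|k [H _]]; exact: H. Qed.

Lemma CkW k U f : Ck k.+1 U f -> Ck k U f.
Proof.
elim: k f => [|k IH] f; first by case=> cf _; exact: (conj cf I).
case=> cf [d1 d2 C1 C2]; split; first exact: cf.
split; [exact: d1|exact: d2|exact (IH _ C1)|exact (IH _ C2)].
Qed.

Lemma Ck_le j k U f : (j <= k)%N -> Ck k U f -> Ck j U f.
Proof.
move=> /subnK <-; elim: (k - j)%N => [//|n IH].
by move/CkW; exact: IH.
Qed.

Lemma derive_line (V W : normedModType R) (f : V -> W) (x v : V) :
  'D_v f x = 'D_1 (fun h : R => f (h *: v + x)) 0.
Proof.
rewrite /derive; set g1 := fun h => h^-1 *: _; set g2 := fun h => h^-1 *: _.
suff -> : g1 = g2 by [].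
by rewrite funeqE /g1 /g2 => h /=; rewrite addr0 scale0r add0r [_%:A]mulr1.
Qed.

(** [g1] and [g2] are only derivable in the direction [v]. Restricted to the line through [x] they
    become functions of one real variable, for which derivability is differentiability and the chain
    rule applies. *)
Lemma is_derive_comp2 (V : normedModType R) (U : set plane) (F : plane -> R)
    (g1 g2 : V -> R) (x v : V) :
  open U -> U (g1 x, g2 x) -> Ck 1 U F ->
  derivable g1 x v -> derivable g2 x v ->
  is_derive x v (fun y => F (g1 y, g2 y))
    (partial1 F (g1 x, g2 x) * 'D_v g1 x + partial2 F (g1 x, g2 x) * 'D_v g2 x).
Proof.
move=> oU Ux CF d1 d2.
pose p1 (h : R) : R := g1 (h *: v + x); pose p2 (h : R) : R := g2 (h *: v + x).
have dp1 : differentiable p1 0.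
  exact: ((derivable1_diffP p1 0).1 ((derivable1P g1 x v).1 d1)).
have dp2 : differentiable p2 0.
  exact: ((derivable1_diffP p2 0).1 ((derivable1P g2 x v).1 d2)).
have p0 : (p1 0, p2 0) = (g1 x, g2 x) by rewrite /p1 /p2 scale0r add0r.
have [dF EF] := C1_differential oU Ux CF.
have dF' : differentiable F (p1 0, p2 0) by rewrite p0.
have [dc Ec] := derive_comp_pair (1 : R) dp1 dp2 dF'.
apply: DeriveDef.
  exact: ((derivable1P _ x v).2 dc).
rewrite derive_line [LHS]Ec p0 EF /=.
by rewrite (derive_line g1) (derive_line g2); congr (_ + _); rewrite [LHS]mulrC.
Qed.

Lemma is_derive_comp1 (V : normedModType R) (h : R -> R) (g : V -> R) (x v : V) :
  derivable h (g x) 1 -> derivable g x v ->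
  is_derive x v (fun y => h (g y)) ('D_1 h (g x) * 'D_v g x).
Proof.
move=> dh dg; pose p (t : R) : R := g (t *: v + x).
have dp : derivable p 0 1 := (derivable1P g x v).1 dg.
have p0 : p 0 = g x by rewrite /p scale0r add0r.
have dhp : derivable h (p 0) 1 by rewrite p0.
have D := derivableP dhp.
have D2 := derivableP dp.
have H := is_derive1_comp D D2.
apply: DeriveDef.
  apply: (derivable1P (fun y => h (g y)) x v).2; exact: (is_deriveP H).1.
rewrite derive_line (derive_line g) -[LHS]/('D_1 (h \o p) 0).
by rewrite (is_deriveP H).2 p0.
Qed.

Lemma partial1D f g x : derivable f x (1, 0) -> derivable g x (1, 0) ->
  partial1 (fun y => f y + g y) x = partial1 f x + partial1 g x.
Proof. by move=> df dg; exact: (deriveD df dg). Qed.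

Lemma partial2D f g x : derivable f x (0, 1) -> derivable g x (0, 1) ->
  partial2 (fun y => f y + g y) x = partial2 f x + partial2 g x.
Proof. by move=> df dg; exact: (deriveD df dg). Qed.

Lemma partial1M f g x : derivable f x (1, 0) -> derivable g x (1, 0) ->
  partial1 (fun y => f y * g y) x = partial1 f x * g x + f x * partial1 g x.
Proof.
move=> df dg; rewrite [LHS](deriveM df dg) addrC.
by rewrite [_ *: 'D_ _ f x]mulrC.
Qed.

Lemma partial2M f g x : derivable f x (0, 1) -> derivable g x (0, 1) ->
  partial2 (fun y => f y * g y) x = partial2 f x * g x + f x * partial2 g x.
Proof.
move=> df dg; rewrite [LHS](deriveM df dg) addrC.
by rewrite [_ *: 'D_ _ f x]mulrC.
Qed.

Lemma CkD k f g : Ck k setT f -> Ck k setT g -> Ck k setT (fun x => f x + g x).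
Proof.
elim: k f g => [|k IH] f g [cf Hf] [cg Hg]; (split; first by
  move=> x _; apply: continuousD; [exact: cf|exact: cg]); first exact: I.
case: Hf Hg => f1 f2 Cf1 Cf2 [g1 g2 Cg1 Cg2]; split=> [x Tx|x Tx||].
- exact: derivableD (f1 x Tx) (g1 x Tx).
- exact: derivableD (f2 x Tx) (g2 x Tx).
- rewrite (_ : partial1 _ = fun x => partial1 f x + partial1 g x); first exact: (IH _ _ Cf1 Cg1).
  by apply/funext => x; apply: partial1D; [exact: f1|exact: g1].
- rewrite (_ : partial2 _ = fun x => partial2 f x + partial2 g x); first exact: (IH _ _ Cf2 Cg2).
  by apply/funext => x; apply: partial2D; [exact: f2|exact: g2].
Qed.

Lemma CkM k f g : Ck k setT f -> Ck k setT g -> Ck k setT (fun x => f x * g x).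
Proof.
elim: k f g => [|k IH] f g Hf0 Hg0; have [cf Hf] := Hf0; have [cg Hg] := Hg0;
  (split; first by move=> x _; apply: continuousM; [exact: cf|exact: cg]);
  first exact: I.
have Cf := CkW Hf0; have Cg := CkW Hg0.
case: Hf Hg => f1 f2 Cf1 Cf2 [g1 g2 Cg1 Cg2]; split=> [x Tx|x Tx||].
- exact: derivableM (f1 x Tx) (g1 x Tx).
- exact: derivableM (f2 x Tx) (g2 x Tx).
- rewrite (_ : partial1 _ = fun x => partial1 f x * g x + f x * partial1 g x).
    exact: (CkD (IH _ _ Cf1 Cg) (IH _ _ Cf Cg1)).
  by apply/funext => x; apply: partial1M; [exact: f1|exact: g1].
- rewrite (_ : partial2 _ = fun x => partial2 f x * g x + f x * partial2 g x).
    exact: (CkD (IH _ _ Cf2 Cg) (IH _ _ Cf Cg2)).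
  by apply/funext => x; apply: partial2M; [exact: f2|exact: g2].
Qed.

Lemma partial1_cst (c : R) : partial1 (fun _ : plane => c) = (fun _ => 0).
Proof. by apply/funext => x; exact: derive_cst. Qed.

Lemma partial2_cst (c : R) : partial2 (fun _ : plane => c) = (fun _ => 0).
Proof. by apply/funext => x; exact: derive_cst. Qed.

Lemma Ck_cst k (c : R) : Ck k setT (fun _ : plane => c).
Proof.
elim: k c => [|k IH] c; (split; first by move=> x _; exact: cvg_cst).
  exact: I.
split=> [x _|x _||]; try exact: derivable_cst.
- by rewrite partial1_cst.
- by rewrite partial2_cst.
Qed.

Lemma partial1_fst : partial1 (fun x : plane => x.1) = (fun _ => 1).
Proof. by apply/funext => x; rewrite partial1E /= derive_id. Qed.

Lemma partial2_fst : partial2 (fun x : plane => x.1) = (fun _ => 0).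
Proof. by apply/funext => x; rewrite partial2E /= derive_cst. Qed.

Lemma partial1_snd : partial1 (fun x : plane => x.2) = (fun _ => 0).
Proof. by apply/funext => x; rewrite partial1E /= derive_cst. Qed.

Lemma partial2_snd : partial2 (fun x : plane => x.2) = (fun _ => 1).
Proof. by apply/funext => x; rewrite partial2E /= derive_id. Qed.

Lemma Ck_fst k : Ck k setT (fun x : plane => x.1).
Proof.
case: k => [|k]; (split; first by move=> x _; exact: cvg_fst).
  exact: I.
split=> [x _|x _||].
- by rewrite derivable_e1 /=; exact: derivable_id.
- by rewrite derivable_e2 /=; exact: derivable_cst.
- by rewrite partial1_fst; exact: Ck_cst.
- by rewrite partial2_fst; exact: Ck_cst.
Qed.

Lemma Ck_snd k : Ck k setT (fun x : plane => x.2).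
Proof.
case: k => [|k]; (split; first by move=> x _; exact: cvg_snd).
  exact: I.
split=> [x _|x _||].
- by rewrite derivable_e1 /=; exact: derivable_cst.
- by rewrite derivable_e2 /=; exact: derivable_id.
- by rewrite partial1_snd; exact: Ck_cst.
- by rewrite partial2_snd; exact: Ck_cst.
Qed.

Lemma continuous_comp2 (T : topologicalType) (F : plane -> R) (g1 g2 : T -> R)
    (x : T) :
  {for x, continuous g1} -> {for x, continuous g2} ->
  {for (g1 x, g2 x), continuous F} ->
  {for x, continuous (fun y => F (g1 y, g2 y))}.
Proof.
move=> c1 c2 cF.
exact: (cvg_comp (fun y => (g1 y, g2 y)) F (cvg_pair c1 c2) cF).
Qed.

Lemma Ck_comp k F (g1 g2 : plane -> R) :
  Ck k setT F -> Ck k setT g1 -> Ck k setT g2 ->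
  Ck k setT (fun x => F (g1 x, g2 x)).
Proof.
have cont (F' : plane -> R) (h1 h2 : plane -> R) :
    (forall x, setT x -> {for x, continuous F'}) ->
    (forall x, setT x -> {for x, continuous h1}) ->
    (forall x, setT x -> {for x, continuous h2}) ->
    forall x, setT x -> {for x, continuous (fun x => F' (h1 x, h2 x))}.
  move=> cF c1 c2 x _.
  exact: (continuous_comp2 (c1 x I) (c2 x I) (cF (h1 x, h2 x) I)).
elim: k F g1 g2 => [|k IH] F g1 g2 HF H1 H2.
  by case: HF H1 H2 => cF _ [c1 _] [c2 _]; split; [exact: cont|exact: I].
have C1F : Ck 1 setT F by apply: Ck_le HF.
have CF := CkW HF; have C1 := CkW H1; have C2 := CkW H2.
case: HF H1 H2 => cF [F1 F2 CF1 CF2] [c1 [d11 d12 C11 C12]].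
move=> [c2 [d21 d22 C21 C22]].
have dv1 x := is_derive_comp2 openT I C1F (d11 x I) (d21 x I).
have dv2 x := is_derive_comp2 openT I C1F (d12 x I) (d22 x I).
split; first exact: cont.
split=> [x _|x _||].
- exact: (is_deriveP (dv1 x)).1.
- exact: (is_deriveP (dv2 x)).1.
- rewrite (_ : partial1 _ = fun x => partial1 F (g1 x, g2 x) * partial1 g1 x
      + partial2 F (g1 x, g2 x) * partial1 g2 x).
    exact: (CkD (CkM (IH _ _ _ CF1 C1 C2) C11) (CkM (IH _ _ _ CF2 C1 C2) C21)).
  by apply/funext => x; exact: (is_deriveP (dv1 x)).2.
- rewrite (_ : partial2 _ = fun x => partial1 F (g1 x, g2 x) * partial2 g1 x
      + partial2 F (g1 x, g2 x) * partial2 g2 x).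
    exact: (CkD (CkM (IH _ _ _ CF1 C1 C2) C12) (CkM (IH _ _ _ CF2 C1 C2) C22)).
  by apply/funext => x; exact: (is_deriveP (dv2 x)).2.
Qed.

Definition Cinf f := forall k, Ck k setT f.

Lemma Cinf_cst (c : R) : Cinf (fun _ => c).
Proof. by move=> k; exact: Ck_cst. Qed.

Lemma Cinf_fst : Cinf (fun x => x.1).
Proof. by move=> k; exact: Ck_fst. Qed.

Lemma Cinf_snd : Cinf (fun x => x.2).
Proof. by move=> k; exact: Ck_snd. Qed.

Lemma CinfD f g : Cinf f -> Cinf g -> Cinf (fun x => f x + g x).
Proof. by move=> Cf Cg k; exact: CkD. Qed.

Lemma CinfM f g : Cinf f -> Cinf g -> Cinf (fun x => f x * g x).
Proof. by move=> Cf Cg k; exact: CkM. Qed.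

Lemma CinfZ c f : Cinf f -> Cinf (fun x => c * f x).
Proof. by move=> Cf; apply: CinfM => //; exact: Cinf_cst. Qed.

Lemma CinfN f : Cinf f -> Cinf (fun x => - f x).
Proof.
move=> Cf; rewrite (_ : (fun _ => _) = fun x => (- 1) * f x).
  exact: CinfZ.
by apply/funext => x; rewrite mulN1r.
Qed.

Lemma CinfB f g : Cinf f -> Cinf g -> Cinf (fun x => f x - g x).
Proof. by move=> Cf Cg; apply: CinfD => //; exact: CinfN. Qed.

Lemma CinfX f n : Cinf f -> Cinf (fun x => f x ^+ n).
Proof.
move=> Cf; elim: n => [|n IH]; first exact: Cinf_cst.
rewrite (_ : (fun _ => _) = fun x => f x * f x ^+ n); first exact: CinfM.
by apply/funext => x; rewrite exprS.
Qed.

Lemma Cinf_comp F g1 g2 : Cinf F -> Cinf g1 -> Cinf g2 ->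
  Cinf (fun x => F (g1 x, g2 x)).
Proof. by move=> CF C1 C2 k; exact: Ck_comp. Qed.

Lemma Cinf_partial1 f : Cinf f -> Cinf (partial1 f).
Proof. by move=> Cf k; have [_ []] := Cf k.+1. Qed.

Lemma Cinf_partial2 f : Cinf f -> Cinf (partial2 f).
Proof. by move=> Cf k; have [_ []] := Cf k.+1. Qed.

Lemma Cinf_derivable1 f x : Cinf f -> derivable f x (1, 0).
Proof. by move=> Cf; have [_ [d _ _ _]] := Cf 1; exact: d. Qed.

Lemma Cinf_derivable2 f x : Cinf f -> derivable f x (0, 1).
Proof. by move=> Cf; have [_ [_ d _ _]] := Cf 1; exact: d. Qed.

Lemma Cinf_continuous f : Cinf f -> continuous f.
Proof. by move=> Cf x; exact: (Ck_continuous (Cf 0%N) I). Qed.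

Lemma close_eq (u v p q e : R) :
  p = q -> `|u - p| < e / 2 -> `|v - q| < e / 2 -> `|u - v| <= e.
Proof.
move=> <-; rewrite !ltr_norml ler_norml => /andP[? ?] /andP[? ?].
by apply/andP; split; lra.
Qed.

(** The second difference of [f] over a square of side [h] is evaluated by the mean value theorem in
    both orders; the two mixed derivatives thus agree at two points of the square, and continuity
    brings both points to [(a, b)]. *)
Lemma schwarz f : Ck 2 setT f -> partial1 (partial2 f) = partial2 (partial1 f).
Proof.
move=> Cf; apply/funext => -[a b].
have [_ [d1 d2 [_ [_ d12 _ [c12 _]]] [_ [d21 _ [c21 _] _]]]] := Cf.
apply/eqP; rewrite -subr_eq0 -normr_le0; apply/ler_addgt0Pl => e e0.
rewrite addr0.
have e20 : 0 < e / 2 by rewrite divr_gt0.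
have := c21 (a, b) I => /cvgrPdist_lt /(_ _ e20) /nbhs_ballP[r1 r10 H1].
have := c12 (a, b) I => /cvgrPdist_lt /(_ _ e20) /nbhs_ballP[r2 r20 H2].
have [h [h0 hr1 hr2]] : exists h, [/\ 0 < h, h < r1 & h < r2].
  exists (Num.min r1 r2 / 2).
  rewrite !ltr_pdivrMr // !gt_min !ltr_pMr // ltr1n orbT.
  by rewrite divr_gt0 // lt_min r10.
have [D mem_closed_disk] : exists D,
    D = f (a + h, b + h) - f (a + h, b) - (f (a, b + h) - f (a, b)) by eexists.
have ordh z : Num.min z (z + h) = z /\ Num.max z (z + h) = z + h.
  by split; [apply/min_idPl|apply/max_idPr]; rewrite lerDl ltW.
have [c1 /andP[c1a c1b] E1] : exists2 c, a <= c <= a + h &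
    D = (partial1 f (c, b + h) - partial1 f (c, b)) * h.
  have [|c] := @mean_value R (fun t => f (t, b + h) - f (t, b)) a (a + h).
    move=> t _; apply: derivableB.
    - by have := d1 (t, b + h) I; rewrite derivable_e1.
    - by have := d1 (t, b) I; rewrite derivable_e1.
  have [-> ->] := ordh a => cab E; exists c; first exact: cab.
  rewrite mem_closed_disk [LHS]E [a + h]addrC addrK deriveB ?partial1E //.
  - by have := d1 (c, b + h) I; rewrite derivable_e1.
  - by have := d1 (c, b) I; rewrite derivable_e1.
have [c2 /andP[c2a c2b] E2] : exists2 c, b <= c <= b + h &
    D = partial2 (partial1 f) (c1, c) * h * h.
  have [|c] := @mean_value R (fun t => partial1 f (c1, t)) b (b + h).
    by move=> t _; have := d12 (c1, t) I; rewrite derivable_e2.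
  have [-> ->] := ordh b => cab E; exists c; first exact: cab.
  by rewrite E1 E [b + h]addrC addrK partial2E.
have [k1 /andP[k1a k1b] F1] : exists2 c, b <= c <= b + h &
    D = (partial2 f (a + h, c) - partial2 f (a, c)) * h.
  have [|c] := @mean_value R (fun t => f (a + h, t) - f (a, t)) b (b + h).
    move=> t _; apply: derivableB.
    - by have := d2 (a + h, t) I; rewrite derivable_e2.
    - by have := d2 (a, t) I; rewrite derivable_e2.
  have [-> ->] := ordh b => cab E; exists c; first exact: cab.
  transitivity (f (a + h, b + h) - f (a, b + h) - (f (a + h, b) - f (a, b))).
    by rewrite mem_closed_disk; ring.
  rewrite [LHS]E [b + h]addrC addrK deriveB ?partial2E //.
  - by have := d2 (a + h, c) I; rewrite derivable_e2.
  - by have := d2 (a, c) I; rewrite derivable_e2.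
have [k2 /andP[k2a k2b] F2] : exists2 c, a <= c <= a + h &
    D = partial1 (partial2 f) (c, k1) * h * h.
  have [|c] := @mean_value R (fun t => partial2 f (t, k1)) a (a + h).
    by move=> t _; have := d21 (t, k1) I; rewrite derivable_e1.
  have [-> ->] := ordh a => cab E; exists c; first exact: cab.
  have {}E : partial2 f (a + h, k1) - partial2 f (a, k1) =
      partial1 (partial2 f) (c, k1) * h.
    rewrite (partial1E (partial2 f) (c, k1)); apply: etrans E _.
    by congr (_ * _); rewrite [a + h]addrC addrK.
  exact: etrans F1 (congr1 (fun z => z * h) E).
have E : partial1 (partial2 f) (k2, k1) = partial2 (partial1 f) (c1, c2).
  have h_neq0 : h != 0 by rewrite gt_eqF.
  exact: (mulIf h_neq0 (mulIf h_neq0 (etrans (esym F2) E2))).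
have B1 : `|partial1 (partial2 f) (a, b) - partial1 (partial2 f) (k2, k1)| < e / 2.
  by apply: H1; apply/in_ball_plane; split=> /=; rewrite ltr_norml; lra.
have B2 : `|partial2 (partial1 f) (a, b) - partial2 (partial1 f) (c1, c2)| < e / 2.
  by apply: H2; apply/in_ball_plane; split=> /=; rewrite ltr_norml; lra.
exact: close_eq E B1 B2.
Qed.

Lemma Cinf_schwarz f : Cinf f -> partial1 (partial2 f) = partial2 (partial1 f).
Proof. by move=> Cf; exact: schwarz (Cf 2%N). Qed.

End smooth_calculus.

(** * Maximum principle and gradient estimate *)

Section maximum_principle.
Variable R : realType.
Local Notation plane := (R * R)%type.
Implicit Types (f g : plane -> R) (x : plane).

Lemma is_derive_e1 f x d :
  is_derive x (1, 0) f d <-> is_derive x.1 1 (fun t => f (t, x.2)) d.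
Proof.
split=> /is_deriveP[D E]; apply: DeriveDef.
- by rewrite -derivable_e1.
- by rewrite -E -[RHS]/(partial1 f x) partial1E.
- by rewrite derivable_e1.
- by rewrite -E -[LHS]/(partial1 f x) partial1E.
Qed.

Lemma is_derive_e2 f x d :
  is_derive x (0, 1) f d <-> is_derive x.2 1 (fun t => f (x.1, t)) d.
Proof.
split=> /is_deriveP[D E]; apply: DeriveDef.
- by rewrite -derivable_e2.
- by rewrite -E -[RHS]/(partial2 f x) partial2E.
- by rewrite derivable_e2.
- by rewrite -E -[LHS]/(partial2 f x) partial2E.
Qed.

Definition nsq x := x.1 ^+ 2 + x.2 ^+ 2.

(** The parameter is the squared radius, which avoids square roots throughout. *)
Definition cdisk (s : R) : set plane := [set x | nsq x <= s].

Lemma nsq_continuous : continuous nsq.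
Proof.
move=> x; apply: cvgD.
  by apply: (@cvg_comp _ _ _ fst (fun t : R => t ^+ 2)); [exact: cvg_fst|exact: exprn_continuous].
by apply: (@cvg_comp _ _ _ snd (fun t : R => t ^+ 2)); [exact: cvg_snd|exact: exprn_continuous].
Qed.

Lemma open_disk (s : R) : open [set x | nsq x < s].
Proof.
have := open_comp (fun x _ => @nsq_continuous x) (@open_lt R s).
by rewrite /preimage /=; exact.
Qed.

Lemma cdisk_closed (s : R) : closed (cdisk s).
Proof.
have := closed_comp (fun x _ => @nsq_continuous x) (@closed_le R s).
by rewrite /preimage /=; exact.
Qed.

Lemma cdisk_bound (s : R) x : 0 <= s -> cdisk s x ->
  `|x.1| <= 1 + s /\ `|x.2| <= 1 + s.
Proof.
rewrite /cdisk /nsq /= => s0 H; rewrite !ler_norml.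
have := sqr_ge0 x.1; have := sqr_ge0 x.2; move: H; set a := x.1; set b := x.2.
by move=> ? ? ?; split; apply/andP; split; nra.
Qed.

Lemma cdisk_compact (s : R) : 0 <= s -> compact (cdisk s).
Proof.
move=> s0; have C1 := @segment_compact R (- (1 + s)) (1 + s).
apply: (subclosed_compact (@cdisk_closed s) (compact_setX C1 C1)).
move=> x /(cdisk_bound s0); rewrite !ler_norml => -[h1 h2].
by split; rewrite /= in_itv.
Qed.

(** The derivative of [G = g + d t^2] vanishes at the maximum. If [k + 2 d] were positive, that
    derivative would be positive just to the right of [x] and [G] would increase there. *)
Lemma second_derivative_at_max (g g' : R -> R) (x k e d : R) : 0 < e ->
  (forall t, `|t - x| < e -> is_derive t 1 g (g' t)) ->
  is_derive x 1 g' k ->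
  (forall t, `|t - x| < e -> g t + d * t ^+ 2 <= g x + d * x ^+ 2) ->
  k <= - (2 * d).
Proof.
move=> e0 dg dg' gmax.
pose G t := g t + d * t ^+ 2; pose G' t := g' t + d * (2 * t).
have dG t : `|t - x| < e -> is_derive t 1 G (G' t).
  move=> /dg dgt; apply: is_deriveD; apply: is_deriveZ.
  by apply: is_derive_eq; rewrite /= /GRing.scale /=; ring.
have G'x : G' x = 0.
  have xin : x \in `]x - e, x + e[ by rewrite in_itv /=; apply/andP; split; lra.
  have itvE t : t \in `]x - e, x + e[ -> `|t - x| < e.
    by rewrite in_itv /= ltr_norml => /andP[? ?]; apply/andP; split; lra.
  have := @derive1_at_max _ G (x - e) (x + e) x _ _ xin _.
  case=> [|t /itvE /dG /is_deriveP[]//|t /itvE|D].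
  - by lra.
  - exact: gmax.
  - move=> <-; have /dG/is_deriveP[_ ->] // : `|x - x| < e.
    by rewrite subrr normr0.
have dG' : is_derive x 1 G' (k + 2 * d).
  have -> : k + 2 * d = k + d *: (2 *: (1 : R)).
    by rewrite /GRing.scale /=; ring.
  apply: is_deriveD; apply: is_deriveZ.
rewrite leNgt; apply/negP => kd.
have kd0 : 0 < k + 2 * d by lra.
have [r r0 Hr] : exists2 r, 0 < r & forall t, x < t < x + r -> 0 < G' t.
  have [DD EE] := is_deriveP dG'.
  have /cvgrPdist_lt /(_ _ kd0) := DD.
  rewrite -[lim _]/('D_1 G' x) EE => /nbhs_ballP[r /= r0 Hr].
  exists r => // t /andP[xt txr].
  have h0 : t - x != 0 by rewrite subr_eq0 gt_eqF.
  have := Hr (t - x); rewrite /ball /= sub0r normrN.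
  have -> : `|t - x| < r by rewrite ltr_norml; lra.
  move=> /(_ isT h0); rewrite /= G'x subr0 [(_ - _)%:A]mulr1 subrK.
  rewrite /GRing.scale /= ltr_norml => /andP[_ H].
  have : 0 < (t - x)^-1 * G' t by lra.
  by rewrite pmulr_rgt0 // invr_gt0 subr_gt0.
pose q := Num.min e r / 2.
have q0 : 0 < q by rewrite divr_gt0 // lt_min e0.
have qe : q < e by rewrite ltr_pdivrMr // gt_min ltr_pMr ?ltr1n.
have qr : q < r by rewrite ltr_pdivrMr // gt_min (ltr_pMr _ r0) ltr1n // orbT.
clearbody q.
have xq : x < x + q by rewrite ltrDl.
have [c cab E] : exists2 c, c \in `]x, (x + q)[ & G (x + q) - G x = G' c * (x + q - x).
  apply: (@MVT _ G G') => // [t|].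
    rewrite in_itv /= => /andP[? ?]; apply: dG.
    by rewrite ltr_norml; apply/andP; split; lra.
  apply: derivable_within_continuous => t; rewrite in_itv /= => /andP[? ?].
  have /dG/is_deriveP[] // : `|t - x| < e.
  by rewrite ltr_norml; apply/andP; split; lra.
have : G (x + q) <= G x by apply: gmax; rewrite addrAC subrr add0r gtr0_norm.
rewrite leNgt => /negP; apply; rewrite -subr_gt0 E mulr_gt0 //; last by lra.
by apply: Hr; move: cab; rewrite in_itv /= => /andP[? ?]; apply/andP; split; lra.
Qed.

Lemma ball_line x (s : R) : nsq x < s ->
  exists2 e, 0 < e & forall t, (`|t - x.1| < e -> nsq (t, x.2) < s) /\
     (`|t - x.2| < e -> nsq (x.1, t) < s).
Proof.
move=> xs; have := open_nbhs_nbhs (conj (@open_disk s) xs).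
move=> /nbhs_ballP[e e0 H]; exists e => // t.
by split=> ht; apply: H; apply/in_ball_plane; split; rewrite /= ?subrr ?normr0 // distrC.
Qed.

(** Adding [d * nsq] makes [W] strictly subharmonic, so an interior maximum would give a Laplacian
    at most [- 4 d]. The derivatives are separate functions, required only inside, because the
    principle is applied to functions that are merely continuous at the boundary. *)
Lemma max_principle (s m : R) (W W1 W2 W11 W22 : plane -> R) :
  0 <= s ->
  {within cdisk s, continuous W} ->
  (forall x, nsq x < s -> is_derive x (1, 0) W (W1 x)) ->
  (forall x, nsq x < s -> is_derive x (0, 1) W (W2 x)) ->
  (forall x, nsq x < s -> is_derive x (1, 0) W1 (W11 x)) ->
  (forall x, nsq x < s -> is_derive x (0, 1) W2 (W22 x)) ->
  (forall x, nsq x < s -> 0 <= W11 x + W22 x) ->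
  (forall x, nsq x = s -> W x <= m) ->
  forall x, nsq x <= s -> W x <= m.
Proof.
move=> s0 cW d1 d2 d11 d22 L bd x0 x0s.
apply/ler_addgt0Pr => e e0.
(* The perturbation [d * nsq] is at most [d * s <= e] on the disk. *)
pose d := e / (s + 1).
have d0 : 0 < d by rewrite divr_gt0 // ltr_wpDl.
have ds : d * s <= e.
  by rewrite /d mulrAC ler_pdivrMr ?ltr_wpDl // ler_pM2l // lerDl.
clearbody d.
pose F x := W x + d * nsq x.
have cF : {within cdisk s, continuous F}.
  move=> x; apply: cvgD; first exact: cW.
  apply: cvgM; first exact: cvg_cst.
  by have := continuous_subspaceT (A := cdisk s) nsq_continuous; exact.
have [|c] := compact_EVT_max _ (cdisk_compact s0) cF; first by exists x0.
rewrite inE => cs cmax.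
have {}cmax x : nsq x <= s -> F x <= F c by move=> xs; apply: cmax; rewrite inE.
have [cls|] := ltP (nsq c) s; last first.
  move=> sc; have {sc cs}cs : nsq c = s by apply/eqP; rewrite eq_le sc andbT.
  have := cmax _ x0s; rewrite /F cs => H.
  have := bd _ cs; have : 0 <= d * nsq x0.
    by rewrite mulr_ge0 ?(ltW d0) // addr_ge0 ?sqr_ge0.
  move: ds H; set u := d * s; set v := d * nsq x0; lra.
exfalso; have [r r0 Hr] := ball_line cls.
have h1 : W11 c <= - (2 * d).
  apply: (@second_derivative_at_max (fun t => W (t, c.2)) (fun t => W1 (t, c.2)) c.1 _ r) => //.
  - by move=> t /(Hr t).1 /d1; rewrite is_derive_e1.
  - by rewrite -(is_derive_e1 W1); exact: d11.
  - move=> t /(Hr t).1 /ltW /cmax; rewrite /F /nsq /=.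
    by case: (c) => c1 c2 /=; lra.
have h2 : W22 c <= - (2 * d).
  apply: (@second_derivative_at_max (fun t => W (c.1, t)) (fun t => W2 (c.1, t)) c.2 _ r) => //.
  - by move=> t /(Hr t).2 /d2; rewrite is_derive_e2.
  - by rewrite -(is_derive_e2 W2); exact: d22.
  - move=> t /(Hr t).2 /ltW /cmax; rewrite /F /nsq /=.
    by case: (c) => c1 c2 /=; lra.
have := L _ cls; lra.
Qed.

Lemma closure_unit_diskE : closure (unit_disk R) = cdisk 1.
Proof.
rewrite eqEsubset; split=> [|x].
  have -> : cdisk 1 = closure (cdisk 1) by apply/closure_id; exact: cdisk_closed.
  by apply: closure_subset => x /ltW.
rewrite /cdisk /= => x1 B /nbhs_ballP[e e0 HB].
(* The point is pulled towards the origin by the factor [1 - t]; its coordinates are bounded by 2,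
   so each moves by at most [e / 2]. *)
pose t := Num.min (1 / 2) (e / 4).
have t0 : 0 < t by rewrite lt_min; apply/andP; split; rewrite divr_gt0.
have t1 : t <= 1 / 2 by rewrite ge_min lexx.
have te : t <= e / 4 by rewrite ge_min lexx orbT.
clearbody t; exists ((1 - t) * x.1, (1 - t) * x.2).
have [a1 a2] := cdisk_bound ler01 x1; move: x1; rewrite /nsq => x1.
split; first by rewrite /unit_disk /= !exprMn; nra.
apply: HB; apply/in_ball_plane => /=.
have E z : z - (1 - t) * z = t * z by ring.
rewrite !E !normrM !(gtr0_norm t0); split; nra.
Qed.

Lemma boundary_unit_diskE x :
  (closure (unit_disk R) `\` unit_disk R) x <-> nsq x = 1.
Proof.
rewrite closure_unit_diskE /cdisk /unit_disk /setD /=; split=> [[h /negP]|E].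
  by rewrite -leNgt => h2; apply/eqP; rewrite eq_le h h2.
by rewrite -/(nsq x) E lexx ltxx; split.
Qed.

End maximum_principle.

(** * Differentiation rules for explicit formulas *)

Section derivative_rules.
Variables (R : realType) (V : normedModType R).
Implicit Types (f g : V -> R) (x v : V).

Lemma isdC x v (c : R) : is_derive x v (fun _ => c) 0.
Proof. exact: is_derive_cst. Qed.

Lemma isdD x v f g df dg : is_derive x v f df -> is_derive x v g dg ->
  is_derive x v (fun y => f y + g y) (df + dg).
Proof. by move=> hf hg; exact: is_deriveD. Qed.

Lemma isdN x v f df : is_derive x v f df ->
  is_derive x v (fun y => - f y) (- df).
Proof. by move=> hf; exact: is_deriveN. Qed.

Lemma isdM x v f g df dg : is_derive x v f df -> is_derive x v g dg ->
  is_derive x v (fun y => f y * g y) (df * g x + f x * dg).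
Proof.
move=> /is_deriveP[D1 E1] /is_deriveP[D2 E2]; apply: DeriveDef.
  exact: (derivableM D1 D2).
rewrite [LHS](deriveM D1 D2) E1 E2 addrC.
by congr (_ + _); rewrite [LHS]mulrC.
Qed.

Lemma isdX x v f df n : is_derive x v f df ->
  is_derive x v (fun y => f y ^+ n) (n%:R * f x ^+ n.-1 * df).
Proof.
move=> hf; elim: n => [|n IH].
  by apply: (is_derive_eq (isdC x v 1)); rewrite mul0r mul0r.
have H := isdM hf IH.
rewrite (_ : (fun y => f y ^+ n.+1) = (fun y => f y * f y ^+ n)); last first.
  by apply/funext => y; rewrite exprS.
apply: (is_derive_eq H) => {H IH} /=.
case: n => [|n] /=; first by rewrite !expr0; ring.
by rewrite -[n.+2%:R]natr1 exprS; ring.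
Qed.

End derivative_rules.

Section derivative_rules_plane.
Variable R : realType.
Local Notation plane := (R * R)%type.
Implicit Types (f g : plane -> R) (x : plane).

Lemma isd1_fst x : is_derive x (1, 0) (fun y : plane => y.1) (1 : R).
Proof. apply/is_derive_e1; exact: (is_derive_id _ (1 : R)). Qed.

Lemma isd2_fst x : is_derive x (0, 1) (fun y : plane => y.1) (0 : R).
Proof. apply/is_derive_e2; exact: (is_derive_cst (_ : R) _ (1 : R)). Qed.

Lemma isd1_snd x : is_derive x (1, 0) (fun y : plane => y.2) (0 : R).
Proof. apply/is_derive_e1; exact: (is_derive_cst (_ : R) _ (1 : R)). Qed.

Lemma isd2_snd x : is_derive x (0, 1) (fun y : plane => y.2) (1 : R).
Proof. apply/is_derive_e2; exact: (is_derive_id _ (1 : R)). Qed.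

Lemma Cinf_isd1 f x : Cinf f -> is_derive x (1, 0) f (partial1 f x).
Proof. by move=> Cf; apply: DeriveDef => //; exact: Cinf_derivable1. Qed.

Lemma Cinf_isd2 f x : Cinf f -> is_derive x (0, 1) f (partial2 f x).
Proof. by move=> Cf; apply: DeriveDef => //; exact: Cinf_derivable2. Qed.

Lemma isd_partial1 f f1 : (forall x, is_derive x (1, 0) f (f1 x)) -> partial1 f = f1.
Proof. by move=> H; apply/funext => x; exact: (is_deriveP (H x)).2. Qed.

Lemma isd_partial2 f f2 : (forall x, is_derive x (0, 1) f (f2 x)) -> partial2 f = f2.
Proof. by move=> H; apply/funext => x; exact: (is_deriveP (H x)).2. Qed.

End derivative_rules_plane.

(* [notypeclasses]: the library declares its own differentiation rules as
   instances, whose results are stated with [*:]. *)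
Ltac isd_step :=
  lazymatch goal with
  | |- is_derive _ _ (fun y => @Algebra.add _ (@?f y) (@?g y)) _ =>
      notypeclasses refine (isdD _ _)
  | |- is_derive _ _ (fun y => @Algebra.opp _ (@?f y)) _ =>
      notypeclasses refine (isdN _)
  | |- is_derive _ _ (fun y => @GRing.mul _ (@?f y) (@?g y)) _ =>
      notypeclasses refine (isdM _ _)
  | |- is_derive _ _ (fun y => @GRing.exp _ (@?f y) _) _ =>
      notypeclasses refine (isdX _ _)
  | |- is_derive _ (_, 0) (@fst _ _) _ => exact (isd1_fst _)
  | |- is_derive _ (0, _) (@fst _ _) _ => exact (isd2_fst _)
  | |- is_derive _ (_, 0) (@snd _ _) _ => exact (isd1_snd _)
  | |- is_derive _ (0, _) (@snd _ _) _ => exact (isd2_snd _)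
  | |- is_derive _ (_, 0) (fun y => y.1) _ => exact (isd1_fst _)
  | |- is_derive _ (0, _) (fun y => y.1) _ => exact (isd2_fst _)
  | |- is_derive _ (_, 0) (fun y => y.2) _ => exact (isd1_snd _)
  | |- is_derive _ (0, _) (fun y => y.2) _ => exact (isd2_snd _)
  | |- is_derive _ _ (fun y => ?c) _ => exact (isdC _ _ _)
  | |- is_derive _ ?w ?f _ =>
      match goal with
      | H : is_derive _ w f _ |- _ => exact H
      | H : forall z, is_derive z w f _ |- _ => exact (H _)
      end
  end.
Ltac isd := notypeclasses refine (is_derive_eq _ _); [solve [repeat isd_step]|cbv beta].

(** * Bernstein's interior gradient estimate *)

Section gradient_estimate.
Variable R : realType.
Local Notation plane := (R * R)%type.
Implicit Types (f g : plane -> R) (x : plane).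

(** In the application [(a, b)] is the gradient of [v], [p, q, r] its second derivatives, [f] its
    Laplacian and [z] the weight. The mixed terms are absorbed by [2 z^2] times the squared Hessian
    at the cost of 32 times [a^2 + b^2]; the weight costs 8 more and the right-hand side 1 more, so
    42 is enough. *)
Lemma gradient_estimate_algebra (x1 x2 a b p q r v f f1 f2 A d z : R) :
  0 <= d -> x1 ^+ 2 + x2 ^+ 2 <= 1 -> 0 <= z -> z <= 1 ->
  `|v| <= A -> `|f| <= d -> `|f1| <= d -> `|f2| <= d ->
  0 <= (8 * (x1 ^+ 2 + x2 ^+ 2) - 8 * z) * (a ^+ 2 + b ^+ 2)
    - 16 * z * (x1 * (a * p + b * q) + x2 * (a * q + b * r))
    + z ^+ 2 * (2 * (p ^+ 2 + q ^+ 2 + q ^+ 2 + r ^+ 2) + 2 * (a * f1 + b * f2))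
    + 42 * (a ^+ 2 + b ^+ 2 + v * f) + (2 * d ^+ 2 + 42 * (A * d)).
Proof.
move=> d0 x1x2 z0 z1 vA fd f1d f2d.
have h1 : - (A * d) <= v * f.
  by rewrite lerNl -mulNr; apply: le_trans (ler_norm _) _; rewrite normrM normrN ler_pM.
have sq1 : f1 ^+ 2 <= d ^+ 2 by rewrite -(real_normK (num_real f1)) ler_sqr ?nnegrE.
have sq2 : f2 ^+ 2 <= d ^+ 2 by rewrite -(real_normK (num_real f2)) ler_sqr ?nnegrE.
have z2 : 0 <= z ^+ 2 <= 1 by rewrite sqr_ge0 expr_le1.
have h2 : - (a ^+ 2 + b ^+ 2 + 2 * d ^+ 2) <= z ^+ 2 * (2 * (a * f1 + b * f2)).
  have k1 : - (a ^+ 2 + f1 ^+ 2) <= 2 * (a * f1) by have := sqr_ge0 (a + f1); rewrite sqrrD mulr2n; lra.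
  have k2 : - (b ^+ 2 + f2 ^+ 2) <= 2 * (b * f2) by have := sqr_ge0 (b + f2); rewrite sqrrD mulr2n; lra.
  have := sqr_ge0 a; have := sqr_ge0 b; have := sqr_ge0 d.
  move: z2 k1 k2 sq1 sq2; move: (z ^+ 2) => w /andP[w0 w1].
  set aa := a ^+ 2; set bb := b ^+ 2; set dd := d ^+ 2; move: (a * f1) (b * f2) (f1 ^+ 2) (f2 ^+ 2).
  move=> u1 u2 g1 g2 ? ? ? ? ? ? ?; nra.
have h3 : - (32 * (a ^+ 2 + b ^+ 2) + 2 * z ^+ 2 * (p ^+ 2 + q ^+ 2 + q ^+ 2 + r ^+ 2))
   <= - 16 * z * (x1 * (a * p + b * q) + x2 * (a * q + b * r)).
  have k (u w y : R) : u ^+ 2 <= 1 -> 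
     - (16 * u ^+ 2 * w ^+ 2 + 4 * y ^+ 2) <= - 16 * (u * w * y) by move=> _; have := sqr_ge0 (2 * (2 * (u * w)) - 2 * y); rewrite sqrrB; nra.
  pose m1 := x1 * a; pose m2 := x1 * b; pose m3 := x2 * a; pose m4 := x2 * b.
  pose n1 := z * p; pose n2 := z * q; pose n4 := z * r.
  have E : - 16 * z * (x1 * (a * p + b * q) + x2 * (a * q + b * r)) =
     - 16 * (m1 * n1 + (m2 + m3) * n2 + m4 * n4) by rewrite /m1 /m2 /m3 /m4 /n1 /n2 /n4; ring.
  have E2 : 2 * z ^+ 2 * (p ^+ 2 + q ^+ 2 + q ^+ 2 + r ^+ 2) = 2 * (n1 ^+ 2 + n2 ^+ 2 + n2 ^+ 2 + n4 ^+ 2).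
    by rewrite /n1 /n2 /n4; ring.
  have E3 : m1 ^+ 2 + m2 ^+ 2 + m3 ^+ 2 + m4 ^+ 2 = (x1 ^+ 2 + x2 ^+ 2) * (a ^+ 2 + b ^+ 2).
    by rewrite /m1 /m2 /m3 /m4; ring.
  have E4 : m1 ^+ 2 + m2 ^+ 2 + m3 ^+ 2 + m4 ^+ 2 <= a ^+ 2 + b ^+ 2.
    by rewrite E3 ler_piMl // addr_ge0 ?sqr_ge0.
  rewrite E E2.
  have s1 := sqr_ge0 (4 * m1 - n1); have s2 := sqr_ge0 (4 * m2 - n2).
  have s3 := sqr_ge0 (4 * m3 - n2); have s4 := sqr_ge0 (4 * m4 - n4).
  clearbody m1 m2 m3 m4 n1 n2 n4; move: s1 s2 s3 s4; rewrite !sqrrB !exprMn; lra.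
have h4 : - 8 * (a ^+ 2 + b ^+ 2) <= (8 * (x1 ^+ 2 + x2 ^+ 2) - 8 * z) * (a ^+ 2 + b ^+ 2).
  by apply: ler_wpM2r; have := sqr_ge0 x1; have := sqr_ge0 x2; have := sqr_ge0 a; have := sqr_ge0 b; lra.
have := sqr_ge0 a; have := sqr_ge0 b.
move: h1 h2 h3 h4; rewrite (mulrDr (z ^+ 2)).
move: (z ^+ 2 * (2 * (a * f1 + b * f2))) => w1.
rewrite 2!mulNr; move: (16 * z * _) => w2; lra.
Qed.

(** Maximum principle for Bernstein's function [(s - |x|^2)^2 |grad v|^2 + 21 v^2 + K |x|^2]. On the
    boundary circle the gradient term drops out, which is why no boundary information on the
    gradient is needed. *)
Lemma gradient_estimate (v : plane -> R) (s A d : R) :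
  0 <= s <= 1 -> 0 <= d -> Cinf v ->
  (forall x, nsq x <= s -> `|v x| <= A) ->
  (forall x, nsq x <= s -> `|laplacian v x| <= d) ->
  (forall x, nsq x <= s -> `|partial1 (laplacian v) x| <= d) ->
  (forall x, nsq x <= s -> `|partial2 (laplacian v) x| <= d) ->
  forall x, nsq x <= s ->
    (s - nsq x) ^+ 2 * (partial1 v x ^+ 2 + partial2 v x ^+ 2) <= 21 * (A + d) ^+ 2.
Proof.
move=> /andP[s0 s1] d0 Cv vA fd f1d f2d x0 x0s.
have A0 : 0 <= A by apply: le_trans (normr_ge0 (v x0)) (vA _ x0s).
(* Opaque names for the derivatives up to order three, with mixed derivatives identified, keep the
   later polynomial identities within reach of [ring]. *)
have [a Ea] : {a | a = partial1 v} by eexists.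
have [b Eb] : {b | b = partial2 v} by eexists.
have [p Ep] : {p | p = partial1 a} by eexists.
have [q Eq] : {q | q = partial2 a} by eexists.
have [r Er] : {r | r = partial2 b} by eexists.
have [p1 Ep1] : {p1 | p1 = partial1 p} by eexists.
have [q1 Eq1] : {q1 | q1 = partial1 q} by eexists.
have [q2 Eq2] : {q2 | q2 = partial2 q} by eexists.
have [r2 Er2] : {r2 | r2 = partial2 r} by eexists.
have Ca : Cinf a by rewrite Ea; exact: Cinf_partial1.
have Cb : Cinf b by rewrite Eb; exact: Cinf_partial2.
have Cp : Cinf p by rewrite Ep; exact: Cinf_partial1.
have Cq : Cinf q by rewrite Eq; exact: Cinf_partial2.
have Cr : Cinf r by rewrite Er; exact: Cinf_partial2.
have Eq' : q = partial1 b by rewrite Eq Ea Eb Cinf_schwarz.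
have Er1 : q2 = partial1 r by rewrite Eq2 Eq' Er -Cinf_schwarz.
have Ep2 : q1 = partial2 p by rewrite Eq1 Eq Ep -Cinf_schwarz.
have Lv : laplacian v = fun x => p x + r x by rewrite /laplacian -Ea -Eb -Ep -Er.
have da1 x : is_derive x (1, 0) a (p x) by rewrite Ep; exact: Cinf_isd1.
have da2 x : is_derive x (0, 1) a (q x) by rewrite Eq; exact: Cinf_isd2.
have db1 x : is_derive x (1, 0) b (q x) by rewrite Eq'; exact: Cinf_isd1.
have db2 x : is_derive x (0, 1) b (r x) by rewrite Er; exact: Cinf_isd2.
have dp1 x : is_derive x (1, 0) p (p1 x) by rewrite Ep1; exact: Cinf_isd1.
have dp2 x : is_derive x (0, 1) p (q1 x) by rewrite Ep2; exact: Cinf_isd2.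
have dq1 x : is_derive x (1, 0) q (q1 x) by rewrite Eq1; exact: Cinf_isd1.
have dq2 x : is_derive x (0, 1) q (q2 x) by rewrite Eq2; exact: Cinf_isd2.
have dr1 x : is_derive x (1, 0) r (q2 x) by rewrite Er1; exact: Cinf_isd1.
have dr2 x : is_derive x (0, 1) r (r2 x) by rewrite Er2; exact: Cinf_isd2.
have dv1 x : is_derive x (1, 0) v (a x) by rewrite Ea; exact: Cinf_isd1.
have dv2 x : is_derive x (0, 1) v (b x) by rewrite Eb; exact: Cinf_isd2.
have E1 : partial1 (laplacian v) = fun x => p1 x + q2 x.
  by rewrite Lv; apply: isd_partial1 => x; isd.
have E2 : partial2 (laplacian v) = fun x => q1 x + r2 x.
  by rewrite Lv; apply: isd_partial2 => x; isd.
rewrite E1 in f1d; rewrite E2 in f2d; rewrite Lv in fd; rewrite -Ea -Eb.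
clear Ea Eb Ep Eq Er Ep1 Eq1 Eq2 Er2 Eq' Er1 Ep2 E1 E2 Lv.
(* The Laplacian of [K |x|^2] is [4 K], which has to cover the constant left over in the algebraic
   inequality. *)
have [K KE] : {K | K = (2 * d ^+ 2 + 42 * (A * d)) / 4} by eexists.
pose z x := s - (x.1 * x.1 + x.2 * x.2) : R.
pose G x := a x * a x + b x * b x.
pose G1 x := 2 * (a x * p x + b x * q x).
pose G2 x := 2 * (a x * q x + b x * r x).
pose W x := (s - (x.1 * x.1 + x.2 * x.2)) * (s - (x.1 * x.1 + x.2 * x.2)) *
   (a x * a x + b x * b x) + 21 * (v x * v x) + K * (x.1 * x.1 + x.2 * x.2).
pose W1 x := (- (4 * x.1)) * ((s - (x.1 * x.1 + x.2 * x.2)) * (a x * a x + b x * b x)) +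
   (s - (x.1 * x.1 + x.2 * x.2)) * (s - (x.1 * x.1 + x.2 * x.2)) *
   (2 * (a x * p x + b x * q x)) + 42 * (v x * a x) + K * (2 * x.1).
pose W2 x := (- (4 * x.2)) * ((s - (x.1 * x.1 + x.2 * x.2)) * (a x * a x + b x * b x)) +
   (s - (x.1 * x.1 + x.2 * x.2)) * (s - (x.1 * x.1 + x.2 * x.2)) *
   (2 * (a x * q x + b x * r x)) + 42 * (v x * b x) + K * (2 * x.2).
pose W11 x := (8 * x.1 ^+ 2 - 4 * z x) * G x - 8 * x.1 * z x * G1 x
   + z x ^+ 2 * (2 * (p x ^+ 2 + a x * p1 x + q x ^+ 2 + b x * q1 x))
   + 42 * (a x ^+ 2 + v x * p x) + 2 * K.
pose W22 x := (8 * x.2 ^+ 2 - 4 * z x) * G x - 8 * x.2 * z x * G2 x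
   + z x ^+ 2 * (2 * (q x ^+ 2 + a x * q2 x + r x ^+ 2 + b x * r2 x))
   + 42 * (b x ^+ 2 + v x * r x) + 2 * K.
have dW1 x : is_derive x (1, 0) W (W1 x).
  by rewrite /W /W1; isd; ring.
have dW2 x : is_derive x (0, 1) W (W2 x).
  by rewrite /W /W2; isd; ring.
have dW11 x : is_derive x (1, 0) W1 (W11 x).
  by rewrite /W1 /W11 /z /G /G1; isd; ring.
have dW22 x : is_derive x (0, 1) W2 (W22 x).
  by rewrite /W2 /W22 /z /G /G2; isd; ring.
have CW : Cinf W.
  have Cz : Cinf (fun x : plane => s - (x.1 * x.1 + x.2 * x.2)).
    apply: CinfB; first exact: Cinf_cst.
    by apply: CinfD; apply: CinfM; [exact: Cinf_fst..|exact: Cinf_snd|exact: Cinf_snd].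
  have Cn : Cinf (fun x : plane => x.1 * x.1 + x.2 * x.2).
    by apply: CinfD; apply: CinfM; [exact: Cinf_fst..|exact: Cinf_snd|exact: Cinf_snd].
  have CG : Cinf G by apply: CinfD; apply: CinfM.
  apply: CinfD; last by apply: CinfZ.
  apply: CinfD; last by apply: CinfZ; apply: CinfM.
  by apply: CinfM => //; apply: CinfM.
have zE x : z x = s - nsq x by rewrite /z /nsq !expr2.
have H := @max_principle R s (21 * A ^+ 2 + K) W W1 W2 W11 W22 s0 _
  (fun x _ => dW1 x) (fun x _ => dW2 x) (fun x _ => dW11 x) (fun x _ => dW22 x) _ _ x0 x0s.
have {H} : W x0 <= 21 * A ^+ 2 + K.
  apply: H.
  - exact: continuous_subspaceT (Cinf_continuous CW).
  - move=> x /ltW xs.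
    have := @gradient_estimate_algebra x.1 x.2 (a x) (b x) (p x) (q x) (r x) (v x)
      (p x + r x) (p1 x + q2 x) (q1 x + r2 x) A d (z x) d0 _ _ _ (vA _ xs) (fd _ xs) (f1d _ xs) (f2d _ xs).
    rewrite zE => /(_ (le_trans xs s1)); rewrite subr_ge0 => /(_ xs).
    have -> : s - nsq x <= 1.
      by rewrite lerBlDr (le_trans s1) // lerDl addr_ge0 ?sqr_ge0.
    move=> /(_ isT); rewrite -zE /W11 /W22 /G /G1 /G2 KE.
    move=> H; apply: (le_trans H); rewrite le_eqVlt; apply/orP; left; apply/eqP.
    by field.
  - move=> x xs; rewrite /W.
    have -> : x.1 * x.1 + x.2 * x.2 = s by rewrite -xs /nsq !expr2.
    rewrite subrr !mul0r add0r; apply: lerD.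
      rewrite ler_pM2l // -expr2 -(real_normK (num_real (v x))) ler_sqr ?nnegrE //.
      by apply: vA; rewrite xs.
    have K0 : 0 <= K.
      by rewrite KE divr_ge0 // addr_ge0 // mulr_ge0 ?sqr_ge0 // mulr_ge0.
    by rewrite ler_piMr.
rewrite /W -!expr2 -/(nsq x0) => H.
have n0 : 0 <= nsq x0 by rewrite addr_ge0 ?sqr_ge0.
have Kn : 0 <= K * nsq x0.
  by rewrite mulr_ge0 // KE divr_ge0 // addr_ge0 // mulr_ge0 ?sqr_ge0 // mulr_ge0.
have vv := sqr_ge0 (v x0).
have Ad : 0 <= A * d by rewrite mulr_ge0.
have dd := sqr_ge0 d.
rewrite KE in H Kn *; move: H Kn; rewrite sqrrD mulr2n.
move: (_ * (a x0 ^+ 2 + b x0 ^+ 2)) (_ / 4 * nsq x0) => u w; lra.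
Qed.

End gradient_estimate.

(** * The Dirichlet problem on the disk *)

Section polynomial_dirichlet.
Variable R : realType.
Local Notation plane := (R * R)%type.
Implicit Types (f g p u : plane -> R) (x : plane).

(** Real and imaginary parts of the complex power [(x.1 + i x.2)^m]. *)
Fixpoint zpow (m : nat) x : plane :=
  if m is m'.+1 then
    (x.1 * (zpow m' x).1 - x.2 * (zpow m' x).2,
     x.1 * (zpow m' x).2 + x.2 * (zpow m' x).1)
  else (1, 0).

Definition rez m x := (zpow m x).1.
Definition imz m x := (zpow m x).2.

Lemma rezS m x : rez m.+1 x = x.1 * rez m x - x.2 * imz m x.
Proof. by []. Qed.

Lemma imzS m x : imz m.+1 x = x.1 * imz m x + x.2 * rez m x.
Proof. by []. Qed.

(** The derivatives of the imaginary part are expressed through those of the real part by the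
    Cauchy-Riemann equations; the last clause is Euler's identity for both homogeneous functions. *)
Lemma zpow_derivatives m : exists r1 r2 : plane -> R,
  [/\ Cinf (rez m) /\ Cinf (imz m), Cinf r1 /\ Cinf r2,
    (forall x, is_derive x (1, 0) (rez m) (r1 x)) /\
    (forall x, is_derive x (0, 1) (rez m) (r2 x)),
    (forall x, is_derive x (1, 0) (imz m) (- r2 x)) /\
    (forall x, is_derive x (0, 1) (imz m) (r1 x)) &
    forall x, x.1 * r1 x + x.2 * r2 x = m%:R * rez m x /\
              x.2 * r1 x - x.1 * r2 x = m%:R * imz m x].
Proof.
elim: m => [|m [r1 [r2 [[Cr Ci] [Cr1 Cr2] [d1 d2] [e1 e2] EU]]]].
  exists (fun _ => 0), (fun _ => 0); split.
  - by split; exact: Cinf_cst.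
  - by split; exact: Cinf_cst.
  - by split=> x; exact: isdC.
  - by split=> x; rewrite ?oppr0; exact: isdC.
  - by move=> x; rewrite !mulr0 !mul0r addr0 subr0.
have Cx := @Cinf_fst R; have Cy := @Cinf_snd R.
exists (fun x => rez m x + x.1 * r1 x + x.2 * r2 x),
  (fun x => - imz m x + x.1 * r2 x - x.2 * r1 x); split.
- split; first by apply: CinfB; apply: CinfM.
  by apply: CinfD; apply: CinfM.
- split; first by do 2?apply: CinfD => //; apply: CinfM.
  by apply: CinfB; [apply: CinfD; [exact: CinfN|exact: CinfM]|exact: CinfM].
- split=> x; rewrite (_ : rez m.+1 = fun x => x.1 * rez m x - x.2 * imz m x) //.
    by isd; ring.
  by isd; ring.
- split=> x; rewrite (_ : imz m.+1 = fun x => x.1 * imz m x + x.2 * rez m x) //.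
    by isd; ring.
  by isd; ring.
- move=> x; have [E1 E2] := EU x; rewrite rezS imzS -natr1.
  split.
    transitivity (x.1 * rez m x - x.2 * imz m x + x.1 * (x.1 * r1 x + x.2 * r2 x)
      - x.2 * (x.2 * r1 x - x.1 * r2 x)); first by ring.
    by rewrite E1 E2; ring.
  transitivity (x.2 * rez m x + x.1 * imz m x + x.2 * (x.1 * r1 x + x.2 * r2 x)
      + x.1 * (x.2 * r1 x - x.1 * r2 x)); first by ring.
  by rewrite E1 E2; ring.
Qed.

Definition solvable f := exists u, [/\ Cinf u,
  forall x, laplacian u x = f x & forall x, nsq x = 1 -> u x = 0].

(* On harmonic functions [h] homogeneous of degree [m] the Laplacian of
   [nsq ^+ b.+1 * h] is a multiple of [nsq ^+ b * h]; subtracting [h] restores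
   the boundary condition. *)
Lemma solvable_homogeneous (m b : nat) (h h1 h2 : plane -> R) :
  Cinf h -> Cinf h1 -> Cinf h2 ->
  (forall x, is_derive x (1, 0) h (h1 x)) ->
  (forall x, is_derive x (0, 1) h (h2 x)) ->
  (forall x, partial1 h1 x + partial2 h2 x = 0) ->
  (forall x, x.1 * h1 x + x.2 * h2 x = m%:R * h x) ->
  solvable (fun x => nsq x ^+ b * h x).
Proof.
move=> Ch Ch1 Ch2 d1 d2 harm euler.
(* With [c = b + 1], the Laplacian of [nsq ^+ c] contributes [4 c^2] and the cross term contributes
   [4 c m] by Euler's identity. *)
pose k : R := 4 * b.+1%:R * (b.+1%:R + m%:R).
have k0 : k != 0 by rewrite !mulf_neq0 ?gt_eqF // ltr_wpDr.
have [h11 E11] : {h11 | h11 = partial1 h1} by eexists.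
have [h22 E22] : {h22 | h22 = partial2 h2} by eexists.
have d11 x : is_derive x (1, 0) h1 (h11 x) by rewrite E11; exact: Cinf_isd1.
have d22 x : is_derive x (0, 1) h2 (h22 x) by rewrite E22; exact: Cinf_isd2.
rewrite -E11 -E22 in harm; clear E11 E22.
pose N (x : plane) := x.1 * x.1 + x.2 * x.2.
pose u (x : plane) := k^-1 * (((x.1 * x.1 + x.2 * x.2) ^+ b.+1 - 1) * h x).
pose u1 (x : plane) := k^-1 * ((b.+1%:R * (x.1 * x.1 + x.2 * x.2) ^+ b * (2 * x.1)) * h x
  + ((x.1 * x.1 + x.2 * x.2) ^+ b.+1 - 1) * h1 x).
pose u2 (x : plane) := k^-1 * ((b.+1%:R * (x.1 * x.1 + x.2 * x.2) ^+ b * (2 * x.2)) * h x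
  + ((x.1 * x.1 + x.2 * x.2) ^+ b.+1 - 1) * h2 x).
pose u11 (x : plane) := k^-1 * ((b.+1%:R * (b%:R * N x ^+ b.-1 * (2 * x.1)) * (2 * x.1)) * h x
  + b.+1%:R * N x ^+ b * 2 * h x + 2 * ((b.+1%:R * N x ^+ b * (2 * x.1)) * h1 x) + (N x ^+ b.+1 - 1) * h11 x).
pose u22 (x : plane) := k^-1 * ((b.+1%:R * (b%:R * N x ^+ b.-1 * (2 * x.2)) * (2 * x.2)) * h x
  + b.+1%:R * N x ^+ b * 2 * h x + 2 * ((b.+1%:R * N x ^+ b * (2 * x.2)) * h2 x) + (N x ^+ b.+1 - 1) * h22 x).
have D1 x : is_derive x (1, 0) u (u1 x) by rewrite /u /u1; isd; rewrite /=; ring.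
have D2 x : is_derive x (0, 1) u (u2 x) by rewrite /u /u2; isd; rewrite /=; ring.
have D11 x : is_derive x (1, 0) u1 (u11 x).
  by rewrite /u1 /u11 /N; isd; rewrite /= (exprS _ b); ring.
have D22 x : is_derive x (0, 1) u2 (u22 x).
  by rewrite /u2 /u22 /N; isd; rewrite /= (exprS _ b); ring.
exists u; split.
- apply: CinfZ; apply: CinfM => //; apply: CinfB; last exact: Cinf_cst.
  by apply: CinfX; apply: CinfD; apply: CinfM; [exact: Cinf_fst..|exact: Cinf_snd|exact: Cinf_snd].
- move=> x; have -> : laplacian u x = u11 x + u22 x :> R.
    rewrite /laplacian (isd_partial1 D1) (isd_partial2 D2).
    by rewrite (isd_partial1 D11) (isd_partial2 D22).
  have NE : N x = nsq x by rewrite /N /nsq !expr2.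
  have bE : b%:R * N x ^+ b.-1 * N x = b%:R * N x ^+ b.
    by case: (b) => [|c]; rewrite ?mul0r //= -mulrA -exprSr.
  rewrite -NE -[RHS](mulKf k0).
  transitivity (k^-1 * (4 * b.+1%:R * (b%:R * N x ^+ b.-1 * N x) * h x
    + 4 * b.+1%:R * N x ^+ b * h x + 4 * b.+1%:R * N x ^+ b * (x.1 * h1 x + x.2 * h2 x)
    + (N x ^+ b.+1 - 1) * (h11 x + h22 x))).
    rewrite /u11 /u22; move: (N x ^+ b.-1) (N x ^+ b) (N x ^+ b.+1) => P1 P0 P2.
    by rewrite /N; ring.
  congr (_ * _).
  by rewrite bE harm euler /k -[b.+1%:R]natr1; ring.
- move=> x nx; rewrite /u (_ : x.1 * x.1 + x.2 * x.2 = 1); last by rewrite -nx /nsq !expr2.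
  by rewrite expr1n subrr mul0r mulr0.
Qed.

Lemma solvable_rez b m : solvable (fun x => nsq x ^+ b * rez m x).
Proof.
have [r1 [r2 [[Cr Ci] [Cr1 Cr2] [d1 d2] [e1 e2] EU]]] := zpow_derivatives m.
apply: (@solvable_homogeneous m b (rez m) r1 r2) => // x.
  have := congr1 (fun h => h x) (Cinf_schwarz Ci).
  rewrite (isd_partial1 e1) (isd_partial2 e2) => ->.
  have H : is_derive x (0, 1) (fun x => - r2 x) (- partial2 r2 x).
    by apply: isdN; exact: Cinf_isd2.
  by rewrite [partial2 (fun x => - r2 x) x](is_deriveP H).2 addNr.
by have [] := EU x.
Qed.

Lemma solvable_imz b m : solvable (fun x => nsq x ^+ b * imz m x).
Proof.
have [r1 [r2 [[Cr Ci] [Cr1 Cr2] [d1 d2] [e1 e2] EU]]] := zpow_derivatives m.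
apply: (@solvable_homogeneous m b (imz m) (fun x => - r2 x) r1) => //.
- exact: CinfN.
- move=> x; have := congr1 (fun h => h x) (Cinf_schwarz Cr).
  rewrite (isd_partial1 d1) (isd_partial2 d2) => <-.
  have H : is_derive x (1, 0) (fun x => - r2 x) (- partial1 r2 x).
    by apply: isdN; exact: Cinf_isd1.
  by rewrite [partial1 (fun x => - r2 x) x](is_deriveP H).2 addNr.
- by move=> x; have [_ <-] := EU x; ring.
Qed.

Lemma laplacianE u x :
  laplacian u x = partial1 (partial1 u) x + partial2 (partial2 u) x :> R.
Proof. by []. Qed.

Lemma laplacianD u v x : Cinf u -> Cinf v ->
  laplacian (fun y => u y + v y) x = laplacian u x + laplacian v x.
Proof.
move=> Cu Cv; have := Cinf_partial1 Cu; have := Cinf_partial1 Cv.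
have := Cinf_partial2 Cu; have := Cinf_partial2 Cv => Cv2 Cu2 Cv1 Cu1.
have E1 : partial1 (fun y => u y + v y) = fun y => partial1 u y + partial1 v y.
  by apply: isd_partial1 => y; apply: isdD; exact: Cinf_isd1.
have E2 : partial2 (fun y => u y + v y) = fun y => partial2 u y + partial2 v y.
  by apply: isd_partial2 => y; apply: isdD; exact: Cinf_isd2.
have E11 : partial1 (fun y => partial1 u y + partial1 v y) =
    fun y => partial1 (partial1 u) y + partial1 (partial1 v) y.
  by apply: isd_partial1 => y; apply: isdD; exact: Cinf_isd1.
have E22 : partial2 (fun y => partial2 u y + partial2 v y) =
    fun y => partial2 (partial2 u) y + partial2 (partial2 v) y.
  by apply: isd_partial2 => y; apply: isdD; exact: Cinf_isd2.
rewrite !laplacianE E1 E2 E11 E22; exact: addrACA.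
Qed.

Lemma laplacianZ c u x : Cinf u ->
  laplacian (fun y => c * u y) x = c * laplacian u x.
Proof.
move=> Cu; have Cu1 := Cinf_partial1 Cu; have Cu2 := Cinf_partial2 Cu.
have Z1 v : Cinf v -> partial1 (fun y => c * v y) = fun y => c * partial1 v y.
  move=> Cv; apply: isd_partial1 => y.
  apply: (is_derive_eq (isdM (isdC _ _ c) (Cinf_isd1 _ Cv))).
  by rewrite mul0r add0r.
have Z2 v : Cinf v -> partial2 (fun y => c * v y) = fun y => c * partial2 v y.
  move=> Cv; apply: isd_partial2 => y.
  apply: (is_derive_eq (isdM (isdC _ _ c) (Cinf_isd2 _ Cv))).
  by rewrite mul0r add0r.
rewrite !laplacianE (Z1 _ Cu) (Z2 _ Cu) (Z1 _ Cu1) (Z2 _ Cu2).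
exact: esym (mulrDr _ _ _).
Qed.

Lemma solvableD f g : solvable f -> solvable g -> solvable (fun x => f x + g x).
Proof.
move=> [u [Cu Lu bu]] [v [Cv Lv bv]]; exists (fun x => u x + v x); split.
- exact: CinfD.
- by move=> x; rewrite laplacianD // Lu Lv.
- by move=> x nx; rewrite bu // bv // addr0.
Qed.

Lemma solvableZ c f : solvable f -> solvable (fun x => c * f x).
Proof.
move=> [u [Cu Lu bu]]; exists (fun x => c * u x); split.
- exact: CinfZ.
- by move=> x; rewrite laplacianZ // Lu.
- by move=> x nx; rewrite bu // mulr0.
Qed.

Inductive hspan : (plane -> R) -> Prop :=
| hspan_re b m : hspan (fun x => nsq x ^+ b * rez m x)
| hspan_im b m : hspan (fun x => nsq x ^+ b * imz m x)
| hspanD f g : hspan f -> hspan g -> hspan (fun x => f x + g x)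
| hspanZ c f : hspan f -> hspan (fun x => c * f x).

Lemma hspan_solvable f : hspan f -> solvable f.
Proof.
elim=> [b m|b m|{}f g _ sf _ sg|c {}f _ sf].
- exact: solvable_rez.
- exact: solvable_imz.
- exact: solvableD.
- exact: solvableZ.
Qed.

Lemma hspan_eq f g : hspan f -> f =1 g -> hspan g.
Proof. by move=> hf /funext <-. Qed.

(** With [z = x.1 + i x.2] one has [2 x.1 = z + conj z], so [2 x.1 z^(m+1) = z^(m+2) + |z|^2 z^m].
    Multiplication by [x.2] works likewise from [2 i x.2 = z - conj z]. Hence the span contains all
    polynomials. *)
Lemma hspan_mulx f : hspan f -> hspan (fun x => x.1 * f x).
Proof.
elim=> [b m|b m|{}f g _ sf _ sg|c {}f _ sf].
- case: m => [|m].
    apply: (hspan_eq (hspan_re b 1)) => x; rewrite rezS /rez /imz /=; ring.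
  apply: (hspan_eq (hspanZ 2^-1 (hspanD (hspan_re b m.+2) (hspan_re b.+1 m)))) => x.
  by rewrite !rezS !imzS exprS /nsq; field.
- case: m => [|m].
    apply: (hspan_eq (hspanZ 0 (hspan_re b 1))) => x; rewrite /imz /=; ring.
  apply: (hspan_eq (hspanZ 2^-1 (hspanD (hspan_im b m.+2) (hspan_im b.+1 m)))) => x.
  by rewrite !imzS !rezS exprS /nsq; field.
- by apply: (hspan_eq (hspanD sf sg)) => x; rewrite mulrDr.
- by apply: (hspan_eq (hspanZ c sf)) => x; rewrite mulrCA.
Qed.

Lemma hspan_muly f : hspan f -> hspan (fun x => x.2 * f x).
Proof.
elim=> [b m|b m|{}f g _ sf _ sg|c {}f _ sf].
- case: m => [|m].
    apply: (hspan_eq (hspan_im b 1)) => x; rewrite imzS /rez /imz /=; ring.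
  apply: (hspan_eq (hspanZ 2^-1 (hspanD (hspan_im b m.+2)
    (hspanZ (-1) (hspan_im b.+1 m))))) => x.
  by rewrite !imzS !rezS exprS /nsq; field.
- case: m => [|m].
    apply: (hspan_eq (hspanZ 0 (hspan_re b 1))) => x; rewrite /imz /=; ring.
  apply: (hspan_eq (hspanZ 2^-1 (hspanD (hspan_re b.+1 m)
    (hspanZ (-1) (hspan_re b m.+2))))) => x.
  by rewrite !rezS !imzS exprS /nsq; field.
- by apply: (hspan_eq (hspanD sf sg)) => x; rewrite mulrDr.
- by apply: (hspan_eq (hspanZ c sf)) => x; rewrite mulrCA.
Qed.

Inductive pol : (plane -> R) -> Prop :=
| pol_cst c : pol (fun _ => c)
| pol_mulx f : pol f -> pol (fun x => x.1 * f x)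
| pol_muly f : pol f -> pol (fun x => x.2 * f x)
| polD f g : pol f -> pol g -> pol (fun x => f x + g x).

Lemma pol_eq f g : pol f -> f =1 g -> pol g.
Proof. by move=> hf /funext <-. Qed.

Lemma pol_hspan f : pol f -> hspan f.
Proof.
elim=> [c|{}f _|{}f _|{}f g _ sf _ sg].
- by apply: (hspan_eq (hspanZ c (hspan_re 0 0))) => x; rewrite expr0 /rez /= !mulr1.
- exact: hspan_mulx.
- exact: hspan_muly.
- exact: hspanD.
Qed.

Lemma pol_solvable f : pol f -> solvable f.
Proof. by move/pol_hspan; exact: hspan_solvable. Qed.

Lemma pol_Cinf f : pol f -> Cinf f.
Proof.
elim=> [c|{}f _ Cf|{}f _ Cf|{}f g _ Cf _ Cg].
- exact: Cinf_cst.
- by apply: CinfM => //; exact: Cinf_fst.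
- by apply: CinfM => //; exact: Cinf_snd.
- exact: CinfD.
Qed.

Lemma polZ c f : pol f -> pol (fun x => c * f x).
Proof.
elim=> [d|{}f _ pf|{}f _ pf|{}f g _ pf _ pg].
- exact: pol_cst.
- by apply: (pol_eq (pol_mulx pf)) => x; rewrite mulrCA.
- by apply: (pol_eq (pol_muly pf)) => x; rewrite mulrCA.
- by apply: (pol_eq (polD pf pg)) => x; rewrite mulrDr.
Qed.

Lemma polM f g : pol f -> pol g -> pol (fun x => f x * g x).
Proof.
move=> pf pg; elim: pf => [d|{}f _ pf|{}f _ pf|{}f h _ pf _ ph].
- exact: polZ.
- by apply: (pol_eq (pol_mulx pf)) => x; rewrite mulrA.
- by apply: (pol_eq (pol_muly pf)) => x; rewrite mulrA.
- by apply: (pol_eq (polD pf ph)) => x; rewrite mulrDl.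
Qed.

Lemma pol_fst : pol (fun x => x.1).
Proof. by apply: (pol_eq (pol_mulx (pol_cst 1))) => x; rewrite mulr1. Qed.

Lemma pol_snd : pol (fun x => x.2).
Proof. by apply: (pol_eq (pol_muly (pol_cst 1))) => x; rewrite mulr1. Qed.

Lemma polX f k : pol f -> pol (fun x => f x ^+ k).
Proof.
move=> pf; elim: k => [|k IH]; first exact: pol_cst.
by apply: (pol_eq (polM pf IH)) => x; rewrite exprS.
Qed.

(** The factor [x.1 ^+ k] makes the induction work: multiplying [f] by [x.1] only raises [k], and
    the other constructors commute with integration in the first variable. *)
Lemma pol_antiderivative1 f : pol f -> forall k, exists2 F, pol F &
  (forall x, is_derive x (1, 0) F (x.1 ^+ k * f x)) /\ forall t, F (0, t) = 0.
Proof.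
elim=> [c k|{}f _ IH k|{}f _ IH k|{}f g _ IHf _ IHg k].
- exists (fun x => c / k.+1%:R * x.1 ^+ k.+1).
    by apply: polZ; apply: polX; exact: pol_fst.
  split=> [x|t]; last by rewrite /= exprS mul0r mulr0.
  by isd; rewrite /=; field.
- have [F pF [dF F0]] := IH k.+1; exists F => //; split=> // x.
  by apply: (is_derive_eq (dF x)); rewrite exprSr -mulrA.
- have [F pF [dF F0]] := IH k; exists (fun x => x.2 * F x); first exact: pol_muly.
  by split=> [x|t]; [isd; ring|rewrite /= F0 mulr0].
- have [F pF [dF F0]] := IHf k; have [G pG [dG G0]] := IHg k.
  exists (fun x => F x + G x); first exact: polD.
  by split=> [x|t]; [isd; ring|rewrite F0 G0 addr0].
Qed.

Lemma pol_antiderivative2 f : pol f -> forall k, exists2 F, pol F &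
  (forall x, is_derive x (0, 1) F (x.2 ^+ k * f x)) /\ forall t, F (t, 0) = 0.
Proof.
elim=> [c k|{}f _ IH k|{}f _ IH k|{}f g _ IHf _ IHg k].
- exists (fun x => c / k.+1%:R * x.2 ^+ k.+1).
    by apply: polZ; apply: polX; exact: pol_snd.
  split=> [x|t]; last by rewrite /= exprS mul0r mulr0.
  by isd; rewrite /=; field.
- have [F pF [dF F0]] := IH k; exists (fun x => x.1 * F x); first exact: pol_mulx.
  by split=> [x|t]; [isd; ring|rewrite /= F0 mulr0].
- have [F pF [dF F0]] := IH k.+1; exists F => //; split=> // x.
  by apply: (is_derive_eq (dF x)); rewrite exprSr -mulrA.
- have [F pF [dF F0]] := IHf k; have [G pG [dG G0]] := IHg k.
  exists (fun x => F x + G x); first exact: polD.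
  by split=> [x|t]; [isd; ring|rewrite F0 G0 addr0].
Qed.

End polynomial_dirichlet.

(** * Bernstein polynomials in one variable *)

Section bernstein_operator.
Variable R : realType.

(* [bern n phi p] is the expectation of [phi] under the binomial law of
   parameters [n] and [p]. *)
Fixpoint bern (n : nat) (phi : nat -> R) (p : R) : R :=
  if n is n'.+1 then p * bern n' (fun k => phi k.+1) p + (1 - p) * bern n' phi p
  else phi 0%N.

Lemma bern_le n phi psi p : 0 <= p <= 1 ->
  (forall k, (k <= n)%N -> phi k <= psi k) -> bern n phi p <= bern n psi p.
Proof.
move=> /andP[p0 p1]; elim: n phi psi => [|n IH] phi psi H /=; first exact: H.
have h1 : bern n (fun k => phi k.+1) p <= bern n (fun k => psi k.+1) p.
  by apply: IH => k kn; exact: H.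
have h2 : bern n phi p <= bern n psi p.
  by apply: IH => k kn; apply: H; rewrite ltnW.
by apply: lerD; apply: ler_wpM2l => //; rewrite subr_ge0.
Qed.

Lemma bern_cst n c p : bern n (fun _ => c) p = c.
Proof. by elim: n => //= n ->; ring. Qed.

Lemma bernB n phi psi p :
  bern n (fun k => phi k - psi k) p = bern n phi p - bern n psi p.
Proof. by elim: n phi psi => //= n IH phi psi; rewrite !IH; ring. Qed.

Lemma bernZ n c phi p : bern n (fun k => c * phi k) p = c * bern n phi p.
Proof. by elim: n phi => //= n IH phi; rewrite !IH; ring. Qed.

Lemma bernD n phi psi p :
  bern n (fun k => phi k + psi k) p = bern n phi p + bern n psi p.
Proof. by elim: n phi psi => //= n IH phi psi; rewrite !IH; ring. Qed.

Lemma bern_second_moment n c p :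
  bern n (fun k => (k%:R - c) ^+ 2) p = n%:R * p * (1 - p) + (n%:R * p - c) ^+ 2.
Proof.
elim: n c => [|n IH] c /=; first by ring.
rewrite (_ : (fun k => _) = fun k : nat => (k%:R - (c - 1)) ^+ 2); last first.
  by apply/funext => k; rewrite -natr1; congr (_ ^+ 2); ring.
by rewrite !IH -natr1; ring.
Qed.

Definition node (n k : nat) : R := 2 * k%:R / n%:R - 1.

Lemma node_itv n k : (0 < n)%N -> (k <= n)%N -> `|node n k| <= 1.
Proof.
move=> n0 kn; rewrite /node ler_norml.
have nR : 0 < n%:R :> R by rewrite ltr0n.
have h1 : 0 <= k%:R / n%:R :> R by rewrite divr_ge0.
have h2 : k%:R / n%:R <= 1 :> R by rewrite ler_pdivrMr // mul1r ler_nat.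
by rewrite -mulrA; apply/andP; split; lra.
Qed.

(** The inequality [t <= d + t^2 / d] replaces Chebyshev's splitting, and the mean square deviation
    of the nodes from [x] is at most [1 / n]. The degree depends only on [L] and [e], so one degree
    serves all slices of a function of two variables. *)
Lemma bern_approx (L e : R) : 0 <= L -> 0 < e -> exists2 n : nat, (0 < n)%N &
  forall h : R -> R,
    (forall s t, `|s| <= 1 -> `|t| <= 1 -> `|h s - h t| <= L * `|s - t|) ->
    forall x, `|x| <= 1 ->
      `|h x - bern n (fun k => h (node n k)) ((1 + x) / 2)| <= e.
Proof.
move=> L0 e0; pose d := e / (2 * (L + 1)).
have L1 : 0 < L + 1 by rewrite ltr_wpDl.
have d0 : 0 < d by rewrite divr_gt0 // mulr_gt0.
have [m Hm] : exists m : nat, d ^- 2 < m%:R.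
  by exists (Num.truncn (d ^- 2)).+1; rewrite truncnS_gt.
exists m.+1 => // h hL x x1.
pose n := m.+1; have nR : 0 < n%:R :> R by rewrite ltr0n.
have nd : n%:R^-1 <= d ^+ 2.
  rewrite -[X in _ <= X]invrK lef_pV2 ?posrE ?invr_gt0 ?exprn_gt0 //.
  by apply/ltW/(lt_le_trans Hm); rewrite ler_nat.
pose p := (1 + x) / 2.
have p01 : 0 <= p <= 1 by move: x1; rewrite /p ler_norml => /andP[? ?]; apply/andP; split; lra.
(* Since [x = 2 p - 1], the deviation [x - node n k] equals [2 (n p - k) / n], which explains the
   factor [4 / n^2]. *)
pose q k := L * (d + (4 / n%:R ^+ 2 / d) * (k%:R - n%:R * p) ^+ 2).
have B k : (k <= n)%N -> `|h x - h (node n k)| <= q k.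
  move=> kn; apply: (le_trans (hL _ _ x1 (@node_itv n k isT kn))).
  apply: ler_wpM2l => //.
  have -> : 4 / n%:R ^+ 2 / d * (k%:R - n%:R * p) ^+ 2 = (x - node n k) ^+ 2 / d.
    by rewrite /p /node; field; rewrite gt_eqF // gt_eqF.
  rewrite -(real_normK (num_real (x - node n k))).
  move: (`|x - node n k|) (normr_ge0 (x - node n k)) => t t0.
  rewrite -lerBlDl ler_pdivlMr //; have := sqr_ge0 (t - d).
  by rewrite sqrrB; nra.
have bq : bern n q p <= e.
  have -> : bern n q p = L * (d + 4 / n%:R ^+ 2 / d * (n%:R * p * (1 - p))).
    rewrite (bernZ n L (fun k => d + 4 / n%:R ^+ 2 / d * (k%:R - n%:R * p) ^+ 2)).
    rewrite (bernD n (fun _ => d)) bern_cst bernZ bern_second_moment.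
    by rewrite subrr expr0n /= addr0.
  have h1 : 4 / n%:R ^+ 2 / d * (n%:R * p * (1 - p)) <= d.
    have -> : 4 / n%:R ^+ 2 / d * (n%:R * p * (1 - p)) = n%:R^-1 / d * (4 * (p * (1 - p))).
      by field; rewrite gt_eqF // gt_eqF.
    have h2 : 4 * (p * (1 - p)) <= 1 by have := sqr_ge0 (2 * p - 1); rewrite sqrrB exprMn; nra.
    have h3 : n%:R^-1 / d <= d by rewrite ler_pdivrMr // -expr2.
    have h4 : 0 <= n%:R^-1 / d :> R by rewrite divr_ge0 // ?invr_ge0 ltW.
    by apply: le_trans h3; rewrite ler_piMr.
  have -> : e = (L + 1) * (d + d) by rewrite /d; field; rewrite gt_eqF.
  apply: (@le_trans _ _ (L * (d + d))); first by rewrite ler_wpM2l // lerD2l.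
  by rewrite ler_wpM2r ?addr_ge0 ?(ltW d0) // lerDl.
have E : h x = bern n (fun _ => h x) p by rewrite bern_cst.
rewrite E -bernB ler_norml; apply/andP; split; last first.
  apply: le_trans bq; apply: bern_le => // k kn.
  by apply: le_trans (B k kn); exact: ler_norm.
rewrite lerNl -mulN1r -bernZ; apply: le_trans bq; apply: bern_le => // k kn.
by apply: le_trans (B k kn); rewrite mulN1r -normrN; exact: ler_norm.
Qed.

End bernstein_operator.

(** * Polynomial approximation on the square, together with derivatives *)

Section polynomial_approximation.
Variable R : realType.
Local Notation plane := (R * R)%type.
Implicit Types (f g P : plane -> R) (x : plane).

Definition sq : set plane := [set x | `|x.1| <= 1 /\ `|x.2| <= 1].

Lemma sq_compact : compact sq.
Proof.
have C1 := @segment_compact R (- 1) 1.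
apply: (subclosed_compact _ (compact_setX C1 C1)); last first.
  by move=> x [/=]; rewrite !ler_norml => h1 h2; split; rewrite /= in_itv.
rewrite (_ : sq = (fun x : plane => `|x.1|) @^-1` [set t | t <= 1] `&`
                  (fun x : plane => `|x.2|) @^-1` [set t | t <= 1]) //.
apply: closedI; apply: closed_comp; try exact: closed_le.
  by move=> x _; apply: (@cvg_comp _ _ _ fst (fun t : R => `|t|)); [exact: cvg_fst|exact: norm_continuous].
by move=> x _; apply: (@cvg_comp _ _ _ snd (fun t : R => `|t|)); [exact: cvg_snd|exact: norm_continuous].
Qed.

Lemma within_compact_bounded (K : set plane) f : compact K ->
  {within K, continuous f} ->
  exists2 M, 0 <= M & forall x, K x -> `|f x| <= M.
Proof.
move=> cK cf; have [[x0 Kx0]|K0] := pselect (K !=set0); last first.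
  by exists 0 => // x Kx; exfalso; apply: K0; exists x.
have ne : K !=set0 by exists x0.
have [c _ cmax] := compact_EVT_max ne cK cf.
have [b _ bmin] := compact_EVT_min ne cK cf.
exists (`|f c| + `|f b|); first by rewrite addr_ge0.
move=> x Kx; have := cmax x; have := bmin x; rewrite inE => /(_ Kx) h1 /(_ Kx) h2.
rewrite ler_norml; apply/andP; split.
  have := ler_norm (- f b); rewrite normrN; have := normr_ge0 (f c); lra.
have := ler_norm (f c); have := normr_ge0 (f b); lra.
Qed.

Lemma Cinf_bounded (K : set plane) f : compact K -> Cinf f ->
  exists2 M, 0 <= M & forall x, K x -> `|f x| <= M.
Proof.
by move=> cK Cf; apply: within_compact_bounded => //; exact: continuous_subspaceT (Cinf_continuous Cf).
Qed.

Lemma between_itv (s t c : R) : `|s| <= 1 -> `|t| <= 1 ->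
  Num.min s t <= c <= Num.max s t -> `|c| <= 1.
Proof.
rewrite !ler_norml => /andP[? ?] /andP[? ?] /andP[].
by rewrite ge_min le_max => /orP[?|?] /orP[?|?]; apply/andP; split; lra.
Qed.

Lemma lipschitz1 f (L : R) : Cinf f -> (forall x, sq x -> `|partial1 f x| <= L) ->
  forall y s t, `|y| <= 1 -> `|s| <= 1 -> `|t| <= 1 ->
    `|f (s, y) - f (t, y)| <= L * `|s - t|.
Proof.
move=> Cf H y s t y1 s1 t1.
have := @mean_value_bound R (fun u => f (u, y)) t s 0 L.
rewrite mul0r subr0; apply=> u ust.
  by have := @Cinf_derivable1 R f (u, y) Cf; rewrite derivable_e1.
have := H (u, y); rewrite partial1E subr0; apply; split => //=.
exact: between_itv ust.
Qed.

Lemma lipschitz2 f (L : R) : Cinf f -> (forall x, sq x -> `|partial2 f x| <= L) ->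
  forall y s t, `|y| <= 1 -> `|s| <= 1 -> `|t| <= 1 ->
    `|f (y, s) - f (y, t)| <= L * `|s - t|.
Proof.
move=> Cf H y s t y1 s1 t1.
have := @mean_value_bound R (fun u => f (y, u)) t s 0 L.
rewrite mul0r subr0; apply=> u ust.
  by have := @Cinf_derivable2 R f (y, u) Cf; rewrite derivable_e2.
have := H (y, u); rewrite partial2E subr0; apply; split => //=.
exact: between_itv ust.
Qed.

Lemma pol_bern n (phi : nat -> plane -> R) (p : plane -> R) :
  (forall k, pol (phi k)) -> pol p -> pol (fun x => bern n (phi^~ x) (p x)).
Proof.
move=> + pp; elim: n phi => [|n IH] phi Hphi /=; first exact: Hphi.
apply: polD; apply: polM => //.
- exact: (IH (fun k => phi k.+1)).
- by apply: polD; [exact: pol_cst|apply: (pol_eq (polZ (-1) pp)) => x; rewrite mulN1r].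
- exact: IH.
Qed.

Lemma pol_affine (p : plane -> R) : pol p -> pol (fun x => (1 + p x) / 2).
Proof.
move=> pp; apply: (pol_eq (polZ 2^-1 (polD (pol_cst 1) pp))) => x.
by rewrite mulrC.
Qed.

(** Bernstein operators are applied in one variable after the other; averaging over the nodes of the
    first does not enlarge the error made in the second. *)
Lemma weierstrass g (e : R) : Cinf g -> 0 < e ->
  exists2 P, pol P & forall x, sq x -> `|g x - P x| <= e.
Proof.
move=> Cg e0.
have [L1 L10 B1] := Cinf_bounded sq_compact (Cinf_partial1 Cg).
have [L2 L20 B2] := Cinf_bounded sq_compact (Cinf_partial2 Cg).
have e20 : 0 < e / 2 by rewrite divr_gt0.
have [n n0 Hn] := bern_approx L10 e20.
have [m m0 Hm] := bern_approx L20 e20.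
exists (fun x => bern n (fun k => bern m (fun l => g (node R n k, node R m l))
   ((1 + x.2) / 2)) ((1 + x.1) / 2)).
  apply: (@pol_bern n (fun k x => bern m (fun l => g (node R n k, node R m l))
   ((1 + x.2) / 2))) => [k|]; last exact/pol_affine/pol_fst.
  apply: (@pol_bern m (fun l x => g (node R n k, node R m l))) => [l|].
    exact: pol_cst.
  exact/pol_affine/pol_snd.
move=> -[a b] [/= a1 b1].
have h1 := Hn (fun s => g (s, b)) (fun s t => lipschitz1 Cg B1 b1) a a1.
set p := (1 + a) / 2 in h1 *.
have p01 : 0 <= p <= 1 by move: a1; rewrite /p ler_norml => /andP[? ?]; apply/andP; split; lra.
set u := bern n _ p in h1; set v := bern n _ p.
have h2 : `|u - v| <= e / 2.
  rewrite -bernB; have {1}-> : e / 2 = bern n (fun _ => e / 2) p by rewrite bern_cst.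
  have H k : (k <= n)%N -> `|g (node R n k, b)
      - bern m (fun l => g (node R n k, node R m l)) ((1 + b) / 2)| <= e / 2.
    move=> kn; apply: (Hm (fun t => g (node R n k, t))) => // s t.
    exact/(lipschitz2 Cg B2)/node_itv.
  rewrite ler_norml; apply/andP; split; last first.
    by apply: bern_le => // k /H; rewrite ler_norml => /andP[].
  rewrite lerNl -mulN1r -bernZ; apply: bern_le => // k /H.
  by rewrite ler_norml mulN1r lerNl => /andP[].
have -> : g (a, b) - v = (g (a, b) - u) + (u - v) by rewrite addrA subrK.
by rewrite (splitr e); apply: le_trans (ler_normD _ _) _; apply: lerD.
Qed.

Lemma gtr_half (e : R) : 0 < e -> e / 2 < e.
Proof. by move=> e0; lra. Qed.

Definition pd (i j : nat) f : plane -> R := iter i (@partial1 R) (iter j (@partial2 R) f).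

Lemma Cinf_iter2 i f : Cinf f -> Cinf (iter i (@partial2 R) f).
Proof. by move=> Cf; elim: i => //= i IH; exact: Cinf_partial2. Qed.

Lemma pd_Sl i j f : Cinf f -> pd i.+1 j f = pd i j (partial1 f).
Proof.
move=> Cf; rewrite /pd iterSr; congr iter.
elim: j f Cf => // j IH f Cf; rewrite !iterSr IH; last exact: Cinf_partial2.
by rewrite Cinf_schwarz.
Qed.

Lemma pd_0Sr j f : pd 0 j.+1 f = pd 0 j (partial2 f).
Proof. exact: iterSr. Qed.

Lemma pd_axis j f h : (forall t, f (0, t) = h (0, t)) ->
  forall t, pd 0 j f (0, t) = pd 0 j h (0, t).
Proof.
move=> E; rewrite /pd /=; elim: j f h E => // j IH f h E t.
rewrite !iterSr; apply: IH => {}t; rewrite !partial2E /=.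
by rewrite (_ : (fun u => f (0, u)) = (fun u => h (0, u))) //; apply/funext.
Qed.

Definition approximable i j g := forall e, 0 < e -> exists2 P, pol P &
  forall a b, (a <= i)%N -> (b <= j)%N -> forall x, sq x ->
    `|pd a b (fun y => g y - P y) x| <= e.

Lemma approximable00 g : Cinf g -> approximable 0 0 g.
Proof.
move=> Cg e e0; have [P pP H] := weierstrass Cg e0.
by exists P => // -[|//] [|//] _ _ x; exact: H.
Qed.

Lemma partial1B f g : Cinf f -> Cinf g ->
  partial1 (fun y => f y - g y) = fun y => partial1 f y - partial1 g y.
Proof.
by move=> Cf Cg; apply: isd_partial1 => x; apply: isdD; [|apply: isdN]; exact: Cinf_isd1.
Qed.

Lemma partial2B f g : Cinf f -> Cinf g ->
  partial2 (fun y => f y - g y) = fun y => partial2 f y - partial2 g y.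
Proof.
by move=> Cf Cg; apply: isd_partial2 => x; apply: isdD; [|apply: isdN]; exact: Cinf_isd2.
Qed.

Lemma zero_itv : `|0 : R| <= 1. Proof. by rewrite normr0. Qed.

Lemma le_normB (a b c d : R) : `|a - b| <= d -> `|b| <= c -> `|a| <= c + d.
Proof.
move=> h1 h2; rewrite -(subrK b a) addrC; apply: le_trans (ler_normD _ _) _.
exact: lerD.
Qed.

(** Approximate the derivative in the second variable, integrate the approximation from the axis
    [x.2 = 0], and add an approximation of the trace on that axis. *)
Lemma approximable0S j : (forall g, Cinf g -> approximable 0 j g) ->
  forall g, Cinf g -> approximable 0 j.+1 g.
Proof.
move=> IH g Cg e e0; have e20 : 0 < e / 2 by rewrite divr_gt0.
have [Q pQ HQ] := IH _ (Cinf_partial2 Cg) _ e20.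
have Cg0 : Cinf (fun x => g (x.1, 0)).
  by apply: (@Cinf_comp _ g); [exact: Cg|exact: Cinf_fst|exact: Cinf_cst].
have [p pp Hp] := weierstrass Cg0 e20.
have [F pF [dF F0]] := pol_antiderivative2 pQ 0.
(* [p] approximates the trace but may depend on both variables; freezing the second one keeps it out
   of the derivative in that direction. *)
have pp0 : pol (fun x => p (x.1, 0)).
  elim: pp => [c|f _ pf|f _ pf|f h _ pf _ ph].
  - exact: pol_cst.
  - exact: (pol_mulx pf).
  - by apply: (pol_eq (pol_cst 0)) => x; rewrite /= mul0r.
  - exact: (polD pf ph).
pose P (x : plane) := p (x.1, 0) + F x.
have pP : pol P by exact: polD.
have CP := pol_Cinf pP.
exists P => // -[|//] b _ bj x xsq.
have E2 : partial2 (fun y => g y - P y) = fun y => partial2 g y - Q y.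
  rewrite partial2B //; apply/funext => y; congr (_ - _).
  have -> // : partial2 P = Q.
  apply: isd_partial2 => z; apply: (is_derive_eq (isdD _ (dF z))).
    by apply/is_derive_e2; exact: (isdC z.2 (1 : R) (p (z.1, 0))).
  by rewrite expr0 mul1r add0r.
case: b bj => [_|b bj]; last first.
  by rewrite pd_0Sr E2; exact: (le_trans (HQ 0%N b isT bj x xsq) (ltW (gtr_half e0))).
rewrite /pd /=; have CgP : Cinf (fun y => g y - P y) by exact: CinfB.
have B : forall y, sq y -> `|partial2 (fun y => g y - P y) y| <= e / 2.
  by rewrite E2; exact: (HQ 0%N 0%N isT isT).
have := lipschitz2 CgP B.
case: x xsq => x1 x2 [/= h1 h2] /(_ x1 x2 0 h1 h2 zero_itv) H.
rewrite (splitr e); apply: (@le_normB _ (g (x1, 0) - P (x1, 0))).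
  apply: (le_trans H); rewrite subr0; apply: ler_piMr => //; exact: ltW.
by have := Hp (x1, 0) (conj h1 zero_itv); rewrite /P /= F0 addr0.
Qed.

(** The same construction in the first variable. The trace on [x.1 = 0] must now be approximated
    with its [j] derivatives along the axis, which is the first hypothesis. *)
Lemma approximableS i j : (forall g, Cinf g -> approximable 0 j g) ->
  (forall g, Cinf g -> approximable i j g) ->
  forall g, Cinf g -> approximable i.+1 j g.
Proof.
move=> H0 IH g Cg e e0; have e20 : 0 < e / 2 by rewrite divr_gt0.
have [Q pQ HQ] := IH _ (Cinf_partial1 Cg) _ e20.
have Cg0 : Cinf (fun x => g (0, x.2)).
  by apply: (@Cinf_comp _ g); [exact: Cg|exact: Cinf_cst|exact: Cinf_snd].
have [p pp Hp] := H0 _ Cg0 _ e20.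
have [F pF [dF F0]] := pol_antiderivative1 pQ 0.
have pp0 : pol (fun x => p (0, x.2)).
  elim: pp {Hp} => [c|f _ pf|f _ pf|f h _ pf _ ph].
  - exact: pol_cst.
  - by apply: (pol_eq (pol_cst 0)) => x; rewrite /= mul0r.
  - exact: (pol_muly pf).
  - exact: (polD pf ph).
pose P (x : plane) := p (0, x.2) + F x.
have pP : pol P by exact: polD.
have CP := pol_Cinf pP.
exists P => // a b ai bj x xsq.
have E1 : partial1 (fun y => g y - P y) = fun y => partial1 g y - Q y.
  rewrite partial1B //; apply/funext => y; congr (_ - _).
  have -> // : partial1 P = Q.
  apply: isd_partial1 => z; apply: (is_derive_eq (isdD _ (dF z))).
    by apply/is_derive_e1; exact: (isdC z.1 (1 : R) (p (0, z.2))).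
  by rewrite expr0 mul1r add0r.
have CgP : Cinf (fun y => g y - P y) by exact: CinfB.
case: a ai => [_|a ai]; last first.
  by rewrite pd_Sl // E1; exact: (le_trans (HQ a b ai bj x xsq) (ltW (gtr_half e0))).
have CE : Cinf (pd 0 b (fun y => g y - P y)) by exact: Cinf_iter2.
have B : forall y, sq y -> `|partial1 (pd 0 b (fun y => g y - P y)) y| <= e / 2.
  move=> y ysq; rewrite -[partial1 _]/(pd 1 b (fun y => g y - P y)) pd_Sl // E1.
  exact: HQ.
have := lipschitz1 CE B.
case: x xsq => x1 x2 [/= h1 h2] /(_ x2 x1 0 h2 h1 zero_itv) H.
rewrite (splitr e); apply: (@le_normB _ (pd 0 b (fun y => g y - P y) (0, x2))).
  apply: (le_trans H); rewrite subr0; apply: ler_piMr => //; exact: ltW.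
rewrite (@pd_axis b _ (fun y => g (0, y.2) - p y)); last first.
  by move=> t; rewrite /P /= F0 addr0.
exact: (Hp 0%N b isT bj (0, x2) (conj zero_itv h2)).
Qed.

(** Two derivatives are needed because Hessian bounds for a solution come from the gradient estimate
    applied to its first derivatives, and that estimate involves the gradient of their Laplacian. *)
Lemma approximable22 g : Cinf g -> approximable 2 2 g.
Proof.
have A0 j : forall g, Cinf g -> approximable 0 j g.
  elim: j => [|j IH]; [exact: approximable00|exact: approximable0S].
have A1 := approximableS (A0 2%N) (A0 2%N).
exact: (approximableS (A0 2%N) A1).
Qed.

End polynomial_approximation.

(** * Uniform limits of differentiable functions, with explicit rates *)

Section uniform_limits.
Variable R : realType.
Local Notation plane := (R * R)%type.

Lemma archimedean_le (a b K : R) :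
  (forall n : nat, a <= b + K / n.+1%:R) -> a <= b.
Proof.
move=> H; apply/ler_addgt0Pr => e e0.
have [n Hn] : exists n : nat, `|K| / e < n%:R.
  by exists (Num.truncn (`|K| / e)).+1; rewrite truncnS_gt.
have nR : 0 < n.+1%:R :> R by rewrite ltr0n.
apply: le_trans (H n) _; rewrite lerD2l ler_pdivrMr //.
apply: le_trans (ler_norm _) _.
move: Hn; rewrite ltr_pdivrMr // => /ltW /le_trans; apply.
by rewrite mulrC ler_pM2l // ler_nat.
Qed.

(** The limit is the supremum of the lower bounds [a n - K / (n + 1)], each of which lies below
    every [a m + K / (m + 1)]; this keeps the rate of convergence. *)
Lemma cauchy_limit (a : nat -> R) (K : R) :
  (forall n m, (n <= m)%N -> `|a n - a m| <= K / n.+1%:R) ->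
  exists l, forall n, `|a n - l| <= K / n.+1%:R.
Proof.
move=> H; pose c n : R := K / n.+1%:R.
have H2 n m : a n - c n <= a m + c m.
  have [nm|/ltnW mn] := leqP n m.
    have := H _ _ nm; rewrite ler_norml => /andP[_].
    have : 0 <= c m by apply: le_trans (normr_ge0 _) (H m m (leqnn m)).
    by rewrite -/(c n); move: (c n) (c m) => u v; lra.
  have := H _ _ mn; rewrite ler_norml => /andP[+ _].
  have : 0 <= c n by apply: le_trans (normr_ge0 _) (H n n (leqnn n)).
  by rewrite -/(c m); move: (c n) (c m) => u v; lra.
pose E := [set t | exists n, t = a n - c n].
have E0 : E !=set0 by exists (a 0%N - c 0%N), 0%N.
have ubE m : ubound E (a m + c m) by move=> _ [n ->].
have supE : has_sup E by split => //; exists (a 0%N + c 0%N).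
exists (sup E) => n; rewrite ler_norml; apply/andP; split.
  have : sup E <= a n + c n by apply: ge_sup.
  by rewrite -/(c n); lra.
have : a n - c n <= sup E by apply: sup_upper_bound => //; exists n.
by rewrite -/(c n); lra.
Qed.

(** A general filter covers both continuity at interior points and continuity within the closed
    disk. *)
Lemma continuous_limit (T : Type) (F : set_system T) (f : nat -> T -> R)
    (g : T -> R) (l : nat -> R) (l' K : R) : Filter F ->
  (forall n, f n @ F --> l n) ->
  (forall n, `|l n - l'| <= K / n.+1%:R) ->
  (\forall y \near F, forall n, `|f n y - g y| <= K / n.+1%:R) ->
  g @ F --> l'.
Proof.
move=> FF fl ll' fg; apply/cvgrPdist_le => e e0.
have [n Hn] : exists n : nat, 3 * `|K| / e < n%:R.
  by exists (Num.truncn (3 * `|K| / e)).+1; rewrite truncnS_gt.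
have nR : 0 < n.+1%:R :> R by rewrite ltr0n.
have Kn : K / n.+1%:R <= e / 3.
  rewrite ler_pdivrMr //; move: Hn; rewrite ltr_pdivrMr //.
  have := ler_norm K; have : n%:R * e <= n.+1%:R * e.
    by apply: ler_wpM2r; [exact: ltW|rewrite ler_nat].
  by move: (n%:R * e) (n.+1%:R) => u v; lra.
have e30 : 0 < e / 3 by rewrite divr_gt0.
have /cvgrPdist_le /(_ _ e30) := fl n.
apply: filterS2 fg => y /(_ n) h1 h2; have h3 := ll' n.
move: Kn h1 h2 h3; move: (K / n.+1%:R) (f n y) => k z.
rewrite !ler_norml => ? /andP[? ?] /andP[? ?] /andP[? ?].
by apply/andP; split; lra.
Qed.

(** For fixed increment [h] the mean value theorem is applied to each [f n], and [n] then tends to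
    infinity; the points it provides may vary with [n], since only continuity of [G] near [x] is
    used. *)
Lemma is_derive_limit (f g : nat -> R -> R) (F G : R -> R) (x r K : R) :
  0 < r ->
  (forall n t, `|t - x| < r -> is_derive t 1 (f n) (g n t)) ->
  (forall n t, `|t - x| < r -> `|f n t - F t| <= K / n.+1%:R) ->
  (forall n t, `|t - x| < r -> `|g n t - G t| <= K / n.+1%:R) ->
  {for x, continuous G} -> is_derive x 1 F (G x).
Proof.
move=> r0 dfg fF gG cG.
suff H : (fun h => h^-1 *: ((F \o shift x) (h *: (1 : R)) - F x)) @ 0^' --> G x.
  by apply: DeriveDef; [apply/cvg_ex; exists (G x)|apply: cvg_lim].
apply/cvgrPdist_le => e e0.
have /cvgrPdist_le /(_ _ e0) /nbhs_ballP[d /= d0 Hd] := cG.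
apply/nbhs_ballP; exists (Num.min r d); first by rewrite /= lt_min r0 d0.
move=> h; rewrite /ball /= sub0r normrN lt_min => /andP[hr hd] h0.
have Exh : h *: (1 : R) + x = x + h by rewrite [_ *: _]mulr1 addrC.
rewrite Exh.
have hx : `|x + h - x| < r by rewrite addrAC subrr add0r.
have xx : `|x - x| < r by rewrite subrr normr0.
have inr t : Num.min x (x + h) <= t <= Num.max x (x + h) -> `|t - x| <= `|h|.
  by rewrite (addrC x h) distrC; exact: between_norm.
have key : `|F (x + h) - F x - h * G x| <= `|h| * e.
  apply: (@archimedean_le _ _ (2 * K + `|h| * K)) => n.
  have [|c cx E] := @mean_value R (f n) x (x + h).
    move=> t /inr ht; suff /(dfg n)/is_deriveP[] : `|t - x| < r by [].
    exact: le_lt_trans ht hr.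
  have cr : `|c - x| < r by apply: le_lt_trans hr; exact: inr.
  have cd : `|c - x| < d by apply: le_lt_trans hd; exact: inr.
  have := dfg n c cr => /is_deriveP[_ E2].
  rewrite E2 addrAC subrr add0r in E.
  have h1 := fF n _ hx; have h2 := fF n _ xx; have h3 := gG n _ cr.
  have h4 : `|G x - G c| <= e by apply: Hd; rewrite /ball /= distrC.
  have -> : F (x + h) - F x - h * G x =
      - (f n (x + h) - F (x + h)) + (f n x - F x) + h * ((g n c - G c) - (G x - G c)).
    transitivity (- (f n (x + h) - f n x) + F (x + h) - F x + h * (g n c - G x)).
      by rewrite E; ring.
    by ring.
  apply: le_trans (ler_normD _ _) _; rewrite normrM.
  have k1 : `|- (f n (x + h) - F (x + h)) + (f n x - F x)| <= K / n.+1%:R + K / n.+1%:R.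
    by apply: le_trans (ler_normD _ _) _; rewrite normrN lerD.
  have k2 : `|(g n c - G c) - (G x - G c)| <= K / n.+1%:R + e.
    by apply: le_trans (ler_normB _ _) _; rewrite lerD.
  have k3 := ler_wpM2l (normr_ge0 h) k2.
  apply: le_trans (lerD k1 k3) _; rewrite mulrDr le_eqVlt; apply/orP; left; apply/eqP.
  by ring.
have hn0 : h != 0 by [].
have -> : G x - h^-1 *: (F (x + h) - F x) = - (h^-1 * (F (x + h) - F x - h * G x)).
  by rewrite /GRing.scale /=; field.
rewrite normrN normrM normfV ler_pdivrMl ?normr_gt0 //.
Qed.

Lemma is_derive_near (U : set plane) (f g : plane -> R) (x v : plane) (d : R) :
  open U -> U x -> (forall y, U y -> f y = g y) ->
  is_derive x v f d -> is_derive x v g d.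
Proof.
move=> oU Ux fg; apply: near_eq_is_derive.
by apply: filterS (open_nbhs_nbhs (conj oU Ux)) => y; exact: fg.
Qed.

Lemma continuous_near (U : set plane) (f g : plane -> R) (x : plane) :
  open U -> U x -> (forall y, U y -> f y = g y) ->
  {for x, continuous f} -> {for x, continuous g}.
Proof.
move=> oU Ux fg cf; rewrite /prop_for /continuous_at -(fg _ Ux).
apply: (cvg_trans _ cf); apply: near_eq_cvg.
by apply: filterS (open_nbhs_nbhs (conj oU Ux)) => y Uy; rewrite fg.
Qed.

Lemma C2_intro (U : set plane) (f f1 f2 f11 f12 f21 f22 : plane -> R) :
  open U ->
  (forall x, U x -> [/\ is_derive x (1, 0) f (f1 x), is_derive x (0, 1) f (f2 x)
    & {for x, continuous f}]) ->
  (forall x, U x -> [/\ is_derive x (1, 0) f1 (f11 x), is_derive x (0, 1) f1 (f12 x)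
    & {for x, continuous f1}]) ->
  (forall x, U x -> [/\ is_derive x (1, 0) f2 (f21 x), is_derive x (0, 1) f2 (f22 x)
    & {for x, continuous f2}]) ->
  (forall x, U x -> {for x, continuous f11} /\ {for x, continuous f12}) ->
  (forall x, U x -> {for x, continuous f21} /\ {for x, continuous f22}) ->
  Ck 2 U f /\ forall x, U x -> laplacian f x = f11 x + f22 x.
Proof.
move=> oU H H1 H2 c1 c2.
have E1 x : U x -> f1 x = partial1 f x.
  by move=> /H[/is_deriveP[_ E] _ _]; rewrite -E.
have E2 x : U x -> f2 x = partial2 f x.
  by move=> /H[_ /is_deriveP[_ E] _]; rewrite -E.
have D11 x : U x -> is_derive x (1, 0) (partial1 f) (f11 x).
  by move=> Ux; have [+ _ _] := H1 x Ux; exact: is_derive_near E1.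
have D12 x : U x -> is_derive x (0, 1) (partial1 f) (f12 x).
  by move=> Ux; have [_ + _] := H1 x Ux; exact: is_derive_near E1.
have D21 x : U x -> is_derive x (1, 0) (partial2 f) (f21 x).
  by move=> Ux; have [+ _ _] := H2 x Ux; exact: is_derive_near E2.
have D22 x : U x -> is_derive x (0, 1) (partial2 f) (f22 x).
  by move=> Ux; have [_ + _] := H2 x Ux; exact: is_derive_near E2.
have E11 x : U x -> f11 x = partial1 (partial1 f) x.
  by move=> /D11/is_deriveP[_ E]; rewrite -E.
have E12 x : U x -> f12 x = partial2 (partial1 f) x.
  by move=> /D12/is_deriveP[_ E]; rewrite -E.
have E21 x : U x -> f21 x = partial1 (partial2 f) x.
  by move=> /D21/is_deriveP[_ E]; rewrite -E.
have E22 x : U x -> f22 x = partial2 (partial2 f) x.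
  by move=> /D22/is_deriveP[_ E]; rewrite -E.
split; last by move=> x Ux; rewrite laplacianE -E11 // -E22.
split; first by move=> x /H[].
split.
- by move=> x /H[/is_deriveP[]].
- by move=> x /H[_ /is_deriveP[]].
- split; first by move=> x Ux; have [_ _] := H1 x Ux; exact: continuous_near E1.
  split.
  + by move=> x /D11/is_deriveP[].
  + by move=> x /D12/is_deriveP[].
  + by split; [move=> x Ux; have [+ _] := c1 x Ux; exact: continuous_near E11|exact: I].
  + by split; [move=> x Ux; have [_ +] := c1 x Ux; exact: continuous_near E12|exact: I].
- split; first by move=> x Ux; have [_ _] := H2 x Ux; exact: continuous_near E2.
  split.
  + by move=> x /D21/is_deriveP[].
  + by move=> x /D22/is_deriveP[].
  + by split; [move=> x Ux; have [+ _] := c2 x Ux; exact: continuous_near E21|exact: I].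
  + by split; [move=> x Ux; have [_ +] := c2 x Ux; exact: continuous_near E22|exact: I].
Qed.

End uniform_limits.

(** * A priori bounds for smooth solutions with zero boundary values *)

Section dirichlet_problem.
Variable R : realType.
Local Notation plane := (R * R)%type.
Implicit Types (f g u v : plane -> R) (x : plane).

Lemma laplacian_partial1 u : Cinf u ->
  laplacian (partial1 u) = partial1 (laplacian u).
Proof.
move=> Cu; have C1 := Cinf_partial1 Cu; have C2 := Cinf_partial2 Cu.
have E : partial2 (partial2 (partial1 u)) = partial1 (partial2 (partial2 u)).
  by rewrite -(Cinf_schwarz Cu) -(Cinf_schwarz C2).
have D : partial1 (fun y => partial1 (partial1 u) y + partial2 (partial2 u) y) =
    fun y => partial1 (partial1 (partial1 u)) y + partial1 (partial2 (partial2 u)) y.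
  apply: isd_partial1 => y.
  by apply: isdD; apply: Cinf_isd1; [exact: Cinf_partial1|exact: Cinf_partial2].
rewrite -[RHS]/(partial1 (fun y => partial1 (partial1 u) y + partial2 (partial2 u) y)) D.
by apply/funext => x; rewrite laplacianE E.
Qed.

Lemma laplacian_partial2 u : Cinf u ->
  laplacian (partial2 u) = partial2 (laplacian u).
Proof.
move=> Cu; have C1 := Cinf_partial1 Cu; have C2 := Cinf_partial2 Cu.
have E : partial1 (partial1 (partial2 u)) = partial2 (partial1 (partial1 u)).
  by rewrite (Cinf_schwarz Cu) (Cinf_schwarz C1).
have D : partial2 (fun y => partial1 (partial1 u) y + partial2 (partial2 u) y) =
    fun y => partial2 (partial1 (partial1 u)) y + partial2 (partial2 (partial2 u)) y.
  apply: isd_partial2 => y.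
  by apply: isdD; apply: Cinf_isd2; [exact: Cinf_partial1|exact: Cinf_partial2].
rewrite -[RHS]/(partial2 (fun y => partial1 (partial1 u) y + partial2 (partial2 u) y)) D.
by apply/funext => x; rewrite laplacianE E.
Qed.

Lemma Cinf_nsq : Cinf (@nsq R).
Proof. by apply: CinfD; apply: CinfX; [exact: Cinf_fst|exact: Cinf_snd]. Qed.

Lemma laplacian_nsq x : laplacian (@nsq R) x = 4.
Proof.
have E1 : partial1 (@nsq R) = fun y => 2 * y.1.
  by apply: isd_partial1 => y; rewrite /nsq; isd; rewrite /=; ring.
have E2 : partial2 (@nsq R) = fun y => 2 * y.2.
  by apply: isd_partial2 => y; rewrite /nsq; isd; rewrite /=; ring.
have E11 : partial1 (fun y : plane => 2 * y.1) = fun y => 2.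
  by apply: isd_partial1 => y; isd; rewrite /=; ring.
have E22 : partial2 (fun y : plane => 2 * y.2) = fun y => 2.
  by apply: isd_partial2 => y; isd; rewrite /=; ring.
by rewrite laplacianE E1 E2 E11 E22; ring.
Qed.

Lemma nsq_ge0 x : 0 <= nsq x.
Proof. by rewrite addr_ge0 ?sqr_ge0. Qed.

Lemma Cinf_max_principle u (m : R) : Cinf u ->
  (forall x, nsq x < 1 -> 0 <= laplacian u x) ->
  (forall x, nsq x = 1 -> u x <= m) -> forall x, nsq x <= 1 -> u x <= m.
Proof.
move=> Cu L bd; have C1 := Cinf_partial1 Cu; have C2 := Cinf_partial2 Cu.
apply: (@max_principle R 1 m u (partial1 u) (partial2 u)
  (partial1 (partial1 u)) (partial2 (partial2 u))) => //.
- exact: continuous_subspaceT (Cinf_continuous Cu).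
- by move=> x _; exact: Cinf_isd1.
- by move=> x _; exact: Cinf_isd2.
- by move=> x _; exact: Cinf_isd1.
- by move=> x _; exact: Cinf_isd2.
Qed.

(** Adding [d / 4 * nsq], whose Laplacian is [d], makes [u] and [- u] subharmonic. *)
Lemma solution_sup_bound u (d : R) : 0 <= d -> Cinf u ->
  (forall x, nsq x <= 1 -> `|laplacian u x| <= d) ->
  (forall x, nsq x = 1 -> u x = 0) ->
  forall x, nsq x <= 1 -> `|u x| <= d.
Proof.
move=> d0 Cu Ld bd.
have H v : Cinf v -> (forall x, nsq x <= 1 -> - d <= laplacian v x) ->
    (forall x, nsq x = 1 -> v x = 0) -> forall x, nsq x <= 1 -> v x <= d.
  move=> Cv Lv bv x x1.
  have Cn : Cinf (fun x => d / 4 * @nsq R x) by apply: CinfZ; exact: Cinf_nsq.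
  have : v x + d / 4 * nsq x <= d / 4.
    apply: (@Cinf_max_principle (fun x => v x + d / 4 * nsq x)) => //.
    - exact: CinfD.
    - move=> y y1; rewrite laplacianD // laplacianZ; last exact: Cinf_nsq.
      rewrite laplacian_nsq; have := Lv y (ltW y1).
      by rewrite divfK //; lra.
    - by move=> y y1; rewrite bv // y1; lra.
  have : 0 <= d / 4 * nsq x by rewrite mulr_ge0 ?nsq_ge0 // divr_ge0.
  by move: (d / 4 * nsq x) => w; lra.
move=> x x1; rewrite ler_norml lerNl; apply/andP; split; last first.
  by apply: H => // y /Ld; rewrite ler_norml => /andP[].
rewrite -mulN1r; apply: (H (fun y => -1 * u y)) => //.
- exact: CinfZ.
- move=> y y1; rewrite laplacianZ // mulN1r lerN2.
  by have := Ld y y1; rewrite ler_norml => /andP[].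
- by move=> y y1; rewrite bd // mulr0.
Qed.

(** The factor 5 rounds up the square root of 21. *)
Lemma sum_sqr_bound (a b c D : R) : 0 < a -> 0 <= D ->
  a ^+ 2 * (b ^+ 2 + c ^+ 2) <= 21 * D ^+ 2 ->
  `|b| <= 5 * D / a /\ `|c| <= 5 * D / a.
Proof.
move=> a0 D0 H; have h z : a ^+ 2 * z ^+ 2 <= 21 * D ^+ 2 -> `|z| <= 5 * D / a.
  move=> h; rewrite ler_pdivlMr //.
  have p1 : 0 <= `|z| * a by rewrite mulr_ge0 // ltW.
  have p2 : 0 <= 5 * D by rewrite mulr_ge0.
  rewrite -ler_sqr ?nnegrE // !exprMn mulrC real_normK ?num_real //.
  apply: (le_trans h).
  by apply: ler_wpM2r; [exact: sqr_ge0|lra].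
have := sqr_ge0 b; have := sqr_ge0 c; have := sqr_ge0 a => a2 c2 b2.
by split; apply: h; move: H; rewrite mulrDr; nra.
Qed.

Definition jet_bound f (d : R) := forall x, nsq x <= 1 ->
  [/\ `|f x| <= d, `|partial1 f x| <= d /\ `|partial2 f x| <= d,
     `|partial1 (partial1 f) x| <= d /\ `|partial2 (partial1 f) x| <= d &
     `|partial1 (partial2 f) x| <= d /\ `|partial2 (partial2 f) x| <= d].

(** The constant comes from [5 * (A + d)] divided by the gap [(1 - nsq x) / 2], where
    [A = 20 d / (1 - nsq x)]: it is [5 * 2 * (20 + 1)]. *)
Definition rate x : R := 210 / (1 - nsq x) ^+ 2.

Lemma solution_gradient_bound u (d : R) : 0 <= d -> Cinf u ->
  jet_bound (laplacian u) d -> (forall x, nsq x = 1 -> u x = 0) ->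
  forall x, nsq x < 1 ->
    `|partial1 u x| <= 10 * d / (1 - nsq x) /\
    `|partial2 u x| <= 10 * d / (1 - nsq x).
Proof.
move=> d0 Cu J bd x x1.
have G : (1 - nsq x) ^+ 2 * (partial1 u x ^+ 2 + partial2 u x ^+ 2) <= 21 * (d + d) ^+ 2.
  apply: (@gradient_estimate R u 1 d d) => //.
  - by rewrite ler01 lexx.
  - by apply: solution_sup_bound => // y /J[].
  - by move=> y /J[].
  - by move=> y /J[_ []].
  - by move=> y /J[_ []].
  - exact: ltW.
have -> : 10 * d = 5 * (d + d) by ring.
by apply: sum_sqr_bound => //; [rewrite subr_gt0|rewrite addr_ge0].
Qed.

Lemma rate_ge (d n A : R) : 0 <= d -> 0 <= n < 1 ->
  A <= 20 * d / (1 - n) -> 5 * (A + d) / ((1 + n) / 2 - n) <= 210 / (1 - n) ^+ 2 * d.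
Proof.
move=> d0 /andP[n0 n1] hA.
have k0 : 0 < 1 - n by rewrite subr_gt0.
have -> : (1 + n) / 2 - n = (1 - n) / 2 by field.
rewrite ler_pdivrMr ?divr_gt0 //.
have -> : 210 / (1 - n) ^+ 2 * d * ((1 - n) / 2) = 105 * (d / (1 - n)).
  by field; rewrite gt_eqF.
have h : d <= d / (1 - n) by rewrite ler_pdivlMr // ler_piMr // gerBl.
by move: hA h; rewrite -mulrA; move: (d / (1 - n)) => w; lra.
Qed.

Lemma midpoint_bounds (z : R) : 0 <= z < 1 ->
  [/\ 0 <= (1 + z) / 2 <= 1, z < (1 + z) / 2 & (1 + z) / 2 < 1].
Proof. by move=> /andP[? ?]; split; [apply/andP; split| |]; lra. Qed.

Lemma midpoint_half (y z : R) : y <= (1 + z) / 2 -> 1 - z <= 2 * (1 - y).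
Proof. lra. Qed.

(** The first derivatives of [u] solve equations whose right-hand sides are derivatives of the given
    one, so the gradient estimate applies to them as well, on a smaller concentric disk where they
    are already bounded. *)
Lemma solution_bounds u (d : R) : 0 <= d -> Cinf u ->
  jet_bound (laplacian u) d -> (forall x, nsq x = 1 -> u x = 0) ->
  forall x, nsq x < 1 ->
  [/\ `|u x| <= rate x * d,
    `|partial1 u x| <= rate x * d /\ `|partial2 u x| <= rate x * d,
    `|partial1 (partial1 u) x| <= rate x * d /\ `|partial2 (partial1 u) x| <= rate x * d &
    `|partial1 (partial2 u) x| <= rate x * d /\ `|partial2 (partial2 u) x| <= rate x * d].
Proof.
move=> d0 Cu J bd x x1.
have [g1 g2] := solution_gradient_bound d0 Cu J bd x1.
have n01 : 0 <= nsq x < 1 by rewrite nsq_ge0.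
have k0 : 0 < 1 - nsq x by rewrite subr_gt0.
have d1 : d <= d / (1 - nsq x) by rewrite ler_pdivlMr // ler_piMr // gerBl nsq_ge0.
have d2 : d / (1 - nsq x) <= d / (1 - nsq x) / (1 - nsq x).
  rewrite ler_pdivlMr // ler_piMr // ?gerBl ?nsq_ge0 //.
  by rewrite divr_ge0 // ltW.
have rE : rate x * d = 210 * (d / (1 - nsq x) / (1 - nsq x)).
  by rewrite /rate; field; rewrite gt_eqF.
have g i : i <= 10 * d / (1 - nsq x) -> i <= rate x * d.
  move=> /le_trans; apply; rewrite rE -mulrA; move: d0 d1 d2.
  by move: (d / (1 - nsq x)) (d / (1 - nsq x) / (1 - nsq x)) => w z; lra.
pose s := (1 + nsq x) / 2.
have [s01 xs s1] := midpoint_bounds n01.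
(* For [nsq y <= s] the distance factor [1 - nsq y] is at least half of [1 - nsq x], which turns the
   gradient constant 10 into 20. *)
pose A := 20 * d / (1 - nsq x).
have A0 : 0 <= A by rewrite divr_ge0 ?mulr_ge0 // ltW.
have gs y : nsq y <= s -> `|partial1 u y| <= A /\ `|partial2 u y| <= A.
  move=> ys; have y1 : nsq y < 1 := le_lt_trans ys s1.
  have [h1 h2] := solution_gradient_bound d0 Cu J bd y1.
  have hA : 10 * d / (1 - nsq y) <= A.
    have y0 : 0 < 1 - nsq y by rewrite subr_gt0.
    rewrite /A ler_pdivrMr // mulrAC ler_pdivlMr //.
    apply: (le_trans (ler_wpM2l _ (midpoint_half ys))); first by rewrite mulr_ge0.
    by rewrite le_eqVlt; apply/orP; left; apply/eqP; ring.
  by split; [exact: le_trans h1 hA|exact: le_trans h2 hA].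
have s_x : 0 < s - nsq x by rewrite subr_gt0.
have sle y : nsq y <= s -> nsq y <= 1 by move=> ys; exact: ltW (le_lt_trans ys s1).
have AR : 5 * (A + d) / (s - nsq x) <= rate x * d by exact: rate_ge.
have G1 : (s - nsq x) ^+ 2 * (partial1 (partial1 u) x ^+ 2 +
    partial2 (partial1 u) x ^+ 2) <= 21 * (A + d) ^+ 2.
  apply: gradient_estimate => //.
  - exact: Cinf_partial1.
  - by move=> y /gs[].
  - by rewrite laplacian_partial1 // => y /sle/J[_ []].
  - by rewrite laplacian_partial1 // => y /sle/J[_ _ []].
  - by rewrite laplacian_partial1 // => y /sle/J[_ _ []].
  - exact: ltW.
have G2 : (s - nsq x) ^+ 2 * (partial1 (partial2 u) x ^+ 2 +
    partial2 (partial2 u) x ^+ 2) <= 21 * (A + d) ^+ 2.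
  apply: gradient_estimate => //.
  - exact: Cinf_partial2.
  - by move=> y /gs[].
  - by rewrite laplacian_partial2 // => y /sle/J[_ []].
  - by rewrite laplacian_partial2 // => y /sle/J[_ _ _ []].
  - by rewrite laplacian_partial2 // => y /sle/J[_ _ _ []].
  - exact: ltW.
have [q1 q2] := sum_sqr_bound s_x (addr_ge0 A0 d0) G1.
have [q3 q4] := sum_sqr_bound s_x (addr_ge0 A0 d0) G2.
have Jd y : nsq y <= 1 -> `|laplacian u y| <= d by move=> /J[].
split.
- apply: g; apply: (le_trans (solution_sup_bound d0 Cu Jd bd (ltW x1))).
  rewrite -mulrA; apply: (le_trans d1); apply: ler_peMl; last by rewrite ler1n.
  by rewrite divr_ge0 // ltW.
- by split; exact: g.
- by split; [exact: le_trans q1 AR|exact: le_trans q2 AR].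
- by split; [exact: le_trans q3 AR|exact: le_trans q4 AR].
Qed.

End dirichlet_problem.

(** * Existence for smooth right-hand sides on the disk *)

Section dirichlet_existence.
Variable R : realType.
Local Notation plane := (R * R)%type.
Implicit Types (f g u v : plane -> R) (x : plane).

Definition dir (b : bool) : plane := if b then (1, 0) else (0, 1).

(** Indexing the derivatives by lists lets all limit functions be chosen at once. The head of the
    list is the derivative taken last. *)
Definition Dl (l : seq bool) f : plane -> R :=
  foldr (fun b h => if b then partial1 h else partial2 h) f l.

Lemma Cinf_Dl l f : Cinf f -> Cinf (Dl l f).
Proof.
by move=> Cf; elim: l => //= -[] l IH; [exact: Cinf_partial1|exact: Cinf_partial2].
Qed.

Lemma DlB l f g : Cinf f -> Cinf g ->
  Dl l (fun y => f y - g y) = fun y => Dl l f y - Dl l g y.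
Proof.
move=> Cf Cg; elim: l => //= b l ->; have C1 := Cinf_Dl l Cf; have C2 := Cinf_Dl l Cg.
by case: b; [exact: partial1B|exact: partial2B].
Qed.

Lemma Dl_is_derive b l f x : Cinf f -> is_derive x (dir b) (Dl l f) (Dl (b :: l) f x).
Proof.
move=> Cf; have C := Cinf_Dl l Cf.
by case: b; [exact: Cinf_isd1|exact: Cinf_isd2].
Qed.

Lemma jet_boundP f (d : R) : (forall l, (size l <= 2)%N -> forall x, nsq x <= 1 ->
  `|Dl l f x| <= d) <-> jet_bound f d.
Proof.
split=> [H x x1|J l sl x /J[]].
  split; [exact: (H [::])|..]; split.
  - exact: (H [:: true]).
  - exact: (H [:: false]).
  - exact: (H [:: true; true]).
  - exact: (H [:: false; true]).
  - exact: (H [:: true; false]).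
  - exact: (H [:: false; false]).
by case: l sl => [|[] [|[] [|]]] //= _ ? [? ?] [? ?] [? ?].
Qed.

Lemma solution_bounds_Dl u (d : R) : 0 <= d -> Cinf u ->
  jet_bound (laplacian u) d -> (forall x, nsq x = 1 -> u x = 0) ->
  forall l, (size l <= 2)%N -> forall x, nsq x < 1 -> `|Dl l u x| <= rate x * d.
Proof.
move=> d0 Cu J bd l sl x x1; have [] := solution_bounds d0 Cu J bd x1.
by case: l sl => [|[] [|[] [|]]] //= _ ? [? ?] [? ?] [? ?].
Qed.

Lemma jet_boundB f g (a b : R) : Cinf f -> Cinf g ->
  jet_bound f a -> jet_bound g b -> jet_bound (fun y => f y - g y) (a + b).
Proof.
move=> Cf Cg /jet_boundP Ja /jet_boundP Jb; apply/jet_boundP => l sl x x1.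
rewrite DlB //; apply: le_trans (ler_normB _ _) _.
by apply: lerD; [exact: Ja|exact: Jb].
Qed.

Lemma disk_sq x : nsq x <= 1 -> @sq R x.
Proof.
rewrite /nsq /sq /= => H; have := sqr_ge0 x.1; have := sqr_ge0 x.2 => h1 h2.
have sqr_le1 (z : R) : z ^+ 2 <= 1 -> `|z| <= 1.
  by rewrite -(real_normK (num_real z)) expr_le1.
by split; apply: sqr_le1; lra.
Qed.

Lemma jet_approx g (e : R) : Cinf g -> 0 < e ->
  exists2 P, pol P & jet_bound (fun y => g y - P y) e.
Proof.
move=> Cg e0; have [P pP HP] := approximable22 Cg e0.
have CP := pol_Cinf pP; have Cd : Cinf (fun y => g y - P y) by exact: CinfB.
exists P => // x x1; have xs := disk_sq x1.
have h a b : (a <= 2)%N -> (b <= 2)%N -> `|pd a b (fun y => g y - P y) x| <= e.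
  by move=> a2 b2; exact: HP.
split.
- exact: (h 0%N 0%N).
- by split; [exact: (h 1%N 0%N)|exact: (h 0%N 1%N)].
- by split; [exact: (h 2%N 0%N)|rewrite -(Cinf_schwarz Cd); exact: (h 1%N 1%N)].
- by split; [exact: (h 1%N 1%N)|exact: (h 0%N 2%N)].
Qed.

Lemma rate_ge1 x : nsq x < 1 -> 1 <= rate x.
Proof.
move=> x1; have n0 := nsq_ge0 x; have k0 : 0 < 1 - nsq x by rewrite subr_gt0.
rewrite /rate ler_pdivlMr ?exprn_gt0 // mul1r.
have : (1 - nsq x) ^+ 2 <= 1 by rewrite expr_le1 ?(ltW k0) // gerBl.
by move=> /le_trans; apply; rewrite ler1n.
Qed.

Lemma rate_le x s : s < 1 -> nsq x < s -> rate x <= 210 / (1 - s) ^+ 2.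
Proof.
move=> s1 xs; have k0 : 0 < 1 - s by rewrite subr_gt0.
have k1 : 1 - s <= 1 - nsq x by rewrite lerB // ltW.
have k2 : 0 < 1 - nsq x by exact: lt_le_trans k0 k1.
rewrite /rate ler_pM2l // lef_pV2 ?posrE ?exprn_gt0 //.
by rewrite ler_sqr ?nnegrE // ltW.
Qed.

Lemma sum_close (a b c d k m z : R) : `|a - c| <= k -> `|b - d| <= k ->
  `|z - (a + b)| <= m -> `|c + d - z| <= k + k + m.
Proof.
by rewrite !ler_norml => /andP[? ?] /andP[? ?] /andP[? ?]; apply/andP; split; lra.
Qed.

(** Two kinds of convergence are used: the sup bound makes the solutions converge uniformly up to
    the boundary, which gives continuity and the boundary value, while the interior bounds make
    derivatives up to order two converge locally uniformly, which gives the equation. *)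
Lemma dirichlet_existence g : Cinf g ->
  exists psi, dirichlet_solution (unit_disk R) g psi.
Proof.
move=> Cg.
have [P HP] : {P : nat -> plane -> R & forall n, pol (P n) /\
    jet_bound (fun y => g y - P n y) n.+1%:R^-1}.
  apply: (@choice nat (plane -> R) (fun n p => pol p /\ jet_bound (fun y => g y - p y) n.+1%:R^-1)) => n.
  have e0 : 0 < n.+1%:R^-1 :> R by rewrite invr_gt0 ltr0n.
  by have [p pp J] := jet_approx Cg e0; exists p.
have [u Hu] : {u : nat -> plane -> R & forall n, [/\ Cinf (u n),
    forall x, laplacian (u n) x = P n x & forall x, nsq x = 1 -> u n x = 0]}.
  apply: (@choice nat (plane -> R) (fun n v => [/\ Cinf v, forall x, laplacian v x = P n x &
    forall x, nsq x = 1 -> v x = 0])) => n.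
  by have [v [Cv Lv bv]] := pol_solvable (HP n).1; exists v.
have Cu n : Cinf (u n) by have [] := Hu n.
have Lu n : laplacian (u n) = P n by have [_ L _] := Hu n; apply/funext.
have bu n x : nsq x = 1 -> u n x = 0 by have [_ _] := Hu n; exact.
have CP n : Cinf (P n) by apply: pol_Cinf; have [] := HP n.
have e0 n : 0 <= n.+1%:R^-1 :> R by rewrite invr_ge0.
have Jd n m : (n <= m)%N -> jet_bound (laplacian (fun y => u n y - u m y)) (2 / n.+1%:R).
  move=> nm.
  have -> : laplacian (fun y => u n y - u m y) =
      fun y => (g y - P m y) - (g y - P n y).
    apply/funext => x; rewrite (_ : (fun y => u n y - u m y) = fun y => u n y + -1 * u m y).
      rewrite laplacianD //; last exact: CinfZ.
      by rewrite laplacianZ // !Lu; ring.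
    by apply/funext => y; rewrite mulN1r.
  have := jet_boundB (CinfB Cg (CP m)) (CinfB Cg (CP n)) (HP m).2 (HP n).2.
  move=> /jet_boundP H; apply/jet_boundP => l sl x x1.
  apply: (le_trans (H l sl x x1)).
  have : m.+1%:R^-1 <= n.+1%:R^-1 :> R by rewrite lef_pV2 ?posrE ?ltr0n // ler_nat.
  by move: (m.+1%:R^-1) (n.+1%:R^-1) => p q; lra.
have Cd n m : Cinf (fun y => u n y - u m y) by exact: CinfB.
have bd n m x : nsq x = 1 -> u n x - u m x = 0 by move=> x1; rewrite !bu // subrr.
have d0 n : 0 <= 2 / n.+1%:R :> R by rewrite divr_ge0.
have Cauchy0 x : nsq x <= 1 -> forall n m, (n <= m)%N ->
    `|u n x - u m x| <= 2 / n.+1%:R.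
  move=> x1 n m nm; apply: (solution_sup_bound (d0 n) (Cd n m)) => // [y y1|]; last exact: bd.
  by have [] := Jd _ _ nm y y1.
have Cauchyl l : (size l <= 2)%N -> forall x, nsq x < 1 -> forall n m, (n <= m)%N ->
    `|Dl l (u n) x - Dl l (u m) x| <= rate x * 2 / n.+1%:R.
  move=> sl x x1 n m nm.
  have := solution_bounds_Dl (d0 n) (Cd n m) (Jd _ _ nm) (@bd n m) sl x1.
  by rewrite DlB // mulrA.
(* Both rates are required of a single choice, so that the limit of the values on the closed disk is
   the function whose derivatives are obtained inside. *)
pose spec (p : seq bool * plane) (v : R) :=
  ((size p.1 <= 2)%N -> nsq p.2 < 1 ->
    forall n, `|Dl p.1 (u n) p.2 - v| <= rate p.2 * 2 / n.+1%:R) /\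
  (p.1 = [::] -> nsq p.2 <= 1 -> forall n, `|u n p.2 - v| <= 2 / n.+1%:R).
have [V0 HV] : {V : seq bool * plane -> R & forall p, spec p (V p)}.
  apply: (@choice _ _ spec) => -[l x].
  have [ln|l0] := eqVneq l [::].
    subst l; have [x1|x1] := leP (nsq x) 1; last first.
      exists 0; split=> /= [_ h|_ h].
        by have := lt_trans x1 h; rewrite ltxx.
      by have := lt_le_trans x1 h; rewrite ltxx.
    have [v Hv] := cauchy_limit (Cauchy0 x x1).
    exists v; split=> //= _ x1' n; apply: (le_trans (Hv n)).
    by rewrite -mulrA ler_peMl // rate_ge1.
  have [x1|x1] := ltP (nsq x) 1; last first.
    exists 0; split=> /= [_ h|h]; last by rewrite h in l0.
    by have := lt_le_trans h x1; rewrite ltxx.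
  have [sl|sl] := leqP (size l) 2; last first.
    by exists 0; split=> /= [h|h]; [rewrite leqNgt sl in h|rewrite h in l0].
  have [v Hv] := cauchy_limit (Cauchyl l sl x x1).
  by exists v; split=> //= h; rewrite h in l0.
pose V l x := V0 (l, x).
have HV1 l x : (size l <= 2)%N -> nsq x < 1 ->
    forall n, `|Dl l (u n) x - V l x| <= rate x * 2 / n.+1%:R.
  by have [+ _] := HV (l, x).
have HV2 x : nsq x <= 1 -> forall n, `|u n x - V [::] x| <= 2 / n.+1%:R.
  by have [_ +] := HV ([::], x); apply.
clearbody V; clear HV V0 spec.
have loc x : nsq x < 1 -> exists2 s, nsq x < s & exists K, forall l y,
    (size l <= 2)%N -> nsq y < s ->
    forall n, `|Dl l (u n) y - V l y| <= K / n.+1%:R.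
  move=> x1; pose s := (1 + nsq x) / 2.
  have xs : nsq x < s by rewrite /s; lra.
  have s1 : s < 1 by rewrite /s; lra.
  exists s => //; exists (210 / (1 - s) ^+ 2 * 2) => l y sl ys n.
  apply: (le_trans (HV1 l y sl (lt_trans ys s1) n)).
  rewrite ler_pM2r ?invr_gt0 ?ltr0n // ler_pM2r //.
  exact: rate_le.
have contV l : (size l <= 2)%N -> forall x, nsq x < 1 -> {for x, continuous (V l)}.
  move=> sl x x1; have [s xs [K HK]] := loc x x1.
  apply: (@continuous_limit R plane (nbhs x) (fun n => Dl l (u n)) (V l)
    (fun n => Dl l (u n) x) (V l x) K).
  - by move=> n; exact: (@Cinf_continuous R _ (Cinf_Dl l (Cu n)) x).
  - by move=> n; exact: HK.
  - by apply: filterS (open_nbhs_nbhs (conj (@open_disk R s) xs)) => y ys n; exact: HK.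
have derV b l : (size l <= 1)%N -> forall x, nsq x < 1 ->
    is_derive x (dir b) (V l) (V (b :: l) x).
  move=> sl [a c] x1; have [s xs [K HK]] := loc (a, c) x1.
  have [r r0 Hr] := ball_line xs.
  have sl2 : (size l <= 2)%N by apply: leq_trans sl _.
  have cV := contV (b :: l) sl (a, c) x1.
  case: b cV => cV.
    apply/is_derive_e1.
    apply: (@is_derive_limit R (fun n t => Dl l (u n) (t, c))
      (fun n t => Dl (true :: l) (u n) (t, c)) (fun t => V l (t, c))
      (fun t => V (true :: l) (t, c)) a r K) => //.
    - by move=> n t tr; have := Dl_is_derive true l (t, c) (Cu n) => /is_derive_e1.
    - by move=> n t /(Hr t).1 ts; exact: HK.
    - by move=> n t /(Hr t).1 ts; exact: HK.
    - exact: (@continuous_comp2 R R (V (true :: l)) id (fun _ => c) a cvg_id (cvg_cst _) cV).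
  apply/is_derive_e2.
  apply: (@is_derive_limit R (fun n t => Dl l (u n) (a, t))
    (fun n t => Dl (false :: l) (u n) (a, t)) (fun t => V l (a, t))
    (fun t => V (false :: l) (a, t)) c r K) => //.
  - by move=> n t tr; have := Dl_is_derive false l (a, t) (Cu n) => /is_derive_e2.
  - by move=> n t /(Hr t).2 ts; exact: HK.
  - by move=> n t /(Hr t).2 ts; exact: HK.
  - exact: (@continuous_comp2 R R (V (false :: l)) (fun _ => a) id c (cvg_cst _) cvg_id cV).
have lapV x : nsq x < 1 -> V [:: true; true] x + V [:: false; false] x = g x.
  move=> x1; have J n : `|g x - P n x| <= 1 / n.+1%:R.
    by have [_ /(_ x (ltW x1))[+ _ _ _]] := HP n; rewrite mul1r.
  pose K := rate x * 2; apply/eqP; rewrite -subr_eq0 -normr_le0.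
  apply: (@archimedean_le _ _ _ (K + K + 1)) => n; rewrite add0r.
  have h1 := HV1 [:: true; true] x isT x1 n; have h2 := HV1 [:: false; false] x isT x1 n.
  have h3 := J n; have E : P n x = Dl [:: true; true] (u n) x + Dl [:: false; false] (u n) x.
    by rewrite -Lu.
  rewrite E in h3; rewrite !mulrDl; exact: sum_close h1 h2 h3.
have [C2 LV] : Ck 2 (unit_disk R) (V [::]) /\
    forall x, unit_disk R x -> laplacian (V [::]) x = V [:: true; true] x + V [:: false; false] x.
  apply: (@C2_intro R _ _ (V [:: true]) (V [:: false]) _ (V [:: false; true])
    (V [:: true; false])); first exact: open_disk.
  - by move=> x x1; split; [exact: (derV true)|exact: (derV false)|exact: contV].
  - by move=> x x1; split; [exact: (derV true)|exact: (derV false)|exact: contV].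
  - by move=> x x1; split; [exact: (derV true)|exact: (derV false)|exact: contV].
  - by move=> x x1; split; exact: contV.
  - by move=> x x1; split; exact: contV.
exists (V [::]); split.
- exact: C2.
- rewrite closure_unit_diskE; apply/subspace_continuousP => x x1.
  apply: (@continuous_limit R plane (within (@cdisk R 1) (nbhs x)) u (V [::])
    (fun n => u n x) (V [::] x) 2).
  - move=> n; apply: cvg_trans (@Cinf_continuous R _ (Cu n) x).
    by apply: cvg_app; exact: cvg_within.
  - by move=> n; exact: HV2.
  - by apply: (@filterE plane (nbhs x) _ (fun y => cdisk 1 y -> _)) => y y1 n; exact: HV2.
- by move=> x x1; rewrite LV // lapV.
- move=> x /boundary_unit_diskE x1.
  apply/eqP; rewrite -normr_le0; apply: (@archimedean_le _ _ _ 2) => n.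
  have /HV2 /(_ n) : nsq x <= 1 by rewrite x1.
  by rewrite bu // sub0r normrN add0r.
Qed.

End dirichlet_existence.

(** * Integration in the plane *)

Section area_measure.
Variable R : realType.
Local Notation plane := (R * R)%type.

Local Notation T1 := (measurableTypeR R).
Local Notation T2 := (T1 * T1)%type.

Definition plane_measure : set T2 -> \bar R :=
  product_measure1 (@lebesgue_measure R) (@lebesgue_measure R).

HB.instance Definition _ := Measure.on plane_measure.

Definition box (a b c d : R) : set plane := `[a, b]%classic `*` `[c, d]%classic.

Lemma box_measurable a b c d : measurable (box a b c d : set T2).
Proof. by apply: measurableX; exact: measurable_itv. Qed.

Lemma area_box a b c d : a <= b -> c <= d ->
  plane_measure (box a b c d) = ((b - a) * (d - c))%:E.
Proof.
move=> ab cd.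
have itvE (u v : R) : u <= v -> lebesgue_measure (`[u, v] : set T1) = (v - u)%:E.
  rewrite le_eqVlt lebesgue_measure_itv /= lte_fin => /predU1P[->|->//].
  by rewrite ltxx subrr.
transitivity (lebesgue_measure (`[a, b] : set T1) * lebesgue_measure (`[c, d] : set T1))%E.
  by apply: product_measure1E; exact: measurable_itv.
by rewrite (itvE _ _ ab) (itvE _ _ cd) EFinM.
Qed.

(** The product structure is generated by rectangles; an open set is a countable union of rational
    squares contained in it, squares not contained in it being replaced by [set0]. *)
Lemma open_measurable_plane (U : set plane) : open U -> measurable (U : set T2).
Proof.
move=> oU.
pose B (a b c : rat) : set plane :=
  `]ratr a - ratr c, ratr a + ratr c[%classic `*` `]ratr b - ratr c, ratr b + ratr c[%classic.
pose F (a b c : rat) : set plane := if `[< B a b c `<=` U >] then B a b c else set0.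
have -> : U = \bigcup_a \bigcup_b \bigcup_c F a b c.
  apply/seteqP; split=> [x Ux|x [a _ [b _ [c _]]]]; last first.
    by rewrite /F; case: asboolP => // BU /BU.
  have := open_nbhs_nbhs (conj oU Ux) => /nbhs_ballP[e /= e0 He].
  have [c] : exists c : rat, ratr c \in `]0, e / 2[.
    by apply: rat_in_itvoo; rewrite divr_gt0.
  rewrite in_itv /= => /andP[c0 ce].
  have close (z : R) : exists a : rat, `|z - ratr a| < ratr c.
    have [a] : exists a : rat, ratr a \in `](z - ratr c), (z + ratr c)[.
      by apply: rat_in_itvoo; lra.
    by rewrite in_itv /= => /andP[? ?]; exists a; rewrite ltr_norml; apply/andP; split; lra.
  have [a Ha] := close x.1; have [b Hb] := close x.2.
  have BU : B a b c `<=` U.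
    move=> y [/=]; rewrite !in_itv /= => /andP[? ?] /andP[? ?].
    apply: He; apply/in_ball_plane; move: Ha Hb; rewrite !ltr_norml => /andP[? ?] /andP[? ?].
    by split; apply/andP; split; lra.
  exists a => //; exists b => //; exists c => //; rewrite /F asboolT //.
  split; rewrite /= in_itv /=; [move: Ha|move: Hb]; rewrite ltr_norml => /andP[? ?];
    by apply/andP; split; lra.
apply: bigcupT_measurable_rat => a; apply: bigcupT_measurable_rat => b.
apply: bigcupT_measurable_rat => c; rewrite /F; case: ifP => // _.
by apply: measurableX; exact: measurable_itv.
Qed.

Lemma closed_measurable_plane (U : set plane) : closed U -> measurable (U : set T2).
Proof.
by move=> cU; rewrite -(setCK U); apply: measurableC; apply: open_measurable_plane; exact: closed_openC.
Qed.

Lemma open_continuous_measurable (U : set plane) (f : plane -> R) : open U ->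
  (forall x, U x -> {for x, continuous f}) -> measurable_fun (U : set T2) (f : T2 -> R).
Proof.
move=> oU cf; apply: (measurability _ (RGenOInfty.measurableE R)).
move=> _ [_ [a ->] <-]; apply: open_measurable_plane.
rewrite openE => x [Ux]; rewrite /= in_itv /= andbT => ax.
have := cf _ Ux => /cvgrPdist_lt /(_ (f x - a)).
rewrite subr_gt0 => /(_ ax) H.
rewrite /interior; apply: filterI; first exact: (open_nbhs_nbhs (conj oU Ux)).
apply: filterS H => y /=; rewrite in_itv /= andbT ltr_norml => /andP[_ ?]; lra.
Qed.

Lemma continuous_measurable_plane (f : plane -> R) : continuous f ->
  measurable_fun setT (f : T2 -> R).
Proof.
by move=> cf; apply: open_continuous_measurable => [|x _]; [exact: openT|exact: cf].
Qed.

Lemma areaE : @area R = plane_measure. Proof. by []. Qed.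

(* [area] lives on [R] with its default measurable structure, which has the
   same measurable sets as [measurableTypeR R] but is a different structure. *)
Lemma area_integral (D : set plane) (f : plane -> \bar R) :
  measurable (D : set T2) -> measurable_fun (D : set T2) (f : T2 -> \bar R) ->
  (forall x, D x -> 0%E <= f x)%E ->
  (\int[@area R]_(x in D) f x = \int[plane_measure]_(x in (D : set T2)) (f : T2 -> \bar R) x)%E.
Proof.
move=> mD mf f0.
have mid : measurable_fun [set: T2] (fun x : T2 => (x : plane)).
  by move=> _ Y mY; rewrite setTI.
have H := @ge0_integral_pushforward _ _ T2 plane R (fun x : T2 => (x : plane)) mid
  plane_measure D f mD _ _.
rewrite -[RHS]H //; first by move=> x; rewrite inE; exact: f0.
Qed.

End area_measure.

(** * Integrals of bounded functions supported in the square, and integration of derivatives *)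

Section plane_integral.
Variable R : realType.
Local Notation plane := (R * R)%type.
Local Notation T1 := (measurableTypeR R).
Local Notation T2 := (T1 * T1)%type.
Local Notation mu := (@plane_measure R).
Implicit Types (f g : plane -> R).

(** A class closed under the operations needed below and contained in the integrable functions, so
    that integrals over the plane can be handled as real numbers. *)
Definition bms f := [/\ measurable_fun setT (f : T2 -> R),
  exists M, forall x, `|f x| <= M & forall x, ~ @sq R x -> f x = 0].

Definition I f : R := Rintegral mu setT f.

Lemma sqE : @sq R = box (-1) 1 (-1) 1.
Proof.
apply/seteqP; split=> x; rewrite /sq /box /= !in_itv /= !ler_norml.
  by move=> [].
by move=> [].
Qed.

Lemma box_lty (a b c d : R) : (mu (box a b c d) < +oo)%E.
Proof.
apply: (@le_lt_trans _ _ (mu (box (Num.min a b) (Num.max a b) (Num.min c d) (Num.max c d)))).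
  apply: le_measure; rewrite ?inE; try exact: box_measurable.
  move=> x [/=]; rewrite !in_itv /= => /andP[h1 h2] /andP[h3 h4].
  by split; rewrite /= in_itv /= ge_min le_max ?h1 ?h2 ?h3 ?h4 ?orbT.
have lem (u v : R) : Num.min u v <= Num.max u v by rewrite ge_min !le_max lexx.
by rewrite area_box ?ltry.
Qed.

Lemma bms_integrable f : bms f -> mu.-integrable setT (EFin \o (f : T2 -> R)).
Proof.
move=> [mf [M fM] f0].
have -> : (EFin \o f) = ((EFin \o f) \_ (box (-1) 1 (-1) 1)).
  apply/funext => x; rewrite /patch; case: ifPn => //.
  by rewrite -sqE notin_setE => /f0 /= ->.
have mB := @box_measurable R (-1) 1 (-1) 1.
apply: (integrable_mkcond _ mB).1.
apply: measurable_bounded_integrable => //; first exact: box_lty.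
  exact: measurable_funS mf.
exists M; split; first exact: num_real.
by move=> N MN x _; exact: le_trans (fM x) (ltW MN).
Qed.

Lemma bmsD f g : bms f -> bms g -> bms (fun x => f x + g x).
Proof.
move=> [mf [M fM] f0] [mg [N gN] g0]; split.
- exact: measurable_funD.
- by exists (M + N) => x; apply: le_trans (ler_normD _ _) _; exact: lerD.
- by move=> x nx; rewrite f0 // g0 // addr0.
Qed.

Lemma bmsM f g : bms f -> measurable_fun setT (g : T2 -> R) ->
  (exists M, forall x, `|g x| <= M) -> bms (fun x => f x * g x).
Proof.
move=> [mf [M fM] f0] mg [N gN]; split.
- exact: measurable_funM.
- by exists (M * N) => x; rewrite normrM; exact: ler_pM.
- by move=> x nx; rewrite f0 // mul0r.
Qed.

Lemma bmsZ c f : bms f -> bms (fun x => c * f x).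
Proof.
move=> bf; have := @bmsM f (fun _ => c) bf; rewrite (_ : (fun x => f x * c) = fun x => c * f x).
  by apply; [exact: measurable_cst|exists `|c|].
by apply/funext => x; rewrite mulrC.
Qed.

Lemma ID f g : bms f -> bms g -> I (fun x => f x + g x) = I f + I g.
Proof. by move=> bf bg; apply: RintegralD => //; exact: bms_integrable. Qed.

Lemma IZ c f : bms f -> I (fun x => c * f x) = c * I f.
Proof. by move=> bf; apply: RintegralZl => //; exact: bms_integrable. Qed.

Lemma IB f g : bms f -> bms g -> I (fun x => f x - g x) = I f - I g.
Proof. by move=> bf bg; apply: RintegralB => //; exact: bms_integrable. Qed.

Lemma I_le f g : bms f -> bms g -> (forall x, f x <= g x) -> I f <= I g.
Proof.
by move=> bf bg fg; apply: le_Rintegral => //; exact: bms_integrable.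
Qed.

Lemma bms_norm f : bms f -> bms (fun x => `|f x|).
Proof.
move=> [mf [M fM] f0]; split.
- exact: (measurableT_comp (@normr_measurable R setT) mf).
- by exists M => x; rewrite normr_id.
- by move=> x nx; rewrite f0 // normr0.
Qed.

Lemma I_box (a b c d k : R) : a <= b -> c <= d ->
  Rintegral mu (box a b c d) (fun _ => k) = k * ((b - a) * (d - c)).
Proof.
move=> ab cd; rewrite Rintegral_cst; last exact: box_measurable.
by congr (_ * _); exact: (congr1 fine (area_box ab cd)).
Qed.

Lemma box_cst_integrable (a b c d k : R) :
  mu.-integrable (box a b c d) (EFin \o (fun _ : T2 => k)).
Proof.
apply: measurable_bounded_integrable; first exact: box_measurable.
- exact: box_lty.
- exact: measurable_cst.
- by exists `|k|; split; [exact: num_real|move=> N kN x _; exact: ltW].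
Qed.

Lemma I_box_lower f (a b c d k : R) : a <= b -> c <= d -> bms f ->
  (forall x, 0 <= f x) -> (forall x, box a b c d x -> k <= f x) ->
  k * ((b - a) * (d - c)) <= I f.
Proof.
move=> ab cd bf f0 fk; rewrite -I_box //.
have mB := @box_measurable R a b c d.
have iB : mu.-integrable (box a b c d) (EFin \o (f : T2 -> R)).
  by apply: (integrableS measurableT mB) => //; exact: bms_integrable.
apply: (@le_trans _ _ (Rintegral mu (box a b c d) f)).
  by apply: le_Rintegral => //; exact: box_cst_integrable.
rewrite Rintegral_mkcond; apply: le_Rintegral => //.
- by rewrite -restrict_EFin; apply: (integrable_mkcond _ mB).1.
- exact: bms_integrable.
- by move=> x _; rewrite /patch; case: ifP.
Qed.

Lemma I_box_upper f (a b c d k : R) : a <= b -> c <= d -> bms f ->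
  (forall x, ~ box a b c d x -> f x = 0) ->
  (forall x, box a b c d x -> `|f x| <= k) ->
  `|I f| <= k * ((b - a) * (d - c)).
Proof.
move=> ab cd bf f0 fk; rewrite -I_box //.
have mB := @box_measurable R a b c d.
have iN : mu.-integrable setT (EFin \o (fun x : T2 => `|f x|)).
  by apply: bms_integrable; exact: bms_norm.
apply: (@le_trans _ _ (Rintegral mu setT (fun x => `|f x|))).
  by apply: le_normr_Rintegral => //; exact: bms_integrable.
have -> : (fun x => `|f x|) = (fun x => `|f x|) \_ (box a b c d).
  apply/funext => x; rewrite /patch; case: ifPn => //.
  by rewrite notin_setE => /f0 ->; rewrite normr0.
rewrite -Rintegral_mkcond; apply: le_Rintegral => //.
- exact: (integrableS measurableT mB).
- exact: box_cst_integrable.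
Qed.

Definition supp_disk f := exists2 s : R, s < 1 & forall x, s < nsq x -> f x = 0.

Lemma not_sq (x : plane) : ~ @sq R x -> 1 < nsq x.
Proof.
by move=> nx; rewrite ltNge; apply/negP => /disk_sq.
Qed.

Lemma continuous_bms f : continuous f -> supp_disk f -> bms f.
Proof.
move=> cf [s s1 f0]; split.
- exact: continuous_measurable_plane.
- have [M M0 HM] := within_compact_bounded (@cdisk_compact R 1 ler01) (continuous_subspaceT cf).
  exists M => x; have [x1|x1] := leP (nsq x) 1; first exact: HM.
  by rewrite f0 ?normr0 //; exact: lt_trans x1.
- by move=> x /not_sq x1; rewrite f0 //; exact: lt_trans x1.
Qed.

(** Integration runs over [[-2, 2]] because vanishing is assumed only strictly outside [[-1, 1]],
    and [F] must vanish at both endpoints. *)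
Lemma line_integral_zero (F G : R -> R) : (forall t : R, is_derive t 1 F (G t)) ->
  continuous G -> (forall t : R, 1 < `|t| -> F t = 0) ->
  (forall t : R, 1 < `|t| -> G t = 0) ->
  (\int[@lebesgue_measure R]_x (G x)%:E = 0)%E.
Proof.
move=> dF cG F0 G0.
have cF : continuous F.
  by move=> t; have /is_deriveP[/derivable1_diffP /differentiable_continuous] := dF t.
have -> : (fun x : T1 => (G x)%:E) = ((fun x : T1 => (G x)%:E) \_ `[-2, 2]%classic).
  apply/funext => x; rewrite /patch; case: ifPn => //.
  rewrite notin_setE /= in_itv /= => nx; rewrite G0 //.
  rewrite ltNge; apply/negP => x1; apply: nx; move: x1; rewrite ler_norml => /andP[? ?].
  by apply/andP; split; lra.
rewrite -integral_mkcond.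
rewrite (@continuous_FTC2 R G F (-2) 2).
- by rewrite !F0 ?subee // ?normrN ger0_norm // ltr1n.
- by lra.
- exact: continuous_subspaceT.
- split.
  + by move=> x _; have /is_deriveP[] := dF x.
  + exact: (cvg_at_right_filter (cF (-2))).
  + exact: (cvg_at_left_filter (cF 2)).
- by move=> x _; rewrite derive1E; have /is_deriveP[_ ->] := dF x.
Qed.

(** By Fubini it suffices to integrate along horizontal lines, where the derivative of a compactly
    supported function has integral zero. *)
Lemma I_partial1 (F G : plane -> R) : (forall x : plane, is_derive x (1, 0) F (G x)) ->
  continuous G -> supp_disk F -> supp_disk G -> I G = 0.
Proof.
move=> dF cG [s s1 F0] sG; have [r r1 G0] := sG.
have bG := continuous_bms cG sG; have iG := bms_integrable bG.
have big (z y : R) : 1 < `|z| -> 1 < nsq (z, y).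
  move=> z1; rewrite /nsq /=; have := sqr_ge0 y; rewrite -(real_normK (num_real z)).
  by move: (`|z|) z1 => w w1; nra.
have inner (y : R) : (\int[@lebesgue_measure R]_x (EFin \o G) (x, y) = 0)%E.
  apply: (@line_integral_zero (fun t => F (t, y)) (fun t => G (t, y))).
  - by move=> t; have /is_derive_e1 := dF (t, y).
  - move=> t; exact: (@continuous_comp2 R R G id (fun _ => y) t cvg_id (cvg_cst _) (cG (t, y))).
  - by move=> t t1; rewrite F0 //; apply: lt_trans (big _ y t1).
  - by move=> t t1; rewrite G0 //; apply: lt_trans (big _ y t1).
rewrite /I /Rintegral -[X in fine X](integral21_prod_meas1 iG).
by rewrite (eq_integral (cst 0%E)) ?integral0 // => y _; exact: inner.
Qed.

Lemma I_partial2 (F G : plane -> R) : (forall x : plane, is_derive x (0, 1) F (G x)) ->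
  continuous G -> supp_disk F -> supp_disk G -> I G = 0.
Proof.
move=> dF cG [s s1 F0] sG; have [r r1 G0] := sG.
have bG := continuous_bms cG sG; have iG := bms_integrable bG.
have big (z y : R) : 1 < `|z| -> 1 < nsq (y, z).
  move=> z1; rewrite /nsq /=; have := sqr_ge0 y; rewrite -(real_normK (num_real z)).
  by move: (`|z|) z1 => w w1; nra.
have inner (y : R) : (\int[@lebesgue_measure R]_x (EFin \o G) (y, x) = 0)%E.
  apply: (@line_integral_zero (fun t => F (y, t)) (fun t => G (y, t))).
  - by move=> t; have /is_derive_e2 := dF (y, t).
  - move=> t; exact: (@continuous_comp2 R R G (fun _ => y) id t (cvg_cst _) cvg_id (cG (y, t))).
  - by move=> t t1; rewrite F0 //; apply: lt_trans (big _ y t1).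
  - by move=> t t1; rewrite G0 //; apply: lt_trans (big _ y t1).
rewrite /I /Rintegral -[X in fine X](integral12_prod_meas1 iG).
by rewrite (eq_integral (cst 0%E)) ?integral0 // => y _; exact: inner.
Qed.

End plane_integral.

(** * Comparison of energies *)

Section cutoff.
Variable R : realType.
Implicit Types (s t k : R).

(** Serves at points where two formulas are glued together, for the square of the positive part and
    for the flat exponential. *)
Lemma is_derive_quadratic (f : R -> R) (x d C : R) : 0 <= C ->
  (forall h, `|f (x + h) - f x - h * d| <= C * h ^+ 2) -> is_derive x 1 f d.
Proof.
move=> C0 H.
suff L : (fun h => h^-1 *: ((f \o shift x) (h *: (1 : R)) - f x)) @ 0^' --> d.
  by apply: DeriveDef; [apply/cvg_ex; exists d|apply: cvg_lim].
apply/cvgrPdist_le => e e0; apply/nbhs_ballP.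
have C1 : 0 < C + 1 by rewrite ltr_wpDl.
exists (e / (C + 1)); first by rewrite /= divr_gt0.
move=> h; rewrite /ball /= sub0r normrN => hs h0.
have -> : h *: (1 : R) + x = x + h by rewrite [_ *: _]mulr1 addrC.
have hn0 : h != 0 by [].
have -> : d - h^-1 *: (f (x + h) - f x) = - (h^-1 * (f (x + h) - f x - h * d)).
  by rewrite /GRing.scale /=; field.
rewrite normrN normrM normfV ler_pdivrMl ?normr_gt0 //.
apply: (le_trans (H h)); rewrite -(real_normK (num_real h)) expr2 mulrCA.
apply: ler_wpM2l => //; move: hs; rewrite ltr_pdivlMr // => /ltW; apply: le_trans.
by rewrite mulrC ler_wpM2l // lerDl.
Qed.

Definition pos t : R := (t + `|t|) / 2.

Lemma pos_ge t : 0 <= t -> pos t = t.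
Proof. by move=> t0; rewrite /pos ger0_norm //; field. Qed.

Lemma pos_le t : t <= 0 -> pos t = 0.
Proof. by move=> t0; rewrite /pos ler0_norm // subrr mul0r. Qed.

Lemma pos_continuous : continuous pos.
Proof.
move=> t; apply: cvgM; last exact: cvg_cst.
by apply: cvgD; [exact: cvg_id|exact: norm_continuous].
Qed.

Lemma is_derive_pos_sqr t : is_derive t 1 (fun t => t * pos t) (2 * pos t).
Proof.
apply: (@is_derive_quadratic _ _ _ 1) => // h; rewrite mul1r ler_norml.
have [t0|t0] := leP 0 t; have [th|th] := leP 0 (t + h).
- by rewrite (pos_ge t0) (pos_ge th); apply/andP; split; nra.
- by rewrite (pos_ge t0) (pos_le (ltW th)); apply/andP; split; nra.
- by rewrite (pos_le (ltW t0)) (pos_ge th); apply/andP; split; nra.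
- by rewrite (pos_le (ltW t0)) (pos_le (ltW th)); apply/andP; split; nra.
Qed.

(* Truncation of the identity: composed with a stream function, which vanishes
   only on the boundary, it has compact support in the disk, so that no boundary
   regularity is needed to integrate by parts. *)
Definition chi k s := ((- s - 2 * k) * pos (- s - 2 * k) - (- s - k) * pos (- s - k)) / (2 * k).
(** The piecewise linear ramp equal to 1 up to [- 2 k] and to 0 from [- k] on. *)
Definition dchi k s := (pos (- s - k) - pos (- s - 2 * k)) / k.

Lemma is_derive_chi k s : 0 < k -> is_derive s 1 (chi k) (dchi k s).
Proof.
move=> k0.
have A c : is_derive s 1 (fun s => - s - c) (-1).
  apply: (is_derive_eq (isdD (isdN (is_derive_id s (1 : R))) (isdC s 1 (- c)))).
  by rewrite addr0.
have B c : is_derive s 1 (fun s => (- s - c) * pos (- s - c)) (- (2 * pos (- s - c))).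
  have [D1 E1] := is_deriveP (A c).
  have [D2 E2] := is_deriveP (is_derive_pos_sqr (- s - c)).
  have H := @is_derive_comp1 R R (fun t => t * pos t) (fun s => - s - c) s 1 D2 D1.
  by apply: (is_derive_eq H); rewrite E1 E2; ring.
apply: (is_derive_eq (isdM (isdD (B (2 * k)) (isdN (B k))) (isdC s 1 (2 * k)^-1))).
by rewrite /dchi; field; rewrite gt_eqF.
Qed.

Lemma chi0 k s : 0 < k -> - k <= s -> chi k s = 0 /\ dchi k s = 0.
Proof.
move=> k0 ks; have h1 : - s - k <= 0 by lra. have h2 : - s - 2 * k <= 0 by lra.
by rewrite /chi /dchi (pos_le h1) (pos_le h2) !mulr0 subrr !mul0r.
Qed.

(** The shift [3 / 2 * k] is harmless later, since it is integrated against a vorticity change of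
    mean zero. *)
Lemma chi1 k s : 0 < k -> s <= - (2 * k) -> chi k s = s + 3 / 2 * k /\ dchi k s = 1.
Proof.
move=> k0 ks; have h1 : 0 <= - s - k by lra. have h2 : 0 <= - s - 2 * k by lra.
by rewrite /chi /dchi (pos_ge h1) (pos_ge h2); split; field; rewrite gt_eqF.
Qed.

Lemma dchi01 k s : 0 < k -> 0 <= dchi k s <= 1.
Proof.
move=> k0; have [ks|ks] := leP (- k) s.
  by have [_ ->] := chi0 k0 ks; rewrite lexx ler01.
have [k2s|k2s] := leP s (- (2 * k)).
  by have [_ ->] := chi1 k0 k2s; rewrite lexx ler01.
have h1 : 0 <= - s - k by lra. have h2 : - s - 2 * k <= 0 by lra.
rewrite /dchi (pos_ge h1) (pos_le h2) subr0 divr_ge0 ?(ltW k0) //=.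
by rewrite ler_pdivrMr // mul1r; lra.
Qed.

Lemma chi_bound k s : 0 < k -> - `|s| <= chi k s <= 0.
Proof.
move=> k0; have [ks|ks] := leP (- k) s.
  by have [-> _] := chi0 k0 ks; rewrite lexx oppr_le0 normr_ge0.
have s0 : s < 0 by lra.
rewrite ltr0_norm // opprK.
have [k2s|k2s] := leP s (- (2 * k)).
  by have [-> _] := chi1 k0 k2s; apply/andP; split; lra.
have h1 : 0 <= - s - k by lra. have h2 : - s - 2 * k <= 0 by lra.
rewrite /chi (pos_ge h1) (pos_le h2) mulr0 sub0r ler_pdivlMr ?mulr_gt0 //.
rewrite pmulr_lle0 ?invr_gt0 ?mulr_gt0 // oppr_le0 -expr2 sqr_ge0 andbT.
by rewrite expr2; nra.
Qed.

(** Lets the weighted energies increase as the threshold decreases, as monotone convergence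
    requires. *)
Lemma dchi_mono k l s : 0 < l -> l <= k -> dchi k s <= dchi l s.
Proof.
move=> l0 lk; have k0 : 0 < k by exact: lt_le_trans lk.
have /andP[a0 a1] := dchi01 s l0.
have [ks|ks] := leP (- k) s; first by have [_ ->] := chi0 k0 ks.
have [l2s|l2s] := leP s (- (2 * l)).
  by have [_ ->] := chi1 l0 l2s; have /andP[] := dchi01 s k0.
have h1 : 0 <= - s - k by lra. have h2 : - s - 2 * k <= 0 by lra.
have h3 : 0 <= - s - l by lra. have h4 : - s - 2 * l <= 0 by lra.
rewrite /dchi (pos_ge h1) (pos_le h2) (pos_ge h3) (pos_le h4) !subr0.
by rewrite ler_pdivrMr // mulrAC ler_pdivlMr //; nra.
Qed.

Lemma dchi_continuous k : continuous (dchi k).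
Proof.
have A c : continuous (fun s => pos (- s - c)).
  move=> s; apply: (@cvg_comp _ _ _ (fun s : R => - s - c) pos); last exact: pos_continuous.
  by apply: cvgB; [exact: opp_continuous|exact: cvg_cst].
by move=> s; apply: cvgM; [apply: cvgB; exact: A|exact: cvg_cst].
Qed.

End cutoff.

(** * Extension by zero across the unit circle *)

Section cutoff_integration.
Variable R : realType.
Local Notation plane := (R * R)%type.
Implicit Types (f g h : plane -> R) (x : plane).

Lemma open_outside (s : R) : open [set x : plane | s < nsq x].
Proof.
have := open_comp (fun x _ => @nsq_continuous R x) (@open_gt R s).
by rewrite /preimage /=; exact.
Qed.

Lemma continuous_extend0 f (s : R) : s < 1 ->
  (forall x, nsq x < 1 -> {for x, continuous f}) ->
  (forall x, s < nsq x -> f x = 0) -> continuous f.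
Proof.
move=> s1 cf f0 x; have [x1|x1] := ltP (nsq x) 1; first exact: cf.
apply: (@continuous_near R [set x | s < nsq x] (fun _ => 0)).
- exact: open_outside.
- exact: lt_le_trans x1.
- by move=> y /= /f0 ->.
- exact: cvg_cst.
Qed.

Lemma is_derive_extend0 f g (s : R) (v : plane) : s < 1 ->
  (forall x, nsq x < 1 -> is_derive x v f (g x)) ->
  (forall x, s < nsq x -> f x = 0) ->
  (forall x, s < nsq x -> g x = 0) -> forall x, is_derive x v f (g x).
Proof.
move=> s1 df f0 g0 x; have [x1|x1] := ltP (nsq x) 1; first exact: df.
have sx : s < nsq x := lt_le_trans s1 x1.
rewrite (g0 _ sx).
apply: (@is_derive_near R [set x | s < nsq x] (fun _ => 0)).
- exact: open_outside.
- exact: sx.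
- by move=> y /= /f0 ->.
Qed.

End cutoff_integration.

(** * Dirichlet integrals weighted by a cutoff of the stream function *)

Section energy_comparison.
Variable R : realType.
Local Notation plane := (R * R)%type.
Local Notation T1 := (measurableTypeR R).
Local Notation T2 := (T1 * T1)%type.
Local Notation mu := (@plane_measure R).
Implicit Types (f g w psi nu : plane -> R) (x : plane).

(** A solution together with its partial derivatives as separate functions; negatives and
    differences then come with explicit derivatives, as the comparison arguments need. *)
Definition disk_jet w psi (p1 p2 p11 p22 : plane -> R) :=
  [/\ {within cdisk 1, continuous psi}, forall x, nsq x = 1 -> psi x = 0,
    forall x, nsq x < 1 -> [/\ {for x, continuous psi}, {for x, continuous p1},
      {for x, continuous p2}, {for x, continuous p11} & {for x, continuous p22}],
    forall x, nsq x < 1 -> [/\ is_derive x (1, 0) psi (p1 x),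
      is_derive x (0, 1) psi (p2 x), is_derive x (1, 0) p1 (p11 x) &
      is_derive x (0, 1) p2 (p22 x)] &
    forall x, nsq x < 1 -> p11 x + p22 x = w x].

Lemma dirichlet_disk_jet w psi : dirichlet_solution (unit_disk R) w psi ->
  disk_jet w psi (partial1 psi) (partial2 psi) (partial1 (partial1 psi))
    (partial2 (partial2 psi)).
Proof.
move=> [[c0 [d1 d2 [c1 [d11 _ [c11 _] _]] [c2 [_ d22 _ [c22 _]]]]] cw L bd].
split; last exact: L.
- by rewrite -closure_unit_diskE.
- by move=> x x1; apply: bd; apply/boundary_unit_diskE.
- by move=> x x1; split; [apply: c0|apply: c1|apply: c2|apply: c11|apply: c22].
- move=> x x1; split; apply: DeriveDef => //; [exact: d1|exact: d2|exact: d11|exact: d22].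
Qed.

(** The right-hand side is the exact solution for the constant vorticity [m]. For [m > 0] it keeps
    [nu] away from zero on smaller disks, so the cutoff disappears there. *)
Lemma solution_upper w nu n1 n2 n11 n22 m : disk_jet w nu n1 n2 n11 n22 ->
  (forall x, nsq x < 1 -> m <= w x) ->
  forall x, nsq x <= 1 -> nu x <= - (m / 4 * (1 - nsq x)).
Proof.
move=> [cw bd _ D L] mw x x1.
have dn1 (y : plane) : is_derive y (1, 0) (@nsq R) (2 * y.1).
  by rewrite /nsq; isd; rewrite /=; ring.
have dn2 (y : plane) : is_derive y (0, 1) (@nsq R) (2 * y.2).
  by rewrite /nsq; isd; rewrite /=; ring.
suff : nu x + (- (m / 4)) * nsq x <= - (m / 4) by lra.
apply: (@max_principle R 1 (- (m / 4)) (fun x => nu x + (- (m / 4)) * nsq x)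
  (fun x => n1 x + (- (m / 4)) * (2 * x.1)) (fun x => n2 x + (- (m / 4)) * (2 * x.2))
  (fun x => n11 x - m / 2) (fun x => n22 x - m / 2)) => //.
- move=> y; apply: cvgD; first exact: cw.
  apply: cvgM; first exact: cvg_cst.
  by have := continuous_subspaceT (A := cdisk 1) (@nsq_continuous R); exact.
- by move=> y /D[h1 h2 h3 h4]; isd; ring.
- by move=> y /D[h1 h2 h3 h4]; isd; ring.
- by move=> y /D[h1 h2 h3 h4]; isd; field.
- by move=> y /D[h1 h2 h3 h4]; isd; field.
- by move=> y y1; have := L y y1; have := mw y y1; lra.
- by move=> y y1; rewrite bd // y1; lra.
Qed.

Lemma solution_lower w nu n1 n2 n11 n22 M : disk_jet w nu n1 n2 n11 n22 ->
  (forall x, nsq x < 1 -> w x <= M) ->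
  forall x, nsq x <= 1 -> - (M / 4 * (1 - nsq x)) <= nu x.
Proof.
move=> [cw bd C D L] mw x x1; rewrite lerNl.
have -> : M / 4 * (1 - nsq x) = - (- M / 4 * (1 - nsq x)) by field.
apply: (@solution_upper (fun x => - w x) (fun x => - nu x) (fun x => - n1 x)
  (fun x => - n2 x) (fun x => - n11 x) (fun x => - n22 x) (- M)); last exact: x1.
- split.
  + by move=> y; apply: cvgN; exact: cw.
  + by move=> y y1; rewrite bd // oppr0.
  + by move=> y /C[h1 h2 h3 h4 h5]; split; apply: cvgN.
  + by move=> y /D[h1 h2 h3 h4]; split; exact: isdN.
  + by move=> y y1; rewrite -opprD L.
- by move=> y y1; rewrite lerN2 mw.
Qed.

Lemma extend0_bms f (s : R) : s < 1 -> (forall x, nsq x < 1 -> {for x, continuous f}) ->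
  (forall x, s < nsq x -> f x = 0) -> bms f.
Proof.
move=> s1 cf f0; apply: continuous_bms; first exact: (@continuous_extend0 R f s).
by exists s.
Qed.

(** The value outside the open disk is fixed explicitly, since [nu] is arbitrary off the closed
    disk. *)
Definition cutoff nu (c : R -> R) x := if nsq x < 1 then c (nu x) else 0.

Lemma cut_continuous nu (c : R -> R) x : nsq x < 1 -> continuous c ->
  {for x, continuous nu} -> {for x, continuous (cutoff nu c)}.
Proof.
move=> x1 cc cn; apply: (@continuous_near R [set x | nsq x < 1] (fun y => c (nu y))).
- exact: open_disk.
- exact: x1.
- by move=> y /= y1; rewrite /cutoff y1.
- by apply: (@cvg_comp _ _ _ nu c); [exact: cn|exact: cc].
Qed.

Lemma is_derive_cut nu (c c' : R -> R) x (v : plane) (d : R) : nsq x < 1 ->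
  (forall t : R, is_derive t 1 c (c' t)) -> is_derive x v nu d ->
  is_derive x v (cutoff nu c) (cutoff nu c' x * d).
Proof.
move=> x1 dc dn; apply: (@is_derive_near R [set x | nsq x < 1] (fun y => c (nu y))).
- exact: open_disk.
- exact: x1.
- by move=> y /= y1; rewrite /cutoff y1.
- have [D1 E1] := is_deriveP (dc (nu x)); have [D2 E2] := is_deriveP dn.
  have H := @is_derive_comp1 R plane c nu x v D1 D2.
  by apply: (is_derive_eq H); rewrite E1 E2 /cutoff x1.
Qed.

Lemma chi_continuous (k : R) : 0 < k -> continuous (chi k).
Proof.
by move=> k0 t; have /is_deriveP[/derivable1_diffP /differentiable_continuous] := is_derive_chi t k0.
Qed.

Section cutoff_support.
Variables (w' nu n1 n2 n11 n22 : plane -> R) (M k : R).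
Hypotheses (jet : disk_jet w' nu n1 n2 n11 n22) (k0 : 0 < k) (M0 : 0 < M).
Hypothesis wM : forall x, nsq x < 1 -> w' x <= M.

(** By the lower barrier [nu >= - (M / 4) (1 - nsq x)], the value of [nu] exceeds [- k] as soon as
    [1 - nsq x < 4 k / M]. *)
Lemma cut_zero x : 1 - 4 * k / M < nsq x ->
  cutoff nu (chi k) x = 0 /\ cutoff nu (dchi k) x = 0.
Proof.
move=> sx; rewrite /cutoff; case: ifP => // x1.
apply: chi0 => //; have := solution_lower jet wM (ltW x1).
apply: le_trans; rewrite lerN2.
have : 1 - nsq x < 4 * k / M by lra.
by rewrite ltr_pdivlMr //; lra.
Qed.

Lemma cut_support_lt1 : 1 - 4 * k / M < 1.
Proof. by rewrite ltrBlDr ltrDl divr_gt0 // mulr_gt0. Qed.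

Lemma cut_chi_bms f : (forall x, nsq x < 1 -> {for x, continuous f}) ->
  bms (fun x => cutoff nu (chi k) x * f x).
Proof.
move=> cf; have [_ _ C _ _] := jet; apply: (extend0_bms cut_support_lt1).
  move=> x x1; have [h _ _ _ _] := C x x1; apply: cvgM; last exact: cf.
  by apply: cut_continuous => //; exact: chi_continuous.
by move=> x /cut_zero[-> _]; rewrite mul0r.
Qed.

Lemma cut_dchi_bms f : (forall x, nsq x < 1 -> {for x, continuous f}) ->
  bms (fun x => cutoff nu (dchi k) x * f x).
Proof.
move=> cf; have [_ _ C _ _] := jet; apply: (extend0_bms cut_support_lt1).
  move=> x x1; have [h _ _ _ _] := C x x1; apply: cvgM; last exact: cf.
  by apply: cut_continuous => //; exact: dchi_continuous.
by move=> x /cut_zero[_ ->]; rewrite mul0r.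
Qed.

(** Divergence theorem for the field [chi k nu] times the gradient of [psi], which vanishes near the
    circle; so nothing is asked of the gradients at the boundary. *)
Lemma green w psi p1 p2 p11 p22 : disk_jet w psi p1 p2 p11 p22 ->
  I (fun x => cutoff nu (dchi k) x * (n1 x * p1 x + n2 x * p2 x)) =
  - I (fun x => cutoff nu (chi k) x * w x).
Proof.
move=> [_ _ Cp Dp Lp]; have [_ _ C D _] := jet.
have z1 := cut_support_lt1.
have dchik (t : R) : is_derive t 1 (chi k) (dchi k t) by exact: is_derive_chi.
have div1 : I (fun x => cutoff nu (dchi k) x * (n1 x * p1 x) + cutoff nu (chi k) x * p11 x) = 0.
  have G0 x : 1 - 4 * k / M < nsq x ->
      cutoff nu (dchi k) x * (n1 x * p1 x) + cutoff nu (chi k) x * p11 x = 0.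
    by move=> /cut_zero[-> ->]; rewrite !mul0r addr0.
  have F0 x : 1 - 4 * k / M < nsq x -> cutoff nu (chi k) x * p1 x = 0.
    by move=> /cut_zero[-> _]; rewrite mul0r.
  apply: (@I_partial1 R (fun x => cutoff nu (chi k) x * p1 x)).
  - apply: (is_derive_extend0 z1 _ F0 G0) => x x1.
    have [h1 _ h3 _] := D x x1; have [g1 _ g3 _] := Dp x x1.
    apply: (is_derive_eq (isdM (is_derive_cut x1 dchik h1) g3)); ring.
  - apply: (continuous_extend0 z1 _ G0) => x x1.
    have [h1 h2 h3 _ _] := C x x1; have [g1 g2 g3 g4 g5] := Cp x x1.
    apply: cvgD; apply: cvgM.
    + by apply: cut_continuous => //; exact: dchi_continuous.
    + by apply: cvgM.
    + by apply: cut_continuous => //; exact: chi_continuous.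
    + exact: g4.
  - by exists (1 - 4 * k / M).
  - by exists (1 - 4 * k / M).
have div2 : I (fun x => cutoff nu (dchi k) x * (n2 x * p2 x) + cutoff nu (chi k) x * p22 x) = 0.
  have G0 x : 1 - 4 * k / M < nsq x ->
      cutoff nu (dchi k) x * (n2 x * p2 x) + cutoff nu (chi k) x * p22 x = 0.
    by move=> /cut_zero[-> ->]; rewrite !mul0r addr0.
  have F0 x : 1 - 4 * k / M < nsq x -> cutoff nu (chi k) x * p2 x = 0.
    by move=> /cut_zero[-> _]; rewrite mul0r.
  apply: (@I_partial2 R (fun x => cutoff nu (chi k) x * p2 x)).
  - apply: (is_derive_extend0 z1 _ F0 G0) => x x1.
    have [_ h1 _ h3] := D x x1; have [_ g1 _ g3] := Dp x x1.
    apply: (is_derive_eq (isdM (is_derive_cut x1 dchik h1) g3)); ring.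
  - apply: (continuous_extend0 z1 _ G0) => x x1.
    have [h1 h2 h3 _ _] := C x x1; have [g1 g2 g3 g4 g5] := Cp x x1.
    apply: cvgD; apply: cvgM.
    + by apply: cut_continuous => //; exact: dchi_continuous.
    + by apply: cvgM.
    + by apply: cut_continuous => //; exact: chi_continuous.
    + exact: g5.
  - by exists (1 - 4 * k / M).
  - by exists (1 - 4 * k / M).
have Ew : (fun x => cutoff nu (chi k) x * w x) =
    fun x => cutoff nu (chi k) x * p11 x + cutoff nu (chi k) x * p22 x.
  apply/funext => x; rewrite -mulrDr /cutoff; case: ifP => [x1|_]; first by rewrite Lp.
  by rewrite !mul0r.
have Ec : (fun x => cutoff nu (dchi k) x * (n1 x * p1 x + n2 x * p2 x)) =
    fun x => cutoff nu (dchi k) x * (n1 x * p1 x) + cutoff nu (dchi k) x * (n2 x * p2 x).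
  by apply/funext => x; rewrite mulrDr.
have b1 : bms (fun x => cutoff nu (dchi k) x * (n1 x * p1 x)).
  apply: cut_dchi_bms => x x1; have [_ h1 _ _ _] := C x x1; have [_ h2 _ _ _] := Cp x x1.
  exact: cvgM.
have b2 : bms (fun x => cutoff nu (dchi k) x * (n2 x * p2 x)).
  apply: cut_dchi_bms => x x1; have [_ _ h1 _ _] := C x x1; have [_ _ h2 _ _] := Cp x x1.
  exact: cvgM.
have b3 : bms (fun x => cutoff nu (chi k) x * p11 x).
  by apply: cut_chi_bms => x x1; have [] := Cp x x1.
have b4 : bms (fun x => cutoff nu (chi k) x * p22 x).
  by apply: cut_chi_bms => x x1; have [] := Cp x x1.
move: div1 div2; rewrite (ID b1 b3) (ID b2 b4) Ew Ec (ID b1 b2) (ID b3 b4).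
by move: (I _) (I _) (I _) (I _) => a b c d; lra.
Qed.

End cutoff_support.

Lemma sum_sqr_continuous f g x : {for x, continuous f} -> {for x, continuous g} ->
  {for x, continuous (fun y => f y ^+ 2 + g y ^+ 2)}.
Proof.
by move=> cf cg; apply: cvgD; [exact: (cvgM cf cf)|exact: (cvgM cg cg)].
Qed.

Section cutoff_energy.
Variables (w' nu n1 n2 n11 n22 w psi p1 p2 p11 p22 : plane -> R) (M k : R).
Hypotheses (jetn : disk_jet w' nu n1 n2 n11 n22) (jetp : disk_jet w psi p1 p2 p11 p22).
Hypotheses (k0 : 0 < k) (M0 : 0 < M).
Hypothesis wM : forall x, nsq x < 1 -> w' x <= M.

Definition cut_energy (c q1 q2 : plane -> R) x := c x * (q1 x ^+ 2 + q2 x ^+ 2).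

Let contn x : nsq x < 1 -> [/\ {for x, continuous n1}, {for x, continuous n2},
  {for x, continuous p1} & {for x, continuous p2}].
Proof.
move=> x1; have [_ _ C _ _] := jetn; have [_ _ C' _ _] := jetp.
by have [_ ? ? _ _] := C _ x1; have [_ ? ? _ _] := C' _ x1.
Qed.

Lemma cut_energy_bms_self : bms (cut_energy (cutoff nu (dchi k)) n1 n2).
Proof.
apply: (cut_dchi_bms jetn k0 M0 wM) => x x1; have [h1 h2 h3 h4] := contn x1.
by apply: sum_sqr_continuous.
Qed.

Lemma cut_energy_bms_other : bms (cut_energy (cutoff nu (dchi k)) p1 p2).
Proof.
apply: (cut_dchi_bms jetn k0 M0 wM) => x x1; have [h1 h2 h3 h4] := contn x1.
by apply: sum_sqr_continuous.
Qed.

Lemma cut_energy_self : I (cut_energy (cutoff nu (dchi k)) n1 n2) =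
  - I (fun x => cutoff nu (chi k) x * w' x).
Proof.
by rewrite -(green jetn k0 M0 wM jetn).
Qed.

(** Expand the nonnegative integral of [dchi k nu] times the squared norm of the difference of the
    two gradients; [green] evaluates the cross term and the energy of [nu]. Both energies carry the
    weight built from [nu], so the linear term contains the new stream function. *)
Lemma cut_energy_compare : continuous w -> continuous w' ->
  I (cut_energy (cutoff nu (dchi k)) n1 n2) +
  2 * I (fun x => cutoff nu (chi k) x * (w' x - w x)) <=
  I (cut_energy (cutoff nu (dchi k)) p1 p2).
Proof.
move=> cw cw'.
have b1 := cut_energy_bms_self; have b2 := cut_energy_bms_other.
have b3 : bms (fun x => cutoff nu (dchi k) x * (n1 x * p1 x + n2 x * p2 x)).
  apply: (cut_dchi_bms jetn k0 M0 wM) => x x1; have [h1 h2 h3 h4] := contn x1.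
  by apply: cvgD; apply: cvgM.
have b4 : bms (fun x => cutoff nu (chi k) x * w x).
  by apply: (cut_chi_bms jetn k0 M0 wM) => x x1; exact: cw.
have b5 : bms (fun x => cutoff nu (chi k) x * w' x).
  by apply: (cut_chi_bms jetn k0 M0 wM) => x x1; exact: cw'.
have -> : (fun x => cutoff nu (chi k) x * (w' x - w x)) =
    fun x => cutoff nu (chi k) x * w' x - cutoff nu (chi k) x * w x.
  by apply/funext => x; rewrite mulrBr.
rewrite (IB b5 b4).
have := green jetn k0 M0 wM jetp; have := cut_energy_self.
have : 2 * I (fun x => cutoff nu (dchi k) x * (n1 x * p1 x + n2 x * p2 x)) <=
    I (cut_energy (cutoff nu (dchi k)) n1 n2) + I (cut_energy (cutoff nu (dchi k)) p1 p2).
  rewrite -(IZ _ b3) -(ID b1 b2); apply: I_le; [exact: bmsZ|exact: bmsD|].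
  move=> x; rewrite /cut_energy /cutoff; case: ifP => _; last by rewrite !mul0r mulr0 addr0.
  have /andP[c0 _] := dchi01 (nu x) k0.
  rewrite -subr_ge0.
  have -> : dchi k (nu x) * (n1 x ^+ 2 + n2 x ^+ 2) + dchi k (nu x) * (p1 x ^+ 2 + p2 x ^+ 2)
      - 2 * (dchi k (nu x) * (n1 x * p1 x + n2 x * p2 x)) =
      dchi k (nu x) * ((n1 x - p1 x) ^+ 2 + (n2 x - p2 x) ^+ 2) by ring.
  by rewrite mulr_ge0 // addr_ge0 // sqr_ge0.
by move: (I _) (I _) (I _) (I _) (I _) => a b c d e; lra.
Qed.

End cutoff_energy.

End energy_comparison.

(** * Removal of the cutoff and strict decrease of the energy *)

Section energy_decrease.
Variable R : realType.
Local Notation plane := (R * R)%type.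
Local Notation T1 := (measurableTypeR R).
Local Notation T2 := (T1 * T1)%type.
Local Notation mu := (@plane_measure R).
Implicit Types (f g w psi nu : plane -> R) (x : plane).

Lemma I_EFin f : bms f -> (\int[mu]_x (f x)%:E = (I f)%:E)%E.
Proof.
move=> bf; rewrite /I /Rintegral fineK //.
exact: integrable_fin_num (bms_integrable bf).
Qed.

Lemma I_le_integral (D : set plane) f (F : plane -> R) : bms f ->
  measurable (D : set T2) -> measurable_fun (D : set T2) (F : T2 -> R) ->
  (forall x, D x -> 0 <= f x <= F x) -> (forall x, ~ D x -> f x = 0) ->
  ((I f)%:E <= \int[mu]_(x in (D : set T2)) (F x)%:E)%E.
Proof.
move=> bf mD mF fF f0; rewrite -I_EFin //.
have -> : (fun x : T2 => (f x)%:E) = ((fun x : T2 => (f x)%:E) \_ D).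
  by apply/funext => x; rewrite /patch; case: ifPn => //; rewrite notin_setE => /f0 ->.
have [mf _ _] := bf.
rewrite -integral_mkcond; apply: ge0_le_integral => //.
- by move=> x /fF /andP[h _]; rewrite lee_fin.
- by apply/measurable_EFinP; exact: measurable_funS mf.
- exact/measurable_EFinP.
- by move=> x /fF /andP[_ h]; rewrite lee_fin.
Qed.

(** Monotone convergence, for sequences that are eventually constant at each point. The bound [K] is
    an extended real because the Dirichlet integral of the old stream function may be infinite. *)
Lemma integral_le_of_exhaustion (D : set plane) (f : nat -> plane -> R) (F : plane -> R)
    (K : \bar R) :
  (forall n, bms (f n)) -> measurable (D : set T2) ->
  (forall n x, 0 <= f n x) -> (forall n m x, (n <= m)%N -> f n x <= f m x) ->
  (forall n x, ~ D x -> f n x = 0) ->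
  (forall x, D x -> exists n0, forall n, (n0 <= n)%N -> f n x = F x) ->
  (forall n, ((I (f n))%:E <= K)%E) ->
  (\int[mu]_(x in (D : set T2)) (F x)%:E <= K)%E.
Proof.
move=> bf mD f0 fnd fz fF fK.
have lim_eq (x : T2) : limn (fun n => (f n x)%:E) = (((fun x : T2 => (F x)%:E) \_ D) x).
  rewrite /patch; case: ifPn => [|]; [rewrite inE|rewrite notin_setE] => Dx.
    have [n0 Hn] := fF _ Dx; apply/cvg_lim => //.
    apply: cvg_near_cst; exists n0 => // n /= /Hn -> //.
  apply/cvg_lim => //; apply: cvg_near_cst; exists 0%N => // n _ /=.
  by rewrite fz.
rewrite integral_mkcond.
have -> : (fun x : T2 => (F x)%:E) \_ D = fun x => limn (fun n => (f n x)%:E).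
  by apply/funext => x; rewrite lim_eq.
have mf n : measurable_fun setT (fun x : T2 => (f n x)%:E).
  by have [mf _ _] := bf n; exact/measurable_EFinP.
have H := @cvg_monotone_convergence _ T2 R mu setT measurableT
  (fun n (x : T2) => (f n x)%:E) mf (fun n x _ => f0 n x)
  (fun x _ n m nm => fnd n m x nm).
rewrite -(cvg_lim _ H) //; apply: lime_le; first by apply/cvg_ex; eexists; exact: H.
by apply: nearW => n; rewrite I_EFin.
Qed.

(** Where the vorticity changes, the cutoff of [nu] is a translate of [nu] once the threshold is
    small, so the gain [2 G] is the same for every threshold [k n]; only the weighted energies
    change in the limit. *)
Theorem dirichlet_integral_decreases w w' psi nu (m M s0 : R) : 0 < m ->
  continuous w -> continuous w' ->
  (forall x, nsq x < 1 -> m <= w' x <= M) -> s0 < 1 ->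
  (forall x, s0 < nsq x -> w' x = w x) ->
  I (fun x => w' x - w x) = 0 -> 0 < I (fun x => nu x * (w' x - w x)) ->
  dirichlet_solution (unit_disk R) w psi -> dirichlet_solution (unit_disk R) w' nu ->
  (\int[@area R]_(x in unit_disk R) (partial1 nu x ^+ 2 + partial2 nu x ^+ 2)%:E <
   \int[@area R]_(x in unit_disk R) (partial1 psi x ^+ 2 + partial2 psi x ^+ 2)%:E)%E.
Proof.
move=> m0 cw cw' wmM s01 ww' Iw0 Ig0 /dirichlet_disk_jet jetp /dirichlet_disk_jet jetn.
move: jetp jetn; move: (partial1 (partial1 psi)) (partial2 (partial2 psi)) => p11 p22.
move: (partial1 (partial1 nu)) (partial2 (partial2 nu)) => n11 n22.
move: (partial1 psi) (partial2 psi) (partial1 nu) (partial2 nu) => p1 p2 n1 n2 jetp jetn.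
have mw x : nsq x < 1 -> m <= w' x by move=> /wmM/andP[].
have wM x : nsq x < 1 -> w' x <= M by move=> /wmM/andP[].
have M0 : 0 < M.
  have z1 : nsq (0 : plane) < 1 by rewrite /nsq /= expr0n /= addr0 ltr01.
  by apply: lt_le_trans m0 (le_trans (mw _ z1) (wM _ z1)).
pose G := I (fun x => nu x * (w' x - w x)).
(* On the disk [nsq x <= s0] the upper barrier gives [nu x <= - m (1 - s0) / 4 = - 2 k0], which is
   where [chi] becomes a translation. *)
pose k0 := m * (1 - s0) / 8.
have k00 : 0 < k0 by rewrite divr_gt0 // mulr_gt0 // subr_gt0.
pose k n : R := k0 / n.+1%:R.
have k_gt0 n : 0 < k n by rewrite divr_gt0.
have k_le n : k n <= k0.
  by rewrite ler_pdivrMr // ler_peMr ?(ltW k00) // ler1n.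
have [_ _ Cn _ _] := jetn; have [_ _ Cp _ _] := jetp.
have mD : measurable (unit_disk R : set T2).
  exact: open_measurable_plane (@open_disk R 1).
have mF (q1 q2 : plane -> R) : (forall x, nsq x < 1 -> {for x, continuous q1}) ->
    (forall x, nsq x < 1 -> {for x, continuous q2}) ->
    measurable_fun (unit_disk R : set T2) ((fun x => q1 x ^+ 2 + q2 x ^+ 2) : T2 -> R).
  move=> c1 c2; apply: open_continuous_measurable; first exact: (@open_disk R 1).
  by move=> x x1; apply: sum_sqr_continuous; [exact: c1|exact: c2].
have mFn : measurable_fun (unit_disk R : set T2) ((fun x => n1 x ^+ 2 + n2 x ^+ 2) : T2 -> R).
  by apply: mF => x /Cn[].
have mFp : measurable_fun (unit_disk R : set T2) ((fun x => p1 x ^+ 2 + p2 x ^+ 2) : T2 -> R).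
  by apply: mF => x /Cp[].
have areaI (F : plane -> R) : (forall x, 0 <= F x) ->
    measurable_fun (unit_disk R : set T2) (F : T2 -> R) ->
    (\int[@area R]_(x in unit_disk R) (F x)%:E =
     \int[mu]_(x in (unit_disk R : set T2)) (F x)%:E)%E.
  move=> F0 mFF; apply: area_integral => //; first exact/measurable_EFinP.
  by move=> x _; rewrite lee_fin.
have ss (q1 q2 : plane -> R) x : 0 <= q1 x ^+ 2 + q2 x ^+ 2 by rewrite addr_ge0 // sqr_ge0.
rewrite !areaI //.
have cut01 n x : 0 <= cutoff nu (dchi (k n)) x <= 1.
  by rewrite /cutoff; case: ifP => _; [exact: dchi01|rewrite lexx ler01].
have En n x : 0 <= cut_energy (cutoff nu (dchi (k n))) n1 n2 x.
  by have /andP[h _] := cut01 n x; rewrite mulr_ge0.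
have out n (q1 q2 : plane -> R) x : ~ unit_disk R x -> cut_energy (cutoff nu (dchi (k n))) q1 q2 x = 0.
  by move=> /negP/negbTE nx; rewrite /cut_energy /cutoff [nsq x < 1]nx mul0r.
have J n : I (cut_energy (cutoff nu (dchi (k n))) n1 n2) + 2 * G <=
    I (cut_energy (cutoff nu (dchi (k n))) p1 p2).
  apply: le_trans (cut_energy_compare jetn jetp (k_gt0 n) M0 wM cw cw').
  rewrite lerD2l ler_pM2l // le_eqVlt; apply/orP; left; apply/eqP; rewrite /G.
  have bd : bms (fun x => w' x - w x).
    apply: (extend0_bms s01) => [x _|x /ww' ->]; last by rewrite subrr.
    by apply: cvgB; [exact: cw'|exact: cw].
  have bG : bms (fun x => nu x * (w' x - w x)).
    apply: (extend0_bms s01) => [x x1|x /ww' ->]; last by rewrite subrr mulr0.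
    by apply: cvgM; [have [] := Cn x x1|apply: cvgB; [exact: cw'|exact: cw]].
  (* The constant [3 / 2 * k n] drops out because the total vorticity is unchanged. *)
  have -> : (fun x => cutoff nu (chi (k n)) x * (w' x - w x)) =
      fun x => nu x * (w' x - w x) + 3 / 2 * k n * (w' x - w x).
    apply/funext => x; rewrite -mulrDl.
    have [sx|sx] := ltP s0 (nsq x); first by rewrite ww' // subrr !mulr0.
    have x1 : nsq x < 1 := le_lt_trans sx s01.
    rewrite /cutoff x1; have [|-> _ //] := @chi1 R (k n) (nu x) (k_gt0 n).
    have := solution_upper jetn mw (ltW x1); have := k_le n; rewrite /k0.
    have : m * (1 - s0) <= m * (1 - nsq x) by rewrite ler_pM2l // lerD2l lerN2.
    move: (m * (1 - s0)) (k n) => a b; move: (1 - nsq x) => c; lra.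
  by rewrite (ID bG (bmsZ _ bd)) (IZ _ bd) Iw0 mulr0 addr0.
have Ep n : ((I (cut_energy (cutoff nu (dchi (k n))) p1 p2))%:E <=
    \int[mu]_(x in (unit_disk R : set T2)) (p1 x ^+ 2 + p2 x ^+ 2)%:E)%E.
  apply: I_le_integral => //.
  - exact: (cut_energy_bms_other jetn jetp (k_gt0 n) M0 wM).
  - move=> x _; have /andP[h1 h2] := cut01 n x.
    by rewrite /cut_energy mulr_ge0 //= ler_piMl.
  - by move=> x; exact: out.
have exhaust K : (forall n, ((I (cut_energy (cutoff nu (dchi (k n))) n1 n2))%:E <= K)%E) ->
    (\int[mu]_(x in (unit_disk R : set T2)) (n1 x ^+ 2 + n2 x ^+ 2)%:E <= K)%E.
  apply: integral_le_of_exhaustion => //.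
  - by move=> n; exact: (cut_energy_bms_self jetn jetp (k_gt0 n) M0 wM).
  - move=> i j x ij; apply: ler_wpM2r => //; rewrite /cutoff; case: ifP => // _.
    apply: dchi_mono => //; rewrite ler_pM2l // lef_pV2 ?posrE // ler_nat ltnS //.
  - by move=> n x; exact: out.
  - move=> x x1; have := solution_upper jetn mw (ltW x1).
    set a := m / 4 * _; have a0 : 0 < a by rewrite mulr_gt0 ?subr_gt0 // divr_gt0.
    move=> na; have [N HN] : exists N : nat, 2 * k0 / a < N%:R.
      by exists (Num.truncn (2 * k0 / a)).+1; rewrite truncnS_gt.
    exists N => n Nn; rewrite /cut_energy /cutoff x1.
    suff : nu x <= - (2 * k n) by move=> /(chi1 (k_gt0 n)) [_ ->]; rewrite mul1r.
    apply: (le_trans na); rewrite lerN2 /k mulrA ler_pdivrMr //.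
    move: HN; rewrite ltr_pdivrMr // => /ltW /le_trans; apply.
    by rewrite mulrC ler_pM2l // ler_nat; exact: leqW.
(* Finiteness of the new energy is what makes the inequality strict. The integrand is at most
   [M / 4 * M] on a square of area 4. *)
have fin : (\int[mu]_(x in (unit_disk R : set T2)) (n1 x ^+ 2 + n2 x ^+ 2)%:E <=
    (M ^+ 2)%:E)%E.
  apply: exhaust => n; rewrite lee_fin (cut_energy_self jetn (k_gt0 n) M0 wM).
  have bh : bms (fun x => cutoff nu (chi (k n)) x * w' x).
    by apply: (cut_chi_bms jetn (k_gt0 n) M0 wM) => x x1; exact: cw'.
  apply: le_trans (ler_norm _) _; rewrite normrN.
  have -> : M ^+ 2 = M ^+ 2 / 4 * ((1 - -1) * (1 - -1)) by field.
  have h11 : -1 <= 1 :> R by lra.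
  have bh0 x : ~ box (-1) 1 (-1) 1 x -> cutoff nu (chi (k n)) x * w' x = 0.
    by case: bh => _ _; rewrite sqE; exact.
  apply: (I_box_upper h11 h11 bh bh0) => x _; rewrite /cutoff; case: ifP => x1; last first.
    by rewrite mul0r normr0 divr_ge0 // sqr_ge0.
  have /andP[h1 h2] := chi_bound (nu x) (k_gt0 n).
  have l1 := solution_lower jetn wM (ltW x1); have l2 := solution_upper jetn mw (ltW x1).
  have n0 : nu x <= 0.
    by apply: le_trans l2 _; rewrite oppr_le0 mulr_ge0 ?divr_ge0 ?(ltW m0) // subr_ge0 ltW.
  have nM : - (M / 4) <= nu x.
    apply: le_trans l1; rewrite lerN2 ler_piMr ?divr_ge0 ?(ltW M0) //.
    by have := nsq_ge0 x; lra.
  rewrite normrM expr2 mulrAC; apply: ler_pM => //.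
    by rewrite ler0_norm //; move: h1; rewrite ler0_norm //; lra.
  by rewrite ger0_norm ?wM // (le_trans (ltW m0)) // mw.
have : (\int[mu]_(x in (unit_disk R : set T2)) (n1 x ^+ 2 + n2 x ^+ 2)%:E + (2 * G)%:E <=
    \int[mu]_(x in (unit_disk R : set T2)) (p1 x ^+ 2 + p2 x ^+ 2)%:E)%E.
  rewrite -leeBrDr //; apply: exhaust => n; rewrite leeBrDr // -EFinD.
  by apply: le_trans (Ep n); rewrite lee_fin.
apply: lt_le_trans.
have fn : (\int[mu]_(x in (unit_disk R : set T2)) (n1 x ^+ 2 + n2 x ^+ 2)%:E)%E \is a fin_num.
  rewrite ge0_fin_numE; first exact: le_lt_trans fin (ltry _).
  by apply: integral_ge0 => x _; rewrite lee_fin.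
by rewrite lteDl // lte_fin mulr_gt0.
Qed.

End energy_decrease.

(** * Area-preserving twists *)

Section smooth_bump.
Variable R : realType.
Local Notation plane := (R * R)%type.
Implicit Types (t u v : R).

Lemma isdV (f : R -> R) t (df : R) : f t != 0 -> is_derive t 1 f df ->
  is_derive t 1 (fun u => (f u)^-1) (- (f t) ^- 2 * df).
Proof. by move=> ft /(is_deriveV ft); rewrite [_ *: _]mulr1 || exact. Qed.

Lemma isdE (f : R -> R) t (df : R) : is_derive t 1 f df ->
  is_derive t 1 (fun u => expR (f u)) (expR (f t) * df).
Proof.
move=> /is_deriveP[D E].
have [D' E'] := is_deriveP (is_derive_expR (f t)).
have H := @is_derive_comp1 R R (@expR R) f t 1 D' D.
by apply: (is_derive_eq H); rewrite E E'.
Qed.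

(** Differentiating [t^(-m) exp (- 1 / t)] gives a linear combination of members with larger [m], so
    smoothness of the whole family follows by one induction on the order. *)
Definition flat (m : nat) t : R := if 0 < t then t ^- m * expR (- t^-1) else 0.

(** One term of the exponential series, of degree [m + 2], bounds [exp (1 / t)] from below and
    leaves the factor [t^2] that gives derivative zero at the origin. *)
Lemma flat_bound m t : `|flat m t| <= (m.+2)`!%:R * t ^+ 2.
Proof.
rewrite /flat; case: ifP => [t0|_]; last by rewrite normr0 mulr_ge0 // sqr_ge0.
rewrite ger0_norm ?mulr_ge0 ?invr_ge0 ?exprn_ge0 ?(ltW t0) ?expR_ge0 //.
have F0 : 0 < (m.+2)`!%:R :> R by rewrite ltr0n fact_gt0.
have tm : 0 < t ^+ m.+2 by rewrite exprn_gt0.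
have H : ((m.+2)`!%:R * t ^+ m.+2)^-1 <= expR t^-1.
  have := @expR_ge1Dxn R t^-1 m.+1; rewrite invr_ge0 => /(_ (ltW t0)).
  by apply: le_trans; rewrite exprVn invfM mulrC lerDr.
have H' : expR (- t^-1) <= (m.+2)`!%:R * t ^+ m.+2.
  have P := mulr_gt0 F0 tm; by rewrite expRN invf_ple ?posrE ?expR_gt0.
have tn : t ^+ m != 0 by rewrite expf_neq0 // gt_eqF.
have -> : (m.+2)`!%:R * t ^+ 2 = t ^- m * ((m.+2)`!%:R * t ^+ m.+2).
  rewrite [t ^+ m.+2]exprSr [t ^+ m.+1]exprSr; move: (_`!%:R) (t ^+ m) tn => F z zn.
  by field.
by rewrite ler_wpM2l // invr_ge0 exprn_ge0 // ltW.
Qed.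

Lemma is_derive_flat m t : is_derive t 1 (flat m) (flat m.+2 t - m%:R * flat m.+1 t).
Proof.
have [t0|t0|t0] := ltgtP 0 t.
- have H : is_derive t 1 (fun u => u ^- m * expR (- u^-1))
      (flat m.+2 t - m%:R * flat m.+1 t).
    have tn : t != 0 by rewrite gt_eqF.
    have tm : (fun u : R => u ^+ m) t != 0 by rewrite /= expf_neq0.
    have d1 := @isdV (fun u => u ^+ m) t _ tm (isdX m (is_derive_id t (1 : R))).
    have d2 := isdE (isdN (@isdV id t 1 tn (is_derive_id t (1 : R)))).
    apply: (is_derive_eq (isdM d1 d2)); rewrite /flat t0 /=.
    case: m tm {d1} => [|m] tm; first by rewrite !mul0r !mulr0 !exprS expr0 invr1 !mul1r; field.
    have := expf_neq0 m tn; rewrite /= !exprS; move: (t ^+ m) (expR _) => z E zn; field.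
    by rewrite tn zn.
  apply: near_eq_is_derive H.
  near=> u; rewrite /flat ifT //; near: u; exact: lt_nbhsr.
- apply: (@near_eq_is_derive _ _ _ (fun _ => 0)).
    near=> u; rewrite /flat ifF //; apply/negbTE; rewrite -leNgt ltW //.
    by near: u; exact: lt_nbhsl.
  by rewrite /flat !ifF ?mulr0 ?subrr; [exact: isdC| | ]; rewrite ltNge (ltW t0).
- rewrite -t0 /flat ltxx mulr0 subrr.
  apply: (@is_derive_quadratic R _ _ _ ((m.+2)`!%:R)) => // h.
  by rewrite add0r ltxx mulr0 !subr0; exact: flat_bound.
Unshelve. all: by end_near. Qed.

Lemma Ck_flat k m : Ck k setT (fun x : plane => flat m x.1).
Proof.
elim: k m => [|k IH] m.
  split=> // x _; apply: (@cvg_comp _ _ _ fst (flat m)); first exact: cvg_fst.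
  by have /is_deriveP[/derivable1_diffP /differentiable_continuous] := is_derive_flat m x.1.
have d1 (x : plane) : is_derive x (1, 0) (fun x : plane => flat m x.1)
    (flat m.+2 x.1 - m%:R * flat m.+1 x.1).
  by apply/is_derive_e1; exact: is_derive_flat.
have d2 (x : plane) : is_derive x (0, 1) (fun x : plane => flat m x.1) 0.
  by apply/is_derive_e2; exact: (isdC x.2 (1 : R) (flat m x.1)).
split; first by move=> x; exact: (Ck_continuous (IH m)).
split.
- by move=> x _; have /is_deriveP[] := d1 x.
- by move=> x _; have /is_deriveP[] := d2 x.
- rewrite (isd_partial1 d1).
  have := CkD (IH m.+2) (CkM (Ck_cst k (- m%:R : R)) (IH m.+1)).
  by congr (Ck _ _ _); apply/funext => x; rewrite mulNr.
- rewrite (isd_partial2 d2); exact: Ck_cst.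
Qed.

Definition bumpf t : R := flat 0 (1 + t) * flat 0 (1 - t).

Lemma Cinf_bump (g : plane -> R) : Cinf g -> Cinf (fun x => bumpf (g x)).
Proof.
have Cf (h : plane -> R) : Cinf h -> Cinf (fun x => flat 0 (h x)).
  move=> Ch; apply: (@Cinf_comp R (fun x : plane => flat 0 x.1) h (fun _ => 0)) => //.
    by move=> k; exact: Ck_flat.
  exact: Cinf_cst.
by move=> Cg; apply: CinfM; apply: Cf; [apply: CinfD|apply: CinfB] => //; exact: Cinf_cst.
Qed.

Lemma bump_out t : 1 <= `|t| -> bumpf t = 0.
Proof.
rewrite ler_normr /bumpf /flat => /orP[t1|t1].
  by rewrite [in X in _ * X]ifF ?mulr0 //; apply/negbTE; rewrite -leNgt; lra.
by rewrite ifF ?mul0r //; apply/negbTE; rewrite -leNgt; lra.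
Qed.

Lemma bump_in t : `|t| < 1 -> bumpf t = expR (- (2 / (1 - t ^+ 2))).
Proof.
rewrite ltr_norml => /andP[h1 h2].
have p1 : 0 < 1 + t by lra. have p2 : 0 < 1 - t by lra.
rewrite /bumpf /flat p1 p2 !expr0 invr1 !mul1r -expRD; congr expR.
have -> : 1 - t ^+ 2 = (1 + t) * (1 - t) by ring.
by field; rewrite !gt_eqF.
Qed.

Lemma bump_gt0 t : `|t| < 1 -> 0 < bumpf t.
Proof. by move=> /bump_in ->; exact: expR_gt0. Qed.

Lemma bump01 t : 0 <= bumpf t <= 1.
Proof.
have [t1|t1] := ltP `|t| 1; last by rewrite bump_out // lexx ler01.
rewrite bump_in // expR_ge0 expR_le1 oppr_le0 divr_ge0 // subr_ge0.
by rewrite -(real_normK (num_real t)) exprn_ile1 // ltW.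
Qed.

Lemma bump_lt1 t : bumpf t < 1.
Proof.
have [t1|t1] := ltP `|t| 1; last by rewrite bump_out.
rewrite bump_in // expR_lt1 oppr_lt0 divr_gt0 // subr_gt0.
by rewrite -(real_normK (num_real t)) exprn_ilt1.
Qed.

Lemma bump_mono u v : `|u| <= `|v| -> bumpf v <= bumpf u.
Proof.
move=> uv; have [v1|v1] := ltP `|v| 1; last first.
  by rewrite (bump_out v1); have /andP[] := bump01 u.
have u1 := le_lt_trans uv v1.
have sq_lt1 t : `|t| < 1 -> 0 < 1 - t ^+ 2.
  by move=> t1; rewrite subr_gt0 -(real_normK (num_real t)) exprn_ilt1.
rewrite !bump_in // ler_expR lerN2 ler_pM2l // lef_pV2 ?posrE ?sq_lt1 //.
rewrite lerD2l lerN2 -(real_normK (num_real u)) -(real_normK (num_real v)).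
by rewrite lerXn2r ?nnegrE.
Qed.

End smooth_bump.

(** * Shears preserve area *)

Section area_preserving.
Variable R : realType.
Local Notation plane := (R * R)%type.
Local Notation T1 := (measurableTypeR R).
Local Notation T2 := (T1 * T1)%type.
Local Notation mu := (@plane_measure R).
Local Notation leb := (@lebesgue_measure R).

Definition area_preserving (T : plane -> plane) :=
  measurable_fun setT (T : T2 -> T2) /\
  forall A : set T2, measurable A -> mu ((T : T2 -> T2) @^-1` A) = mu A.

Lemma area_preserving_comp (S T : plane -> plane) :
  area_preserving S -> area_preserving T -> area_preserving (S \o T).
Proof.
move=> [mS HS] [mT HT]; split; first exact: (measurableT_comp mS mT).
move=> A mA; rewrite comp_preimage HT ?HS //.
by rewrite -[X in measurable X]setTI; exact: mS.
Qed.

Lemma lebesgue_translate (c : R) (A : set T1) : measurable A ->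
  leb ((fun y => y + c) @^-1` A) = leb A.
Proof.
move=> mA.
have mf : measurable_fun setT ((fun y => y + c) : T1 -> T1).
  by apply: measurable_funD.
apply/esym.
apply: (@lebesgue_measure_unique R (pushforward leb ((fun y => y + c) : T1 -> T1))) => // _ [[a b]] _ <-.
transitivity (leb (`](a - c), (b - c)] : set T1)); last first.
  by rewrite /pushforward; congr (leb _); apply/seteqP; split=> y /=; rewrite !in_itv /= ltrBlDr lerBrDr.
rewrite !lebesgue_measure_itv /= !lte_fin ltrD2r.
by case: ifP => // _; rewrite -!EFinD; congr (_%:E); ring.
Qed.

Definition shear2 (phi : R -> R) (x : plane) : plane := (x.1, x.2 + phi x.1).
Definition shear1 (phi : R -> R) (x : plane) : plane := (x.1 + phi x.2, x.2).

Lemma measurable_pair (f g : plane -> R) : continuous f -> continuous g ->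
  measurable_fun setT ((fun x => (f x, g x)) : T2 -> T2).
Proof.
by move=> cf cg; apply: measurable_fun_pair; exact: continuous_measurable_plane.
Qed.

Lemma shear2_area_preserving (phi : R -> R) : continuous phi ->
  area_preserving (shear2 phi).
Proof.
move=> cphi; have cp : continuous (fun x : plane => phi x.1).
  by move=> x; apply: (@cvg_comp _ _ _ fst phi); [exact: cvg_fst|exact: cphi].
have mS : measurable_fun setT (shear2 phi : T2 -> T2).
  apply: measurable_pair => x; first exact: cvg_fst.
  by apply: cvgD; [exact: cvg_snd|exact: cp].
split; first exact: mS.
move=> A mA; rewrite /plane_measure /product_measure1 /=.
apply: eq_integral => x _ /=.
rewrite -[RHS](@lebesgue_translate (phi x)); last exact: measurable_xsection.
by congr (leb _); apply/seteqP; split=> y /=; rewrite /xsection /= !inE.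
Qed.

(** A horizontal shear translates horizontal slices, so the area is first rewritten as the product
    measure that integrates over those slices; uniqueness of the product measure identifies the
    two. *)
Lemma shear1_area_preserving (phi : R -> R) : continuous phi ->
  area_preserving (shear1 phi).
Proof.
move=> cphi; have cp : continuous (fun x : plane => phi x.2).
  by move=> x; apply: (@cvg_comp _ _ _ snd phi); [exact: cvg_snd|exact: cphi].
have mS : measurable_fun setT (shear1 phi : T2 -> T2).
  apply: measurable_pair => x; last exact: cvg_snd.
  by apply: cvgD; [exact: cvg_fst|exact: cp].
have E (A : set T2) : measurable A -> mu A = (leb \x^ leb)%E A.
  move=> mA; apply: (@product_measure_unique _ _ T1 T1 R leb leb (leb \x^ leb)%E) => //.
  by move=> B C mB mC; exact: product_measure2E.
split; first exact: mS.
move=> A mA.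
have mSA : measurable ((shear1 phi : T2 -> T2) @^-1` A).
  by rewrite -[X in measurable X]setTI; exact: mS.
rewrite (E _ mA) (E _ mSA).
rewrite /product_measure2 /=.
apply: eq_integral => x _ /=.
rewrite -[RHS](@lebesgue_translate (phi x)); last exact: measurable_ysection.
by congr (leb _); apply/seteqP; split=> y /=; rewrite /ysection /= !inE.
Qed.

Lemma I_area_preserving (T : plane -> plane) (f : plane -> R) : area_preserving T ->
  bms f -> bms (f \o T) -> I (f \o T) = I f.
Proof.
move=> [mT HT] bf bfT; rewrite /I /Rintegral; congr fine.
have mf : measurable_fun setT (EFin \o (f : T2 -> R)) by case: bf => h _ _; exact/measurable_EFinP.
have H := @integral_pushforward _ _ T2 T2 R (T : T2 -> T2) mT mu setT (EFin \o f) mf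
  (bms_integrable bfT) measurableT.
rewrite preimage_setT in H; apply: (etrans (esym H)).
by apply: eq_measure_integral => A mA _; exact: HT.
Qed.

End area_preserving.

(** * Action of compactly supported twists on the orbit *)

Section disk_twist.
Variable R : realType.
Local Notation plane := (R * R)%type.
Local Notation T1 := (measurableTypeR R).
Local Notation T2 := (T1 * T1)%type.
Local Notation mu := (@plane_measure R).
Local Notation D := (closure (unit_disk R)).
Implicit Types (T Ti eta : plane -> plane) (s : R).

Definition Cinf_map T := Cinf (fun x => (T x).1) /\ Cinf (fun x => (T x).2).

(** The inverse is part of the data, so that [T] and [Ti] play symmetric roles; [s] is a squared
    radius. *)
Definition twist s T Ti := [/\ cancel T Ti /\ cancel Ti T, Cinf_map T /\ Cinf_map Ti,
  area_preserving T /\ area_preserving Ti & forall x, s < nsq x -> T x = x].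

Lemma twist_sym s T Ti : twist s T Ti -> twist s Ti T.
Proof.
move=> [[TK TiK] [C1 C2] [a1 a2] out]; split=> // x sx.
by rewrite -{1}(out _ sx) TK.
Qed.

Lemma Cinf_map_comp f T : Cinf f -> Cinf_map T -> Cinf (fun x => f (T x)).
Proof.
move=> Cf [C1 C2]; have := Cinf_comp Cf C1 C2.
by congr Cinf; apply/funext => x; case: (T x).
Qed.

(** A point of the disk sent outside would have a fixed point as image, hence would be that point by
    injectivity. *)
Lemma twist_disk s T Ti x : s < 1 -> twist s T Ti -> D x -> D (T x).
Proof.
move=> s1 [[TK _] _ _ out]; rewrite closure_unit_diskE /cdisk /= => x1.
rewrite leNgt; apply/negP => Tx1.
have := out _ (lt_trans s1 Tx1) => /(can_inj TK) E.
by move: Tx1; rewrite E ltNge x1.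
Qed.

Section twisted_diffeo.
Variables (s : R) (T Ti eta : plane -> plane).
Hypotheses (s1 : s < 1) (tw : twist s T Ti) (Deta : Dvol (unit_disk R) eta).

Lemma twist_bij : set_bij D D (T \o eta).
Proof.
have [[beta _ _] _] := Deta; have [[TK TiK] _ _ _] := tw.
apply: (set_bij_comp beta); split.
- by move=> x; exact: (twist_disk s1 tw).
- by move=> x y _ _; exact: (can_inj TK).
- by move=> y Dy; exists (Ti y); [exact: (twist_disk s1 (twist_sym tw))|rewrite TiK].
Qed.

Lemma pinv_twist x : D x -> pinv D (T \o eta) x = pinv D eta (Ti x).
Proof.
move=> Dx; have [[beta _ _] _] := Deta; have [[TK TiK] _ _ _] := tw.
have DTi : D (Ti x) := twist_disk s1 (twist_sym tw) Dx.
have [_ inje sur] := beta; have [_ inj _] := twist_bij.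
have [y Dy yE] := sur _ DTi; have yD := mem_set Dy.
have K1 := pinvKV _ inj yD; have K2 := pinvKV _ inje yD.
have xE : (T \o eta) y = x by rewrite /= yE TiK.
by rewrite -xE (K1 (fun=> point)) xE -yE K2.
Qed.

Lemma Dvol_twist : Dvol (unit_disk R) (T \o eta).
Proof.
have [[beta [[G1 [CG1 G1E]] [G2 [CG2 G2E]]] [[Z1 [CZ1 Z1E]] [Z2 [CZ2 Z2E]]]] vol] := Deta.
have [[TK TiK] [[CT1 CT2] CTi] [apT apTi] out] := tw.
have eqT x : D x -> T (G1 x, G2 x) = T (eta x).
  by move=> Dx; rewrite G1E // G2E //=; case: (eta x).
split.
  split; first exact: twist_bij.
  - split.
    + exists (fun x => (T (G1 x, G2 x)).1); split; last by move=> x /eqT /= ->.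
      exact: (@Cinf_comp R (fun x => (T x).1) G1 G2).
    + exists (fun x => (T (G1 x, G2 x)).2); split; last by move=> x /eqT /= ->.
      exact: (@Cinf_comp R (fun x => (T x).2) G1 G2).
  - split.
    + exists (fun x => Z1 (Ti x)); split; first exact: Cinf_map_comp.
      by move=> x Dx; rewrite /= pinv_twist // Z1E //; exact: (twist_disk s1 (twist_sym tw)).
    + exists (fun x => Z2 (Ti x)); split; first exact: Cinf_map_comp.
      by move=> x Dx; rewrite /= pinv_twist // Z2E //; exact: (twist_disk s1 (twist_sym tw)).
move=> A mA AD; have [mT aT] := apT.
have mTA : measurable ((T : T2 -> T2) @^-1` (A : set T2)).
  by rewrite -[X in measurable X]setTI; exact: mT.
have TAD : T @^-1` A `<=` D.
  move=> x /AD /(twist_disk s1 (twist_sym tw)); by rewrite TK.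
transitivity (@area R (T @^-1` A)); first exact: (vol _ mTA TAD).
by rewrite areaE; exact: aT.
Qed.

End twisted_diffeo.

(** On the closed disk the inverse of [T \o eta] is the inverse of [eta] after [Ti]. *)
Lemma coadjoint_orbit_twist s T Ti omega0 omega : s < 1 -> twist s T Ti ->
  coadjoint_orbit (unit_disk R) omega0 omega ->
  coadjoint_orbit (unit_disk R) omega0 (omega \o Ti).
Proof.
move=> s1 tw [eta Deta E]; exists (T \o eta); first exact: (Dvol_twist s1 tw).
move=> x Dx; rewrite /= (pinv_twist s1 tw Deta Dx) E //.
exact: (twist_disk s1 (twist_sym tw)).
Qed.

End disk_twist.

(** * The commutator of two unit shears *)

Section commutator.
Variable R : realType.
Local Notation plane := (R * R)%type.
Implicit Types (u v : R).

(* Displacement of the commutator of the two shears [(u, v + bumpf u)] and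
   [(u + bumpf v, v)]. *)
Definition disp1 u v : R := bumpf (v - bumpf (u - bumpf v)) - bumpf v.
Definition disp2 u v : R := bumpf (u + disp1 u v) - bumpf (u - bumpf v).

(** Each shear moves points by at most 1 and acts only on a strip of half-width 1. At distance 2 in
    one coordinate one of the shears therefore never acts, and the other is cancelled by its
    inverse. *)
Lemma disp_out u v : 2 <= `|u| \/ 2 <= `|v| -> disp1 u v = 0 /\ disp2 u v = 0.
Proof.
have far (a b : R) : 2 <= `|a| -> bumpf (a - bumpf b) = 0.
  move=> a2; apply: bump_out; have /andP[b0 b1] := bump01 b.
  move: a2; rewrite !ler_normr => /orP[h|h]; apply/orP; [left|right]; lra.
have far0 (a : R) : 2 <= `|a| -> bumpf a = 0.
  by move=> a2; apply: bump_out; apply: le_trans a2; rewrite ler1n.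
case=> h; rewrite /disp2 /disp1.
  by rewrite (far u v h) subr0 subrr addr0 (far0 u h) subrr.
by rewrite (far0 v h) !subr0 (far v u h) addr0 subrr.
Qed.

Lemma disp_bound u v : `|disp1 u v| <= 1 /\ `|disp2 u v| <= 1.
Proof.
have H (a b : R) : `|bumpf a - bumpf b| <= 1.
  have /andP[? ?] := bump01 a; have /andP[? ?] := bump01 b.
  by rewrite ler_norml; apply/andP; split; lra.
by split; exact: H.
Qed.

(** At [v = 1] the first shear does nothing; the second then moves the point into the strip where
    undoing the first shear displaces it. *)
Lemma disp1_neq0 : disp1 0 1 != 0.
Proof.
have b1 : bumpf 1 = 0 :> R by apply: bump_out; rewrite normr1.
rewrite /disp1 b1 !subr0 gt_eqF // bump_gt0 // ltr_norml.
have := @bump_gt0 R 0; rewrite normr0 ltr01 => /(_ isT); have := bump_lt1 (0 : R).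
by move=> *; apply/andP; split; lra.
Qed.

(** At [(1, 1/2)] the first shear moves the point into the strip of the second. Since [disp1] is
    nonnegative there, the point has left that strip when the second shear should be undone. *)
Lemma disp2_neq0 : disp2 1 2^-1 != 0.
Proof.
have bh : 0 < bumpf (2^-1 : R) by apply: bump_gt0; rewrite ger0_norm //; lra.
have bh1 := bump_lt1 (2^-1 : R).
have r0 : 0 < bumpf (1 - bumpf (2^-1 : R)).
  by apply: bump_gt0; rewrite ltr_norml; apply/andP; split; lra.
have r1 := bump_lt1 (1 - bumpf (2^-1 : R)).
have d0 : 0 <= disp1 1 2^-1.
  rewrite /disp1 subr_ge0 bump_mono // [X in _ <= X]ger0_norm // ler_norml.
  by apply/andP; split; lra.
rewrite /disp2 (bump_out (t := 1 + _)) ?sub0r ?oppr_eq0 ?gt_eqF //.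
by rewrite ger0_norm; lra.
Qed.

End commutator.

(** * Rescaled commutators as twists *)

Section scaled_commutator.
Variable R : realType.
Local Notation plane := (R * R)%type.

Lemma positive_box (f : plane -> R) (p : plane) (r : R) : continuous f -> f p != 0 ->
  `|p.1| < r -> `|p.2| < r ->
  exists a b c d k, [/\ a < b, c < d, 0 < k,
    forall x, box a b c d x -> `|x.1| <= r /\ `|x.2| <= r &
    forall x, box a b c d x -> k <= f x ^+ 2].
Proof.
move=> cf fp pr1 pr2.
have f2 : 0 < f p ^+ 2 / 2 by rewrite divr_gt0 // exprn_even_gt0.
have /cvgrPdist_lt /(_ _ f2) := @cvgM _ _ _ (nbhs_filter p) _ _ _ _ (cf p) (cf p).
rewrite -expr2 => /nbhs_ballP[e /= e0 He].
pose m := Num.min (e / 2) (Num.min (r - `|p.1|) (r - `|p.2|)).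
have m0 : 0 < m by rewrite !lt_min divr_gt0 // !subr_gt0 pr1.
have [me m1 m2] : [/\ m <= e / 2, m <= r - `|p.1| & m <= r - `|p.2|].
  by split; rewrite /m !ge_min lexx ?orbT.
have near (z w : R) : z - m <= w <= z + m -> `|z - w| <= m.
  by rewrite ler_norml => /andP[? ?]; apply/andP; split; lra.
have bnd (z w : R) : z - m <= w <= z + m -> `|w| <= `|z| + m.
  by move=> /near zw; have := ler_normB z (z - w); rewrite opprB addrCA subrr addr0; lra.
exists (p.1 - m), (p.1 + m), (p.2 - m), (p.2 + m), (f p ^+ 2 / 2).
split=> //; try lra.
- move=> x [/=]; rewrite !in_itv /= => /bnd h1 /bnd h2; split; lra.
- move=> x [/=]; rewrite !in_itv /= => /near h1 /near h2.
  have /He : ball p e x by apply/in_ball_plane; split; lra.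
  by rewrite /= -expr2 ltr_norml => /andP[_ ?]; lra.
Qed.

Lemma Cinf_disp1 : Cinf (fun x : plane => disp1 x.1 x.2).
Proof.
have C1 := @Cinf_fst R; have C2 := @Cinf_snd R.
apply: CinfB; last exact: Cinf_bump.
by apply: Cinf_bump; apply: CinfB => //; apply: Cinf_bump; apply: CinfB => //; exact: Cinf_bump.
Qed.

Lemma Cinf_disp2 : Cinf (fun x : plane => disp2 x.1 x.2).
Proof.
have C1 := @Cinf_fst R; have C2 := @Cinf_snd R.
apply: CinfB; apply: Cinf_bump; first by apply: CinfD => //; exact: Cinf_disp1.
by apply: CinfB => //; exact: Cinf_bump.
Qed.

Lemma Cinf_continuous1 (phi : R -> R) : Cinf (fun x : plane => phi x.1) -> continuous phi.
Proof.
move=> /(@Cinf_continuous R _) C t.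
exact: (@continuous_comp2 R R (fun x => phi x.1) id (fun _ => 0) t cvg_id (cvg_cst _) (C (t, 0))).
Qed.

(** [Cinf] speaks of functions on the plane, so smoothness in one variable is expressed through
    compositions. *)
Definition smooth_fun (phi : R -> R) := forall g : plane -> R, Cinf g -> Cinf (fun x => phi (g x)).

Lemma smooth_fun_continuous phi : smooth_fun phi -> continuous phi.
Proof. by move=> /(_ _ (@Cinf_fst R)) /Cinf_continuous1. Qed.

Lemma smooth_funN phi : smooth_fun phi -> smooth_fun (fun t => - phi t).
Proof. by move=> H g /H; exact: CinfN. Qed.

Definition shear_commutator (phi1 phi2 : R -> R) (x : plane) : plane :=
  shear2 phi2 (shear1 phi1 (shear2 (fun t => - phi2 t) (shear1 (fun t => - phi1 t) x))).
Definition shear_commutator_inv (phi1 phi2 : R -> R) (x : plane) : plane :=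
  shear1 phi1 (shear2 phi2 (shear1 (fun t => - phi1 t) (shear2 (fun t => - phi2 t) x))).

Lemma shear1K (phi : R -> R) : cancel (shear1 phi) (shear1 (fun t => - phi t)).
Proof. by case=> a c; rewrite /shear1 /= addrK. Qed.
Lemma shear2K (phi : R -> R) : cancel (shear2 phi) (shear2 (fun t => - phi t)).
Proof. by case=> a c; rewrite /shear2 /= addrK. Qed.
Lemma shear1KV (phi : R -> R) : cancel (shear1 (fun t => - phi t)) (shear1 phi).
Proof. by case=> a c; rewrite /shear1 /= subrK. Qed.
Lemma shear2KV (phi : R -> R) : cancel (shear2 (fun t => - phi t)) (shear2 phi).
Proof. by case=> a c; rewrite /shear2 /= subrK. Qed.

Lemma Cinf_map_shear1 (phi : R -> R) (T : plane -> plane) : smooth_fun phi ->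
  Cinf_map T -> Cinf_map (fun x => shear1 phi (T x)).
Proof. by move=> sp [C1 C2]; split=> //; apply: CinfD => //; exact: sp. Qed.

Lemma Cinf_map_shear2 (phi : R -> R) (T : plane -> plane) : smooth_fun phi ->
  Cinf_map T -> Cinf_map (fun x => shear2 phi (T x)).
Proof. by move=> sp [C1 C2]; split=> //; apply: CinfD => //; exact: sp. Qed.

Lemma twist_shear_commutator (phi1 phi2 : R -> R) (s : R) :
  smooth_fun phi1 -> smooth_fun phi2 ->
  (forall x, s < nsq x -> shear_commutator phi1 phi2 x = x) ->
  twist s (shear_commutator phi1 phi2) (shear_commutator_inv phi1 phi2).
Proof.
move=> s1 s2 out; have n1 := smooth_funN s1; have n2 := smooth_funN s2.
have c1 := smooth_fun_continuous s1; have c2 := smooth_fun_continuous s2.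
have k1 := smooth_fun_continuous n1; have k2 := smooth_fun_continuous n2.
have Cid : Cinf_map (fun x : plane => x) by split; [exact: Cinf_fst|exact: Cinf_snd].
split=> //.
- split=> x; rewrite /shear_commutator /shear_commutator_inv.
    by rewrite shear2K shear1K shear2KV shear1KV.
  by rewrite shear1K shear2K shear1KV shear2KV.
- split.
    by apply: Cinf_map_shear2 => //; apply: Cinf_map_shear1 => //;
       apply: Cinf_map_shear2 => //; apply: Cinf_map_shear1.
  by apply: Cinf_map_shear1 => //; apply: Cinf_map_shear2 => //;
     apply: Cinf_map_shear1 => //; apply: Cinf_map_shear2.
- have a1 := shear1_area_preserving c1; have a2 := shear2_area_preserving c2.
  have b1 := shear1_area_preserving k1; have b2 := shear2_area_preserving k2.
  split.
    exact: (area_preserving_comp a2 (area_preserving_comp a1 (area_preserving_comp b2 b1))).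
  exact: (area_preserving_comp a1 (area_preserving_comp a2 (area_preserving_comp b1 b2))).
Qed.

Definition scaled_bump (p e h t : R) := h * bumpf ((t - p) / e).

Lemma smooth_scaled_bump (p e h : R) : smooth_fun (scaled_bump p e h).
Proof.
move=> g Cg; apply: CinfZ; apply: Cinf_bump; apply: CinfM; last exact: Cinf_cst.
by apply: CinfB => //; exact: Cinf_cst.
Qed.

(** The height of each bump is the width of the other one. In coordinates scaled by [e1] and [e2]
    this is therefore the fixed unit commutator, and displacements are of first order in the
    scale. *)
Definition commutator (q : plane) (e1 e2 : R) :=
  shear_commutator (scaled_bump q.2 e2 e1) (scaled_bump q.1 e1 e2).
Definition commutator_inv (q : plane) (e1 e2 : R) :=
  shear_commutator_inv (scaled_bump q.2 e2 e1) (scaled_bump q.1 e1 e2).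

Lemma commutatorE q (e1 e2 u v : R) : 0 < e1 -> 0 < e2 ->
  commutator q e1 e2 (q.1 + e1 * u, q.2 + e2 * v) =
  (q.1 + e1 * (u + disp1 u v), q.2 + e2 * (v + disp2 u v)).
Proof.
move=> p1 p2.
have sb p e h t : 0 < e -> scaled_bump p e h (p + e * t) = h * bumpf t.
  by move=> e0; rewrite /scaled_bump; congr (_ * bumpf _); field; rewrite gt_eqF.
rewrite /commutator /shear_commutator /shear1 /shear2 /= sb //.
have -> : q.1 + e1 * u - e1 * bumpf v = q.1 + e1 * (u - bumpf v) by ring.
rewrite !sb //.
have -> : q.2 + e2 * v - e2 * bumpf (u - bumpf v) = q.2 + e2 * (v - bumpf (u - bumpf v)) by ring.
rewrite !sb //.
have -> : q.1 + e1 * (u - bumpf v) + e1 * bumpf (v - bumpf (u - bumpf v)) =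
    q.1 + e1 * (u + disp1 u v) by rewrite /disp1; ring.
by rewrite sb // /disp2; congr (_, _); ring.
Qed.

Lemma rescale (q x : plane) (e1 e2 : R) : 0 < e1 -> 0 < e2 ->
  x = (q.1 + e1 * ((x.1 - q.1) / e1), q.2 + e2 * ((x.2 - q.2) / e2)).
Proof.
by case: x => a c p1 p2 /=; congr (_, _); field; rewrite gt_eqF.
Qed.

Lemma commutator_out q (e1 e2 : R) x : 0 < e1 -> 0 < e2 ->
  2 * e1 <= `|x.1 - q.1| \/ 2 * e2 <= `|x.2 - q.2| -> commutator q e1 e2 x = x.
Proof.
move=> p1 p2 H; rewrite [in LHS](rescale q x p1 p2) commutatorE //.
have [-> ->] : disp1 ((x.1 - q.1) / e1) ((x.2 - q.2) / e2) = 0 /\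
    disp2 ((x.1 - q.1) / e1) ((x.2 - q.2) / e2) = 0.
  apply: disp_out; case: H => h; [left|right];
    by rewrite normrM normfV (gtr0_norm p1, gtr0_norm p2) ler_pdivlMr.
by rewrite !addr0 -rescale.
Qed.

End scaled_commutator.

(** * Gain of energy by a commutator *)

Section barrier.
Variable R : realType.
Local Notation plane := (R * R)%type.
Variables (q : plane) (e : R).
Hypotheses (e0 : 0 < e) (e1 : e <= 1) (q1 : nsq q < 1).

Let N (x : plane) := (x.1 - q.1) ^+ 2 + (x.2 - q.2) ^+ 2 + e ^+ 2.

(* A barrier: [laplacian hyp >= 1 / hyp], which is large near [q]. *)
Definition hyp x := Num.sqrt (N x).

Let N_gt0 x : 0 < N x.
Proof. by rewrite ltr_wpDl ?exprn_gt0 // addr_ge0 // sqr_ge0. Qed.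

Lemma hyp_gt0 x : 0 < hyp x. Proof. by rewrite sqrtr_gt0. Qed.

Lemma hyp_sqr x : hyp x ^+ 2 = N x. Proof. by rewrite sqr_sqrtr // ltW. Qed.

Lemma is_derive_hyp (x v : plane) d : is_derive x v N d ->
  is_derive x v hyp (d / (2 * hyp x)).
Proof.
move=> /is_deriveP[D E]; have [D' E'] := is_deriveP (is_derive1_sqrt (N_gt0 x)).
have H := @is_derive_comp1 R plane (@Num.sqrt R) N x v D' D.
by apply: (is_derive_eq H); rewrite E E' mulrC.
Qed.

Lemma is_derive1_hyp (x : plane) : is_derive x (1, 0) hyp ((x.1 - q.1) / hyp x).
Proof.
have D : is_derive x (1, 0) N (2 * (x.1 - q.1)) by rewrite /N; isd; rewrite /=; ring.
by apply: (is_derive_eq (is_derive_hyp D)); field; rewrite gt_eqF // hyp_gt0.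
Qed.

Lemma is_derive2_hyp (x : plane) : is_derive x (0, 1) hyp ((x.2 - q.2) / hyp x).
Proof.
have D : is_derive x (0, 1) N (2 * (x.2 - q.2)) by rewrite /N; isd; rewrite /=; ring.
by apply: (is_derive_eq (is_derive_hyp D)); field; rewrite gt_eqF // hyp_gt0.
Qed.

Lemma is_derive_inv (f : plane -> R) (x v : plane) d : f x != 0 -> is_derive x v f d ->
  is_derive x v (fun y => (f y)^-1) (- (f x) ^- 2 * d).
Proof.
move=> fx /is_deriveP[D E].
have [D' E'] := is_deriveP (@isdV R id (f x) 1 fx (is_derive_id (f x) (1 : R))).
have H := @is_derive_comp1 R plane (fun t => t^-1) f x v D' D.
by apply: (is_derive_eq H); rewrite E E' mulr1.
Qed.

Lemma is_derive11_hyp (x : plane) : is_derive x (1, 0) (fun y => (y.1 - q.1) / hyp y)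
  ((hyp x)^-1 - (x.1 - q.1) ^+ 2 / hyp x ^+ 3).
Proof.
have h0 : hyp x != 0 by rewrite gt_eqF // hyp_gt0.
have D := is_derive_inv h0 (is_derive1_hyp x).
have D' : is_derive x (1, 0) (fun y : plane => y.1 - q.1) 1 by isd; ring.
by apply: (is_derive_eq (isdM D' D)); field.
Qed.

Lemma is_derive22_hyp (x : plane) : is_derive x (0, 1) (fun y => (y.2 - q.2) / hyp y)
  ((hyp x)^-1 - (x.2 - q.2) ^+ 2 / hyp x ^+ 3).
Proof.
have h0 : hyp x != 0 by rewrite gt_eqF // hyp_gt0.
have D := is_derive_inv h0 (is_derive2_hyp x).
have D' : is_derive x (0, 1) (fun y : plane => y.2 - q.2) 1 by isd; ring.
by apply: (is_derive_eq (isdM D' D)); field.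
Qed.

Lemma laplacian_hyp x : (hyp x)^-1 <=
  ((hyp x)^-1 - (x.1 - q.1) ^+ 2 / hyp x ^+ 3) + ((hyp x)^-1 - (x.2 - q.2) ^+ 2 / hyp x ^+ 3).
Proof.
have h0 := hyp_gt0 x.
suff -> : ((hyp x)^-1 - (x.1 - q.1) ^+ 2 / hyp x ^+ 3) + ((hyp x)^-1 - (x.2 - q.2) ^+ 2 / hyp x ^+ 3)
    = (hyp x)^-1 + e ^+ 2 / hyp x ^+ 3.
  by rewrite lerDl divr_ge0 ?exprn_ge0 // ltW.
have E : e ^+ 2 = hyp x ^+ 2 - (x.1 - q.1) ^+ 2 - (x.2 - q.2) ^+ 2 by rewrite hyp_sqr /N; ring.
by rewrite E; field; rewrite gt_eqF.
Qed.

Lemma hyp_le3 x : nsq x <= 1 -> hyp x <= 3.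
Proof.
move=> x1; rewrite -(@ler_pXn2r _ 2) ?nnegrE ?(ltW (hyp_gt0 x)) // hyp_sqr /N.
move: x1 q1; rewrite /nsq.
have : e ^+ 2 <= 1 by rewrite exprn_ile1 // ltW.
have := sqr_ge0 (x.1 + q.1); have := sqr_ge0 (x.2 + q.2).
move: (e ^+ 2) => e2; move: x.1 x.2 q.1 q.2 => a b c d; nra.
Qed.

Lemma hyp_near x (K : R) : 0 <= K -> `|x.1 - q.1| <= K * e -> `|x.2 - q.2| <= K * e ->
  hyp x <= (2 * K + 1) * e.
Proof.
move=> K0 h1 h2; rewrite -(@ler_pXn2r _ 2) ?nnegrE ?(ltW (hyp_gt0 x)) //; last first.
  by rewrite mulr_ge0 ?(ltW e0) // addr_ge0 // mulr_ge0.
have sqK z : `|z| <= K * e -> z ^+ 2 <= (K * e) ^+ 2.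
  by move=> zK; rewrite -(real_normK (num_real z)) lerXn2r ?nnegrE // mulr_ge0 // ltW.
rewrite hyp_sqr /N; have := sqK _ h1; have := sqK _ h2.
have : 0 <= K * e by rewrite mulr_ge0 // ltW.
rewrite mulrDl mul1r -mulrA; move: (K * e) (x.1 - q.1) (x.2 - q.2) => z a b.
by have := ltW e0; nra.
Qed.

(** Near [q] the function [hyp] is at most [(2 K + 1) e], so [A * hyp] has Laplacian at least [L e]
    there and outweighs the change of vorticity; since [hyp <= 3] on the disk, the difference is at
    most [3 A], of order [e^2]. A bound ignoring the small support would only give order [e]. *)
Lemma solution_difference_upper (w w' psi nu p1 p2 p11 p22 n1 n2 n11 n22 : plane -> R)
    (K L : R) : 0 <= K -> 0 <= L ->
  disk_jet w psi p1 p2 p11 p22 -> disk_jet w' nu n1 n2 n11 n22 ->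
  (forall x, nsq x < 1 -> - (L * e) <= w' x - w x) ->
  (forall x, nsq x < 1 -> w' x - w x = 0 \/
      `|x.1 - q.1| <= K * e /\ `|x.2 - q.2| <= K * e) ->
  forall x, nsq x <= 1 -> nu x - psi x <= 3 * L * (2 * K + 1) * e ^+ 2.
Proof.
move=> K0 L0 [cp bp Cp Dp Lp] [cn bn Cn Dn Ln] wL wK x x1.
set A := L * (2 * K + 1) * e ^+ 2.
have K21 : 0 <= 2 * K + 1 by lra.
have A0 : 0 <= A := mulr_ge0 (mulr_ge0 L0 K21) (sqr_ge0 e).
suff : nu x - psi x + A * hyp x <= 3 * A.
  have := mulr_ge0 A0 (ltW (hyp_gt0 x)).
  have -> : 3 * L * (2 * K + 1) * e ^+ 2 = 3 * A by rewrite /A; ring.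
  by move: (A * hyp x) => z; lra.
apply: (@max_principle R 1 (3 * A) (fun x => nu x - psi x + A * hyp x)
  (fun x => n1 x - p1 x + A * ((x.1 - q.1) / hyp x))
  (fun x => n2 x - p2 x + A * ((x.2 - q.2) / hyp x))
  (fun x => n11 x - p11 x + A * ((hyp x)^-1 - (x.1 - q.1) ^+ 2 / hyp x ^+ 3))
  (fun x => n22 x - p22 x + A * ((hyp x)^-1 - (x.2 - q.2) ^+ 2 / hyp x ^+ 3)));
  last exact: x1.
- exact: ler01.
- have ch : continuous hyp.
    move=> y; apply: (@cvg_comp _ _ _ N (@Num.sqrt R)); last exact: sqrt_continuous.
    have CN : Cinf N.
      apply: CinfD; last exact: Cinf_cst.
      by apply: CinfD; apply: CinfX; apply: CinfB; (exact: Cinf_fst || exact: Cinf_snd || exact: Cinf_cst).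
    exact: (@Cinf_continuous R N CN y).
  move=> y; apply: cvgD; first by apply: cvgB; [exact: cn|exact: cp].
  apply: cvgM; first exact: cvg_cst.
  by have := continuous_subspaceT (A := cdisk 1) ch; exact.
- move=> y y1; have [h1 h2 h3 h4] := Dp y y1; have [g1 g2 g3 g4] := Dn y y1.
  apply: (is_derive_eq (isdD (isdD g1 (isdN h1)) (isdM (isdC y (1, 0) A) (is_derive1_hyp y)))).
  by rewrite mul0r add0r.
- move=> y y1; have [h1 h2 h3 h4] := Dp y y1; have [g1 g2 g3 g4] := Dn y y1.
  apply: (is_derive_eq (isdD (isdD g2 (isdN h2)) (isdM (isdC y (0, 1) A) (is_derive2_hyp y)))).
  by rewrite mul0r add0r.
- move=> y y1; have [h1 h2 h3 h4] := Dp y y1; have [g1 g2 g3 g4] := Dn y y1.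
  apply: (is_derive_eq (isdD (isdD g3 (isdN h3)) (isdM (isdC y (1, 0) A) (is_derive11_hyp y)))).
  by rewrite mul0r add0r.
- move=> y y1; have [h1 h2 h3 h4] := Dp y y1; have [g1 g2 g3 g4] := Dn y y1.
  apply: (is_derive_eq (isdD (isdD g4 (isdN h4)) (isdM (isdC y (0, 1) A) (is_derive22_hyp y)))).
  by rewrite mul0r add0r.
- move=> y y1.
  have E : n11 y - p11 y + (n22 y - p22 y) = w' y - w y by rewrite -(Lp _ y1) -(Ln _ y1); ring.
  have H := ler_wpM2l A0 (laplacian_hyp y).
  have L2 := wL _ y1; have L3 : 0 <= w' y - w y + A * (hyp y)^-1.
    case: (wK _ y1) => [->|[k1 k2]]; first by rewrite add0r mulr_ge0 // invr_ge0 ltW // hyp_gt0.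
    suff : L * e <= A * (hyp y)^-1 by move: (A * _) (L * e) L2 => u v *; lra.
    rewrite ler_pdivlMr ?hyp_gt0 //.
    have -> : A = L * e * ((2 * K + 1) * e) by rewrite /A; ring.
    by rewrite ler_wpM2l ?hyp_near // mulr_ge0 // ltW.
  by move: H E L3; move: (A * _) => u; lra.
- move=> y y1; rewrite (bn _ y1) (bp _ y1) subrr add0r mulrC; apply: ler_wpM2r => //.
  by apply: hyp_le3; rewrite y1.
Qed.

Lemma solution_difference (w w' psi nu p1 p2 p11 p22 n1 n2 n11 n22 : plane -> R)
    (K L : R) : 0 <= K -> 0 <= L ->
  disk_jet w psi p1 p2 p11 p22 -> disk_jet w' nu n1 n2 n11 n22 ->
  (forall x, nsq x < 1 -> `|w' x - w x| <= L * e) ->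
  (forall x, nsq x < 1 -> w' x - w x = 0 \/
      `|x.1 - q.1| <= K * e /\ `|x.2 - q.2| <= K * e) ->
  forall x, nsq x <= 1 -> `|nu x - psi x| <= 3 * L * (2 * K + 1) * e ^+ 2.
Proof.
move=> K0 L0 jp jn wL wK x x1.
have wL1 y : nsq y < 1 -> - (L * e) <= w' y - w y.
  by move=> /wL; rewrite ler_norml => /andP[].
have wL2 y : nsq y < 1 -> - (L * e) <= w y - w' y.
  by move=> /wL; rewrite ler_norml -opprB => /andP[_]; rewrite lerNl.
have wK2 y : nsq y < 1 -> w y - w' y = 0 \/
      `|y.1 - q.1| <= K * e /\ `|y.2 - q.2| <= K * e.
  by move=> /wK[h|h]; [left; rewrite -opprB h oppr0|right].
have h1 := solution_difference_upper K0 L0 jp jn wL1 wK x1.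
have h2 := solution_difference_upper K0 L0 jn jp wL2 wK2 x1.
rewrite ler_norml; apply/andP; split; last exact: h1.
by rewrite lerNl opprB.
Qed.

End barrier.

(** * Leading order of the gain *)

Section gain.
Variable R : realType.
Local Notation plane := (R * R)%type.
Local Notation T1 := (measurableTypeR R).
Local Notation T2 := (T1 * T1)%type.
Local Notation mu := (@plane_measure R).

Lemma first_order_expansion (F : plane -> R) (q : plane) (a1 a2 K d : R) :
  differentiable F q -> (forall v, 'd F q v = v.1 * a1 + v.2 * a2) ->
  0 < K -> 0 < d ->
  exists2 r, 0 < r & forall e v1 v2, 0 < e < r -> `|v1| <= K -> `|v2| <= K ->
    `|F (q.1 + e * v1, q.2 + e * v2) - F q - e * (a1 * v1 + a2 * v2)| <= d * e.
Proof.
move=> dF dE K0 d0; move/diff_locallyP: (dF) => [_ /eqaddoP H].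
have dK : 0 < d / K by rewrite divr_gt0.
have [r /= r0 Hr] : exists2 r, 0 < r & forall h : plane, `|h| < r ->
    `|F (h + q) - (F q + 'd F q h)| <= d / K * `|h|.
  have /nbhs_ballP[r /= r0 Hr] := H _ dK.
  exists r => // h hr; apply: (Hr h).
  by rewrite -ball_normE /= sub0r normrN.
exists (r / (K + 1)); first by rewrite divr_gt0 // ltr_wpDl // ltW.
move=> e v1 v2 /andP[e0 er] h1 h2.
pose h : plane := (e * v1, e * v2).
have hK : `|h| <= e * K.
  rewrite /h prod_normE /= ge_max !normrM (gtr0_norm e0).
  by rewrite !ler_pM2l // h1 h2.
have hr : `|h| < r.
  apply: le_lt_trans hK _; move: er; rewrite ltr_pdivlMr ?ltr_wpDl ?(ltW K0) //.
  by apply: le_lt_trans; rewrite ler_pM2l // lerDl.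
have := Hr h hr; rewrite dE /h /=.
have -> : (e * v1, e * v2) + q = (q.1 + e * v1, q.2 + e * v2).
  by case: (q) => x y; congr (_, _); rewrite addrC.
have -> : F (q.1 + e * v1, q.2 + e * v2) - (F q + (e * v1 * a1 + e * v2 * a2)) =
   F (q.1 + e * v1, q.2 + e * v2) - F q - e * (a1 * v1 + a2 * v2) by ring.
move=> /le_trans; apply; apply: le_trans (ler_wpM2l (ltW dK) hK) _.
by rewrite (mulrC e) mulrA divfK // gt_eqF.
Qed.

(** Adding [th] on the large box makes [f] nonnegative, so that its integral is at least that over
    the small box. *)
Lemma I_box_mixed (f : plane -> R) (a b c d a' b' c' d' th k : R) :
  a <= b -> c <= d -> a' <= b' -> c' <= d' -> bms f -> 0 <= th ->
  box a b c d `<=` @sq R -> box a' b' c' d' `<=` box a b c d ->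
  (forall x, ~ box a b c d x -> f x = 0) ->
  (forall x, box a b c d x -> - th <= f x) ->
  (forall x, box a' b' c' d' x -> k <= f x) ->
  k * ((b' - a') * (d' - c')) - th * ((b - a) * (d - c)) <= I f.
Proof.
move=> ab cd ab' cd' bf th0 Bsq BB f0 fth fk.
have mB := @box_measurable R a b c d.
pose i := (fun _ : plane => th) \_ (box a b c d).
have bi : bms i.
  split.
  - by apply/(measurable_restrictT _ mB); exact: measurable_cst.
  - exists th => x; rewrite /i /patch; case: ifP => _; first by rewrite ger0_norm.
    by rewrite normr0.
  - by move=> x nx; rewrite /i /patch; case: ifPn => //; rewrite inE => /Bsq.
have Ii : I i = th * ((b - a) * (d - c)).
  by rewrite /I /i -Rintegral_mkcond I_box.
have B1 x : box a b c d x -> i x = th by move=> Bx; rewrite /i /patch mem_set.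
have := @I_box_lower R (fun x => f x + i x) a' b' c' d' k ab' cd' (bmsD bf bi).
rewrite (ID bf bi) Ii lerBlDr; apply.
- move=> x; have [Bx|nBx] := pselect (box a b c d x).
    by rewrite B1 //; have := fth _ Bx; lra.
  by rewrite f0 // add0r /i /patch; case: ifP.
- by move=> x Bx; rewrite B1; [have := fk _ Bx; lra|exact: BB].
Qed.

(** Completing the square in [D] shows that the good term with coefficient [- a b] survives with
    half its size, while all terms involving [D'] carry [t^2]. This is why the box is made thin in
    the direction whose product of derivatives has unknown sign. *)
Lemma cross_term_bound (a b a' b' D D' t : R) : a * b < 0 -> `|D'| <= 1 ->
  - (a * b) / 2 * D ^+ 2 - t ^+ 2 *
    ((a * b' + a' * b) ^+ 2 / (2 * - (a * b)) + `|a' * b'|) <=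
  - ((a * D + t * a' * D') * (b * D + t * b' * D')).
Proof.
move=> ab D1; set k := - (a * b); set S := a * b' + a' * b.
have k0 : 0 < k by rewrite oppr_gt0.
have an : a != 0 by apply: contraTneq ab => ->; rewrite mul0r ltxx.
have bn : b != 0 by apply: contraTneq ab => ->; rewrite mulr0 ltxx.
have D2 : D' ^+ 2 <= 1 by rewrite -(real_normK (num_real D')) exprn_ile1.
have -> : - ((a * D + t * a' * D') * (b * D + t * b' * D')) =
   k / 2 * D ^+ 2 + (k * D - t * S * D') ^+ 2 / (2 * k)
   - t ^+ 2 * (S ^+ 2 / (2 * k) * D' ^+ 2 + a' * b' * D' ^+ 2).
  by rewrite /S /k; field; rewrite ?an ?bn.
rewrite -addrA lerD2l.
have h1 : 0 <= (k * D - t * S * D') ^+ 2 / (2 * k) by rewrite divr_ge0 ?sqr_ge0 // ltW // mulr_gt0.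
have h2 : S ^+ 2 / (2 * k) * D' ^+ 2 <= S ^+ 2 / (2 * k).
  by rewrite ler_piMr // divr_ge0 ?sqr_ge0 // ltW // mulr_gt0.
have h3 : a' * b' * D' ^+ 2 <= `|a' * b'|.
  apply: le_trans (ler_norm _) _; rewrite normrM ler_piMr //.
  by rewrite ger0_norm ?sqr_ge0.
have h4 : t ^+ 2 * (S ^+ 2 / (2 * k) * D' ^+ 2 + a' * b' * D' ^+ 2) <=
    t ^+ 2 * (S ^+ 2 / (2 * k) + `|a' * b'|).
  by rewrite ler_wpM2l ?sqr_ge0 // lerD.
by move: h1 h4; move: (_ / (2 * k)) (t ^+ 2 * _) (t ^+ 2 * _) => u v w; lra.
Qed.

Lemma small_scale (M th : R) : 0 <= M -> 0 < th -> exists2 t : R, 0 < t & t ^+ 2 * M <= th.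
Proof.
move=> M0 th0; have M1 : 0 < M + 1 by lra.
exists (Num.min 1 (th / (M + 1))); first by rewrite lt_min ltr01 divr_gt0.
set t := Num.min _ _; have [t1 tM] : t <= 1 /\ t <= th / (M + 1).
  by rewrite /t !ge_min !lexx orbT.
have t0 : 0 <= t by rewrite /t le_min ler01 ltW // divr_gt0.
apply: (@le_trans _ _ (t * (M + 1))); last by rewrite -ler_pdivlMr.
rewrite expr2 -mulrA ler_wpM2l // (@le_trans _ _ M) ?lerDl // ler_piMl //.
Qed.

Lemma subbox_area (a b c d : R) : a < b -> c < d ->
  (forall x, box a b c d x -> `|x.1| <= 2 /\ `|x.2| <= 2) ->
  0 < (b - a) * (d - c) <= 16.
Proof.
move=> ab cd H.
have [h1 h2] : `|a| <= 2 /\ `|c| <= 2.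
  by apply: (H (a, c)); split; rewrite /= in_itv /= lexx ltW.
have [h3 h4] : `|b| <= 2 /\ `|d| <= 2.
  by apply: (H (b, d)); split; rewrite /= in_itv /= lexx ltW.
move: h1 h2 h3 h4; rewrite !ler_norml => /andP[? ?] /andP[? ?] /andP[? ?] /andP[? ?].
have x0 : 0 < b - a by lra. have y0 : 0 < d - c by lra.
rewrite mulr_gt0 //=; have -> : 16 = 4 * 4 :> R by ring.
by apply: ler_pM; lra.
Qed.

(* Leading term, in rescaled coordinates, of
   [- (psi \o T - psi) * (g \o T - g)] for a commutator [T] concentrated at a point
   where the gradients of [psi] and [g] are [(a1, a2)] and [(b1, b2)]. *)
Definition gain_form (a1 a2 b1 b2 t1 t2 u v : R) :=
  - ((t1 * a1 * disp1 u v + t2 * a2 * disp2 u v) *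
     (t1 * b1 * disp1 u v + t2 * b2 * disp2 u v)).

(** The direction with negative product gets scale 1 and the other a small scale [t]. The good box
    lies around a point where the displacement in the favourable direction is nonzero. *)
Lemma gain_scales (a1 a2 b1 b2 : R) : a1 * b1 < 0 \/ a2 * b2 < 0 ->
  exists t1 t2 th k a b c d, [/\ 0 < t1, 0 < t2, 0 < th & a < b /\ c < d] /\
    [/\ forall u v, - th <= gain_form a1 a2 b1 b2 t1 t2 u v,
      forall x, box a b c d x -> `|x.1| <= 2 /\ `|x.2| <= 2,
      forall x, box a b c d x -> k <= gain_form a1 a2 b1 b2 t1 t2 x.1 x.2 &
      49 * th <= k * ((b - a) * (d - c))].
Proof.
have main (f f' : R -> R -> R) (p : plane) (a b a' b' : R) : a * b < 0 ->
    continuous (fun x : plane => f x.1 x.2) -> f p.1 p.2 != 0 -> `|p.1| < 2 -> `|p.2| < 2 ->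
    (forall u v, `|f' u v| <= 1) ->
    exists t th k x y z w, [/\ 0 < t, 0 < th & x < y /\ z < w] /\
    [/\ forall u v, - th <= - ((a * f u v + t * a' * f' u v) * (b * f u v + t * b' * f' u v)),
      forall r, box x y z w r -> `|r.1| <= 2 /\ `|r.2| <= 2,
      forall r, box x y z w r -> k <= - ((a * f r.1 r.2 + t * a' * f' r.1 r.2) *
         (b * f r.1 r.2 + t * b' * f' r.1 r.2)) &
      49 * th <= k * ((y - x) * (w - z))].
  move=> ab cf fp p1 p2 f'1.
  have [x [y [z [w [k [xy zw k0 B Bk]]]]]] := positive_box cf fp p1 p2.
  have /andP[al0 al16] := subbox_area xy zw B.
  set al := (y - x) * (w - z) in al0 al16 *.
  have kap : 0 < - (a * b) / 2 by rewrite divr_gt0 // oppr_gt0.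
  (* The number 65 is [49 + 16]: the lower bound on the box loses [th] over an area of at most
     16. *)
  set th := - (a * b) / 2 * k * al / 65.
  have th0 : 0 < th by apply: divr_gt0 => //; exact: (mulr_gt0 (mulr_gt0 kap k0) al0).
  have M0 : 0 <= (a * b' + a' * b) ^+ 2 / (2 * - (a * b)) + `|a' * b'|.
    by rewrite addr_ge0 // divr_ge0 ?sqr_ge0 // mulr_ge0 // ltW // oppr_gt0.
  have [t t0 tM] := small_scale M0 th0.
  have bnd u v : - (a * b) / 2 * f u v ^+ 2 - th <=
      - ((a * f u v + t * a' * f' u v) * (b * f u v + t * b' * f' u v)).
    by apply: le_trans (cross_term_bound a' b' (f u v) t ab (f'1 u v)); rewrite lerD2l lerN2.
  exists t, th, (- (a * b) / 2 * k - th), x, y, z, w; split=> //; split=> //.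
  - move=> u v; apply: le_trans (bnd u v).
    by have := mulr_ge0 (ltW kap) (sqr_ge0 (f u v)); lra.
  - move=> r Br; apply: le_trans (bnd _ _); rewrite lerD2r ler_wpM2l ?(ltW kap) //.
    exact: Bk.
  - rewrite mulrBl -/al.
    have -> : - (a * b) / 2 * k * al = 65 * th by rewrite /th; field.
    have : th * al <= th * 16 by rewrite ler_pM2l.
    by move: (th * al) => u; lra.
have c1 := @Cinf_continuous R _ (Cinf_disp1 R).
have c2 := @Cinf_continuous R _ (Cinf_disp2 R).
have lt12 : `|1 : R| < 2 by rewrite ger0_norm; lra.
have lt02 : `|0 : R| < 2 by rewrite normr0.
have lth2 : `|2^-1 : R| < 2 by rewrite ger0_norm; lra.
case=> ab.
- have [t [th [k [x [y [z [w [[t0 th0 xyzw] [H1 H2 H3 H4]]]]]]]]] :=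
    main (@disp1 R) (@disp2 R) (0, 1) a1 b1 a2 b2 ab c1 (@disp1_neq0 R) lt02 lt12
      (fun u v => (disp_bound u v).2).
  exists 1, t, th, k, x, y, z, w; split=> //; split=> //.
    by move=> u v; rewrite /gain_form !mul1r; exact: H1.
  by move=> r Br; rewrite /gain_form !mul1r; exact: H3.
- have [t [th [k [x [y [z [w [[t0 th0 xyzw] [H1 H2 H3 H4]]]]]]]]] :=
    main (@disp2 R) (@disp1 R) (1, 2^-1) a2 b2 a1 b1 ab c2 (@disp2_neq0 R) lt12 lth2
      (fun u v => (disp_bound u v).1).
  exists t, 1, th, k, x, y, z, w; split=> //; split=> //.
    move=> u v; rewrite /gain_form !mul1r.
    by rewrite [X in X * _]addrC [X in _ * X]addrC; exact: H1.
  move=> r Br; rewrite /gain_form !mul1r.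
  by rewrite [X in X * _]addrC [X in _ * X]addrC; exact: H3.
Qed.

End gain.

(** * Gain of a commutator at small scales *)

Section commutator_gain.
Variable R : realType.
Local Notation plane := (R * R)%type.

Lemma Cinf_map_continuous (T : plane -> plane) : Cinf_map T -> continuous T.
Proof.
move=> [C1 C2] x.
have -> : T = fun y => ((T y).1, (T y).2) by apply/funext => y; case: (T y).
exact: (cvg_pair (@Cinf_continuous R _ C1 x) (@Cinf_continuous R _ C2 x)).
Qed.

Lemma twist_open_disk s (T Ti : plane -> plane) x : s < 1 -> twist s T Ti ->
  nsq x < 1 -> nsq (T x) < 1.
Proof.
move=> s1 [[TK _] _ _ out] x1; rewrite ltNge; apply/negP => Tx1.
have := out _ (lt_le_trans s1 Tx1) => /(can_inj TK) E.
by move: Tx1; rewrite E leNgt x1.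
Qed.

Lemma twist_comp_continuous s (T Ti : plane -> plane) (f : plane -> R) : s < 1 ->
  twist s T Ti -> (forall x, nsq x < 1 -> {for x, continuous f}) ->
  forall x, nsq x < 1 -> {for x, continuous (fun y => f (T y))}.
Proof.
move=> s1 tw cf x x1; have [_ [CT _] _ _] := tw.
apply: (@cvg_comp _ _ _ T f); first exact: (Cinf_map_continuous CT).
by apply: cf; exact: (twist_open_disk s1 tw).
Qed.

Lemma product_error (e X Y r r' B dl th : R) : 0 <= e -> `|X| <= B -> `|Y| <= B ->
  `|r| <= 2 * dl * e -> `|r'| <= 2 * dl * e -> 0 <= dl <= 1 -> 4 * dl * (B + 1) <= th ->
  e ^+ 2 * (- (X * Y)) - e ^+ 2 * th <= - ((e * X + r) * (e * Y + r')).
Proof.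
move=> e0 XB YB rB rB' /andP[dl0 dl1] dlth.
have -> : - ((e * X + r) * (e * Y + r')) =
  e ^+ 2 * (- (X * Y)) - (e * X * r' + e * Y * r + r * r') by ring.
rewrite lerD2l lerN2; apply: le_trans (ler_norm _) _.
have h1 : `|e * X * r'| <= e * B * (2 * dl * e).
  by rewrite !normrM (ger0_norm e0); apply: ler_pM; rewrite ?mulr_ge0 ?ler_wpM2l.
have h2 : `|e * Y * r| <= e * B * (2 * dl * e).
  by rewrite !normrM (ger0_norm e0); apply: ler_pM; rewrite ?mulr_ge0 ?ler_wpM2l.
have h3 : `|r * r'| <= 2 * dl * e * (2 * dl * e) by rewrite normrM; apply: ler_pM.
have t1 := ler_normD (e * X * r' + e * Y * r) (r * r').
have t2 := ler_normD (e * X * r') (e * Y * r).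
apply: (@le_trans _ _ (e ^+ 2 * (4 * dl * (B + 1)))); last by rewrite ler_wpM2l ?sqr_ge0.
have -> : e ^+ 2 * (4 * dl * (B + 1)) = e * B * (2 * dl * e) + e * B * (2 * dl * e)
  + 2 * dl * e * (2 * dl * e) + e ^+ 2 * (4 * dl * (1 - dl)) by ring.
have : 0 <= e ^+ 2 * (4 * dl * (1 - dl)).
  by rewrite mulr_ge0 ?sqr_ge0 // !mulr_ge0 // subr_ge0.
move: t1 t2 h1 h2 h3; move: (`|_|) (`|_|) (`|_|) (`|_|) (`|_|) => x1 x2 x3 x4 x5.
by move: (e * B * _) (2 * dl * e * _) (e ^+ 2 * _) => y1 y2 y3; lra.
Qed.

Lemma linear_form_bound (t1 t2 a1 a2 B : R) u v : 0 < t1 -> 0 < t2 ->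
  t1 * `|a1| + t2 * `|a2| <= B -> `|t1 * a1 * disp1 u v + t2 * a2 * disp2 u v| <= B.
Proof.
move=> p1 p2; apply: le_trans; apply: le_trans (ler_normD _ _) _.
have [d1 d2] := disp_bound u v.
by rewrite !normrM (gtr0_norm p1) (gtr0_norm p2) lerD // ler_piMr // mulr_ge0 // ltW.
Qed.

Lemma scaled_bound (t t' z w : R) : 0 < t -> 0 < t' -> `|z| <= 2 -> `|w| <= 1 ->
  [/\ `|t * z| <= 3 * (t + t'), `|t * (z + w)| <= 3 * (t + t'),
     `|t * z| <= 3 * (t' + t) & `|t * (z + w)| <= 3 * (t' + t)].
Proof.
move=> t0 t0' z2 w1; rewrite !normrM (gtr0_norm t0).
have := ler_normD z w; rewrite (addrC t') => H.
have h1 : t * `|z| <= t * 3 by rewrite ler_pM2l //; lra.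
have h2 : t * `|z + w| <= t * 3 by rewrite ler_pM2l //; lra.
by split; lra.
Qed.

Lemma centered_itv (z e x : R) : (z - e <= x <= z + e) = (`|x - z| <= e).
Proof. by rewrite ler_norml; apply/andP/andP => -[? ?]; split; lra. Qed.

Lemma centered_le (z e : R) : 0 <= e -> z - 2 * e <= z + 2 * e.
Proof. lra. Qed.

Lemma itv_unscale (z t y x w : R) : 0 < t -> z + t * y <= x <= z + t * w ->
  y <= (x - z) / t <= w.
Proof.
by move=> t0; rewrite ler_pdivlMr // ler_pdivrMr // lerBrDl lerBlDl ![_ * t]mulrC.
Qed.

(** The gain is compared with its value for affine [psi] and [g], which is [e^2] times [gain_form]
    in rescaled coordinates; differentiability at the single point [q] makes the error a small
    fraction of it. *)
Theorem commutator_gain (psi g : plane -> R) (q : plane) (a1 a2 b1 b2 : R) :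
  nsq q < 1 -> (forall x, nsq x < 1 -> {for x, continuous psi}) -> continuous g ->
  differentiable psi q -> (forall v, 'd psi q v = v.1 * a1 + v.2 * a2) ->
  differentiable g q -> (forall v, 'd g q v = v.1 * b1 + v.2 * b2) ->
  a1 * b1 < 0 \/ a2 * b2 < 0 ->
  exists s K L c e0, [/\ s < 1, 0 < K, 0 <= L, 0 < c & 0 < e0] /\
    forall e, 0 < e < e0 -> exists T Ti, [/\ twist s T Ti,
      forall x, T x = x \/ `|x.1 - q.1| <= K * e /\ `|x.2 - q.2| <= K * e,
      forall x, `|g (T x) - g x| <= L * e &
      c * e ^+ 4 <= I (fun x => - ((psi (T x) - psi x) * (g (T x) - g x)))].
Proof.
move=> q1 cpsi cg dpsi Epsi dg Eg neg.
have [t1 [t2 [th [k [a [b [c [d [[p1 p2 th0 [ab cd]] [F1 F2 F3 F4]]]]]]]]]] := gain_scales neg.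
have /andP[al0 al16] := subbox_area ab cd F2.
pose B := t1 * `|a1| + t2 * `|a2| + (t1 * `|b1| + t2 * `|b2|).
have nn t z : 0 < t -> 0 <= t * `|z| by move=> t0; rewrite mulr_ge0 // ltW.
have B0 : 0 <= B by rewrite !addr_ge0 ?nn.
have XB u v : `|t1 * a1 * disp1 u v + t2 * a2 * disp2 u v| <= B.
  by apply: linear_form_bound => //; rewrite lerDl addr_ge0 ?nn.
have YB u v : `|t1 * b1 * disp1 u v + t2 * b2 * disp2 u v| <= B.
  by apply: linear_form_bound => //; rewrite lerDr addr_ge0 ?nn.
have B4 : 0 < 4 * (B + 1) by lra.
(* The relative error of the first order expansions, small enough that the product of two
   differences is off by at most [th * e^2]. *)
pose dl := Num.min 1 (th / (4 * (B + 1))).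
have dl0 : 0 < dl by rewrite lt_min ltr01 divr_gt0.
have [dl1 dlth] : dl <= 1 /\ dl <= th / (4 * (B + 1)) by rewrite /dl !ge_min !lexx orbT.
have {}dlth : 4 * dl * (B + 1) <= th by rewrite mulrAC mulrC -ler_pdivlMr.
clearbody dl B.
(* Rescaled points of the box have coordinates at most 2 and move by at most 1, so both endpoints
   stay within 3. *)
have K10 : 0 < 3 * (t1 + t2) by lra.
have [r1 r10 H1] := first_order_expansion dpsi Epsi K10 dl0.
have [r2 r20 H2] := first_order_expansion dg Eg K10 dl0.
pose s := (1 + nsq q) / 2.
have s1 : s < 1 by rewrite /s; lra.
have qs : nsq q < s by rewrite /s; lra.
clearbody s.
have /nbhs_ballP[r3 /= r30 H3] := open_nbhs_nbhs (conj (@open_disk R s) qs).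
have K0 : 0 < 2 * (t1 + t2) by lra.
exists s, (2 * (t1 + t2)), (B + 2), (t1 * t2 * th),
  (Num.min (Num.min r1 r2) (r3 / (2 * (t1 + t2)))).
split.
  split=> //; first by lra.
  - exact: (mulr_gt0 (mulr_gt0 p1 p2) th0).
  - by rewrite !lt_min r10 r20 divr_gt0.
move=> e /andP[e0]; rewrite !lt_min => /andP[/andP[er1 er2] er3].
have {}er3 : 2 * (t1 + t2) * e < r3 by rewrite mulrC -ltr_pdivlMr.
have e10 : 0 < t1 * e := mulr_gt0 p1 e0. have e20 : 0 < t2 * e := mulr_gt0 p2 e0.
pose T := commutator q (t1 * e) (t2 * e).
pose Ti := commutator_inv q (t1 * e) (t2 * e).
have out x : 2 * (t1 * e) <= `|x.1 - q.1| \/ 2 * (t2 * e) <= `|x.2 - q.2| -> T x = x.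
  exact: commutator_out.
have inbox x : T x = x \/ `|x.1 - q.1| < 2 * (t1 * e) /\ `|x.2 - q.2| < 2 * (t2 * e).
  have [h|h] := leP (2 * (t1 * e)) `|x.1 - q.1|; first by left; apply: out; left.
  have [h'|h'] := leP (2 * (t2 * e)) `|x.2 - q.2|; first by left; apply: out; right.
  by right.
have le1 : 2 * (t1 * e) <= 2 * (t1 + t2) * e.
  by rewrite -mulrA ler_pM2l // mulrDl lerDl ltW.
have le2 : 2 * (t2 * e) <= 2 * (t1 + t2) * e.
  by rewrite -mulrA ler_pM2l // mulrDl lerDr ltW.
have small x : `|x.1 - q.1| <= 2 * (t1 * e) -> `|x.2 - q.2| <= 2 * (t2 * e) -> nsq x < s.
  move=> h1 h2; apply: H3; apply/in_ball_plane; rewrite (distrC q.1) (distrC q.2).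
  by split; apply: le_lt_trans er3; [exact: le_trans le1|exact: le_trans le2].
have tw : twist s T Ti.
  apply: twist_shear_commutator; try exact: smooth_scaled_bump.
  move=> x sx; have [//|[h1 h2]] := inbox x.
  by have := small x (ltW h1) (ltW h2); rewrite ltNge (ltW sx).
(* The expansion at [q] is used at a point and at its image; subtracting leaves the linear form of
   the displacement with twice the error. *)
have step F (c1 c2 r : R) u v : 
    (forall e v1 v2, 0 < e < r -> `|v1| <= 3 * (t1 + t2) -> `|v2| <= 3 * (t1 + t2) ->
      `|F (q.1 + e * v1, q.2 + e * v2) - F q - e * (c1 * v1 + c2 * v2)| <= dl * e) ->
    e < r -> `|u| <= 2 -> `|v| <= 2 ->
    `|F (T (q.1 + t1 * e * u, q.2 + t2 * e * v)) - F (q.1 + t1 * e * u, q.2 + t2 * e * v)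
      - e * (t1 * c1 * disp1 u v + t2 * c2 * disp2 u v)| <= 2 * dl * e.
  move=> H er u2 v2; rewrite /T commutatorE //.
  have [d1 d2] := disp_bound u v.
  have [k1 k2 _ _] := scaled_bound p1 p2 u2 d1; have [_ _ k3 k4] := scaled_bound p2 p1 v2 d2.
  have ee : 0 < e < r by rewrite e0 er.
  have E0 := H e _ _ ee k1 k3; have E1 := H e _ _ ee k2 k4.
  have cm t (z : R) : t * e * z = e * (t * z) by ring.
  rewrite !cm; move: (lerD E1 E0).
  set A0 := F (_ + e * (t1 * u), _); set A1 := F (_, _).
  have -> : 2 * dl * e = dl * e + dl * e by ring.
  apply: le_trans; apply: le_trans (ler_normB _ _).
  by rewrite le_eqVlt; apply/orP; left; apply/eqP; congr (`|_|); ring.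
have unscale (x : plane) : `|x.1 - q.1| <= 2 * (t1 * e) -> `|x.2 - q.2| <= 2 * (t2 * e) ->
    exists u v, [/\ x = (q.1 + t1 * e * u, q.2 + t2 * e * v), `|u| <= 2 & `|v| <= 2].
  move=> h1 h2; exists ((x.1 - q.1) / (t1 * e)), ((x.2 - q.2) / (t2 * e)).
  split; first exact: rescale.
  - by rewrite normrM normfV (gtr0_norm e10) ler_pdivrMr.
  - by rewrite normrM normfV (gtr0_norm e20) ler_pdivrMr.
have bmsF : bms (fun x => - ((psi (T x) - psi x) * (g (T x) - g x))).
  apply: (extend0_bms s1) => [x x1|x sx]; last first.
    by have [_ _ _ ->] := tw; rewrite // !subrr mulr0 oppr0.
  apply: cvgN; apply: cvgM; apply: cvgB.
  - exact: (twist_comp_continuous s1 tw cpsi).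
  - exact: cpsi.
  - by apply: (twist_comp_continuous s1 tw) => // y _; exact: cg.
  - exact: cg.
exists T, Ti; split=> //.
- move=> x; have [->|[h1 h2]] := inbox x; [by left|right].
  by split; [exact: le_trans (ltW h1) le1|exact: le_trans (ltW h2) le2].
- move=> x; have [->|[h1 h2]] := inbox x.
    by rewrite subrr normr0 mulr_ge0 ?(ltW e0) // addr_ge0.
  have [u [v [-> u2 v2]]] := unscale x (ltW h1) (ltW h2).
  have := step g b1 b2 r2 u v H2 er2 u2 v2; have := YB u v.
  move: (t1 * b1 * _ + _) => Y YB' S.
  rewrite -(subrK (e * Y) (_ - _)); apply: le_trans (ler_normD _ _) _.
  rewrite addrC mulrDl normrM (gtr0_norm e0) mulrC lerD ?ler_pM2r //.
  by apply: le_trans S _; rewrite ler_pM2r // ler_piMr.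
pose F x := - ((psi (T x) - psi x) * (g (T x) - g x)).
have FE u v : `|u| <= 2 -> `|v| <= 2 ->
    e ^+ 2 * gain_form a1 a2 b1 b2 t1 t2 u v - e ^+ 2 * th <=
    F (q.1 + t1 * e * u, q.2 + t2 * e * v).
  move=> u2 v2; have := step psi a1 a2 r1 u v H1 er1 u2 v2.
  have := step g b1 b2 r2 u v H2 er2 u2 v2; rewrite /F.
  set dg' := g _ - g _; set dpsi' := psi _ - psi _ => E1 E2.
  have dl01 : 0 <= dl <= 1 by rewrite (ltW dl0) dl1.
  apply: le_trans (product_error (ltW e0) (XB u v) (YB u v) E2 E1 dl01 dlth) _.
  by rewrite le_eqVlt; apply/orP; left; apply/eqP; congr (- _); congr (_ * _); ring.
have Q0 : 0 <= 2 * th * e ^+ 2 by rewrite mulr_ge0 ?sqr_ge0 // mulr_ge0 // ltW.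
have e2 : 0 < e ^+ 2 by rewrite exprn_gt0.
have boxE (x : plane) : box (q.1 - 2 * (t1 * e)) (q.1 + 2 * (t1 * e)) (q.2 - 2 * (t2 * e))
    (q.2 + 2 * (t2 * e)) x <-> `|x.1 - q.1| <= 2 * (t1 * e) /\ `|x.2 - q.2| <= 2 * (t2 * e).
  by rewrite /box /= !in_itv /= !centered_itv.
have H := @I_box_mixed R F (q.1 - 2 * (t1 * e)) (q.1 + 2 * (t1 * e)) (q.2 - 2 * (t2 * e))
  (q.2 + 2 * (t2 * e)) (q.1 + t1 * e * a) (q.1 + t1 * e * b) (q.2 + t2 * e * c)
  (q.2 + t2 * e * d) (2 * th * e ^+ 2) ((k - th) * e ^+ 2).
apply: le_trans (H _ _ _ _ bmsF Q0 _ _ _ _ _).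
(* In units of [th], the good box yields at least [49 - 16], and the lower bound [- 2 th] over the
   rescaled square of area 16 costs 32; the remaining 1 explains the constant [t1 * t2 * th]. *)
- set al := (b - a) * (d - c) in al0 al16 F4 *.
  have -> : (k - th) * e ^+ 2 * ((q.1 + t1 * e * b - (q.1 + t1 * e * a)) *
      (q.2 + t2 * e * d - (q.2 + t2 * e * c))) -
      2 * th * e ^+ 2 * ((q.1 + 2 * (t1 * e) - (q.1 - 2 * (t1 * e))) *
      (q.2 + 2 * (t2 * e) - (q.2 - 2 * (t2 * e)))) =
      t1 * t2 * e ^+ 4 * ((k - th) * al - 32 * th) by rewrite /al; ring.
  rewrite [_ * th * _]mulrAC ler_pM2l ?mulr_gt0 ?exprn_gt0 //.
  have : th * al <= th * 16 by rewrite ler_pM2l.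
  rewrite mulrBl; move: F4; clear; move: (k * al) (th * al) => x y; lra.
- exact: centered_le (ltW e10).
- exact: centered_le (ltW e20).
- by rewrite lerD2l ler_pM2l // ltW.
- by rewrite lerD2l ler_pM2l // ltW.
- move=> x /boxE[h1 h2]; apply: disk_sq; apply: ltW; exact: lt_trans (small _ h1 h2) s1.
- move=> x [/=]; rewrite !in_itv /= => /(itv_unscale e10) h1 /(itv_unscale e20) h2.
  have [] := F2 ((x.1 - q.1) / (t1 * e), (x.2 - q.2) / (t2 * e)).
    by split; rewrite /= in_itv.
  rewrite /= !normrM !normfV (gtr0_norm e10) (gtr0_norm e20) !ler_pdivrMr // => ? ?.
  exact/boxE.
- move=> x nB; rewrite /F; have [->|[h1 h2]] := inbox x; first by rewrite !subrr mulr0 oppr0.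
  by case: nB; apply/boxE; split; exact: ltW.
- move=> x /boxE[h1 h2]; have [u [v [-> u2 v2]]] := unscale x h1 h2.
  apply: le_trans (FE u v u2 v2).
  have : e ^+ 2 * - th <= e ^+ 2 * gain_form a1 a2 b1 b2 t1 t2 u v by rewrite ler_pM2l.
  by clear; move: (gain_form _ _ _ _ _ _ _ _) (e ^+ 2) => G z; lra.
- move=> x Bx; have {Bx}[h1 h2] : a <= (x.1 - q.1) / (t1 * e) <= b /\ c <= (x.2 - q.2) / (t2 * e) <= d.
    by move: Bx => [/=]; rewrite !in_itv /= => /(itv_unscale e10) ? /(itv_unscale e20).
  have Bu : box a b c d ((x.1 - q.1) / (t1 * e), (x.2 - q.2) / (t2 * e)).
    by split; rewrite /= in_itv.
  have [u2 v2] := F2 _ Bu; have G := F3 _ Bu.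
  rewrite (rescale q x e10 e20); apply: le_trans (FE _ _ u2 v2).
  move: G; rewrite /=; move: (gain_form _ _ _ _ _ _ _ _) => G kG.
  by rewrite -mulrBr mulrC ler_pM2l // lerD2r.
Qed.

End commutator_gain.

(** * From the old stream function to the new one *)

Section improving_twist.
Variable R : realType.
Local Notation plane := (R * R)%type.
Local Notation T1 := (measurableTypeR R).
Local Notation T2 := (T1 * T1)%type.
Local Notation mu := (@plane_measure R).
Implicit Types (s : R) (T Ti : plane -> plane) (g psi nu : plane -> R).

(** [g] is not assumed integrable on the plane, so it is cut to the closed disk, which [T]
    preserves, before the change of variables. *)
Lemma twist_integral0 s T Ti g : s < 1 -> twist s T Ti -> continuous g ->
  I (fun x => g (T x) - g x) = 0.
Proof.
move=> s1 tw cg; have [[TK TiK] [CT _] [[mT aT] _] out] := tw.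
pose G : plane -> R := (g : T2 -> R) \_ (cdisk 1).
have mD : measurable (cdisk 1 : set T2) by apply: closed_measurable_plane; exact: cdisk_closed.
have bG : bms G.
  split.
  - apply/(measurable_restrictT _ mD); apply: measurable_funS (continuous_measurable_plane cg) => //.
  - have [M M0 HM] := within_compact_bounded (@cdisk_compact R 1 ler01) (continuous_subspaceT cg).
    exists M => x; rewrite /G /patch; case: ifPn => [|_]; last by rewrite normr0.
    by rewrite inE => /HM.
  - move=> x /not_sq x1; rewrite /G /patch ifF //; apply/negbTE.
    by rewrite notin_setE /cdisk /=; apply/negP; rewrite -ltNge.
have GTE x : G (T x) - G x = g (T x) - g x.
  have [x1|x1] := leP (nsq x) 1.
    rewrite /G /patch !ifT ?inE //.
    by have := @twist_disk R s T Ti x s1 tw; rewrite closure_unit_diskE; exact.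
  by rewrite out ?subrr //; exact: lt_trans x1.
have bGT : bms (G \o T).
  have [mG [M GM] G0] := bG; split.
  - exact: (measurableT_comp mG mT).
  - by exists M => x; exact: GM.
  - move=> x nx; rewrite /= out ?G0 //; have := not_sq nx; exact: lt_trans.
have -> : (fun x => g (T x) - g x) = fun x => (G \o T) x - G x.
  by apply/funext => x; rewrite /= GTE.
by rewrite (IB bGT bG) I_area_preserving // subrr.
Qed.

(* Changing variables by [T] in the integral involving [Ti] cancels the first order
   contributions of [T] and [Ti]. *)
Lemma twist_gain_split s T Ti g psi : s < 1 -> twist s T Ti -> continuous g ->
  (forall x, nsq x < 1 -> {for x, continuous psi}) ->
  I (fun x => - ((psi (T x) - psi x) * (g (T x) - g x))) =
  I (fun x => psi x * (g (T x) - g x)) + I (fun x => psi x * (g (Ti x) - g x)).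
Proof.
move=> s1 tw cg cpsi; have tw' := twist_sym tw.
have [[TK TiK] _ [aT _] out] := tw; have [_ _ _ out'] := tw'.
have cgT x : nsq x < 1 -> {for x, continuous (fun y => g (T y))}.
  by apply: (twist_comp_continuous s1 tw) => // y _; exact: cg.
have cgTi x : nsq x < 1 -> {for x, continuous (fun y => g (Ti y))}.
  by apply: (twist_comp_continuous s1 tw') => // y _; exact: cg.
have cpT := twist_comp_continuous s1 tw cpsi.
have b1 : bms (fun x => psi x * (g (T x) - g x)).
  apply: (extend0_bms s1) => [x x1|x sx]; last by rewrite out // subrr mulr0.
  by apply: cvgM; [exact: cpsi|apply: cvgB; [exact: cgT|exact: cg]].
have b2 : bms (fun x => psi x * (g (Ti x) - g x)).
  apply: (extend0_bms s1) => [x x1|x sx]; last by rewrite out' // subrr mulr0.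
  by apply: cvgM; [exact: cpsi|apply: cvgB; [exact: cgTi|exact: cg]].
have b3 : bms ((fun x => psi x * (g (Ti x) - g x)) \o T).
  apply: (extend0_bms s1) => [x x1|x sx] /=; last by rewrite TK out // subrr mulr0.
  apply: (twist_comp_continuous s1 tw) => // y y1.
  by apply: cvgM; [exact: cpsi|apply: cvgB; [exact: cgTi|exact: cg]].
have -> : (fun x => - ((psi (T x) - psi x) * (g (T x) - g x))) =
    fun x => psi x * (g (T x) - g x) + ((fun x => psi x * (g (Ti x) - g x)) \o T) x.
  by apply/funext => x; rewrite /= TK; ring.
by rewrite (ID b1 b3) I_area_preserving.
Qed.

(** The error is a product of three bounds: [C] for the difference of stream functions, [L e] for
    the change of vorticity and the area of the box where it lives. *)
Lemma gain_transfer s T Ti g psi nu (q : plane) (K L C e gam : R) :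
  s < 1 -> twist s T Ti -> continuous g -> 0 <= K -> 0 <= e -> 0 <= L -> 0 <= C ->
  (forall x, nsq x < 1 -> {for x, continuous psi}) ->
  (forall x, nsq x < 1 -> {for x, continuous nu}) ->
  (forall x, nsq x <= 1 -> `|nu x - psi x| <= C) ->
  (forall x, `|g (T x) - g x| <= L * e) ->
  (forall x, T x = x \/ `|x.1 - q.1| <= K * e /\ `|x.2 - q.2| <= K * e) ->
  gam <= I (fun x => psi x * (g (T x) - g x)) ->
  gam - C * (L * e) * (2 * (K * e)) ^+ 2 <= I (fun x => nu x * (g (T x) - g x)).
Proof.
move=> s1 tw cg K0 e0 L0 C0 cpsi cnu unu gL TK gam0; have [_ _ _ out] := tw.
have cgT x : nsq x < 1 -> {for x, continuous (fun y => g (T y))}.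
  by apply: (twist_comp_continuous s1 tw) => // y _; exact: cg.
have b1 : bms (fun x => psi x * (g (T x) - g x)).
  apply: (extend0_bms s1) => [x x1|x sx]; last by rewrite out // subrr mulr0.
  by apply: cvgM; [exact: cpsi|apply: cvgB; [exact: cgT|exact: cg]].
have b2 : bms (fun x => (nu x - psi x) * (g (T x) - g x)).
  apply: (extend0_bms s1) => [x x1|x sx]; last by rewrite out // subrr mulr0.
  apply: cvgM; first by apply: cvgB; [exact: cnu|exact: cpsi].
  by apply: cvgB; [exact: cgT|exact: cg].
have -> : (fun x => nu x * (g (T x) - g x)) =
   fun x => psi x * (g (T x) - g x) + (nu x - psi x) * (g (T x) - g x).
  by apply/funext => x; ring.
have Ke0 : 0 <= K * e := mulr_ge0 K0 e0.
have lez (z : R) : z - K * e <= z + K * e by lra.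
have := @I_box_upper R (fun x => (nu x - psi x) * (g (T x) - g x)) (q.1 - K * e) (q.1 + K * e)
  (q.2 - K * e) (q.2 + K * e) (C * (L * e)) (lez _) (lez _) b2.
have -> : (q.1 + K * e - (q.1 - K * e)) * (q.2 + K * e - (q.2 - K * e)) = (2 * (K * e)) ^+ 2 by ring.
rewrite (ID b1 b2) => H; have {H} : `|I (fun x => (nu x - psi x) * (g (T x) - g x))| <=
    C * (L * e) * (2 * (K * e)) ^+ 2.
  apply: H => [x nB|x _].
    case: (TK x) => [->|[h1 h2]]; first by rewrite subrr mulr0.
    by case: nB; split; rewrite /= in_itv /= centered_itv.
  have [x1|x1] := leP (nsq x) 1; first by rewrite normrM; apply: ler_pM => //; exact: unu.
  by rewrite out ?(lt_trans s1) // subrr mulr0 normr0 !mulr_ge0.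
by rewrite ler_norml => /andP[]; move: gam0; clear; move: (I _) (I _) => *; lra.
Qed.

Lemma scale_choice (e0 c D : R) : 0 < e0 -> 0 < c -> 0 <= D ->
  exists e, [/\ 0 < e < e0, e <= 1 & D * e ^+ 5 < c * e ^+ 4 / 2].
Proof.
move=> e00 c0 D0; have D1 : 0 < 2 * (D + 1) by lra.
pose e := Num.min 1 (Num.min (e0 / 2) (c / (2 * (D + 1)))).
have e_gt0 : 0 < e by rewrite !lt_min ltr01 !divr_gt0.
have [h1 h2 h3] : [/\ e <= 1, e <= e0 / 2 & e <= c / (2 * (D + 1))].
  by rewrite /e !ge_min !lexx !orbT.
exists e; split=> //; first by rewrite e_gt0 /=; lra.
move: h3; rewrite ler_pdivlMr // => h3.
have -> : D * e ^+ 5 = e ^+ 4 * (e * D) by ring.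
have -> : c * e ^+ 4 / 2 = e ^+ 4 * (c / 2) by field.
by rewrite ltr_pM2l ?exprn_gt0 //; lra.
Qed.

Theorem improving_twist g psi (q : plane) : Cinf g ->
  dirichlet_solution (unit_disk R) g psi -> nsq q < 1 ->
  partial1 psi q * partial1 g q < 0 \/ partial2 psi q * partial2 g q < 0 ->
  exists s T Ti, [/\ s < 1, twist s T Ti, I (fun x => g (T x) - g x) = 0 &
    forall nu, dirichlet_solution (unit_disk R) (fun x => g (T x)) nu ->
      0 < I (fun x => nu x * (g (T x) - g x))].
Proof.
move=> Cg sol q1 neg.
have cg := @Cinf_continuous R g Cg.
have [C2psi _ _ _] := sol.
have [dpsi Epsi] := C1_differential (@open_disk R 1) q1 (CkW C2psi).
have [dg Eg] := C1_differential (@openT plane) Logic.I (Cg 1%N : Ck 1 setT g) (x := q).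
have jp := dirichlet_disk_jet sol; move: jp neg Epsi Eg.
move: (partial1 (partial1 psi)) (partial2 (partial2 psi)) => p11 p22.
move: (partial1 psi) (partial2 psi) (partial1 g) (partial2 g) => p1 p2 g1 g2.
move=> jp neg Epsi Eg; have [_ _ Cp _ _] := jp.
have cpsi x : nsq x < 1 -> {for x, continuous psi} by move=> /Cp[].
have [s [K [L [c [e0 [[s1 K0 L0 c0 e00] H]]]]]] :=
  commutator_gain q1 cpsi cg dpsi Epsi dg Eg neg.
pose C := 3 * L * (2 * K + 1).
have C0 : 0 <= C by rewrite !mulr_ge0 // addr_ge0 // mulr_ge0 // ltW.
have D0 := mulr_ge0 (mulr_ge0 (mulr_ge0 (ler0n R 4) C0) L0) (sqr_ge0 K).
have [e [ee0 e1 De]] := scale_choice e00 c0 D0.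
have /andP[e_gt0 _] := ee0.
have [T [Ti [tw TK gL gain]]] := H e ee0.
have tw' := twist_sym tw; have [[TTi TiT] _ _ _] := tw.
have TiK x : Ti x = x \/ `|x.1 - q.1| <= K * e /\ `|x.2 - q.2| <= K * e.
  by case: (TK x) => [E|]; [left; rewrite -{1}E TTi|right].
have gLi x : `|g (Ti x) - g x| <= L * e by rewrite distrC -{1}(TiT x).
(* Stated for either orientation, since [T] and [Ti] obey the same bounds and it is not known in
   advance which of them has at least half of the gain. *)
have win T' Ti' : twist s T' Ti' -> (forall x, `|g (T' x) - g x| <= L * e) ->
    (forall x, T' x = x \/ `|x.1 - q.1| <= K * e /\ `|x.2 - q.2| <= K * e) ->
    c * e ^+ 4 / 2 <= I (fun x => psi x * (g (T' x) - g x)) ->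
    exists s T Ti, [/\ s < 1, twist s T Ti, I (fun x => g (T x) - g x) = 0 &
      forall nu, dirichlet_solution (unit_disk R) (fun x => g (T x)) nu ->
        0 < I (fun x => nu x * (g (T x) - g x))].
  move=> twT gT TT gamT; exists s, T', Ti'; split=> //; first exact: (twist_integral0 s1 twT).
  move=> nu /dirichlet_disk_jet jn; have [_ _ Cn _ _] := jn.
  have cnu x : nsq x < 1 -> {for x, continuous nu} by move=> /Cn[].
  have unu := solution_difference e_gt0 e1 q1 (ltW K0) L0 jp jn (fun x _ => gT x).
  apply: lt_le_trans (gain_transfer s1 twT cg (ltW K0) (ltW e_gt0) L0 _ cpsi cnu
    (unu _) gT TT gamT).
  - have -> : 3 * L * (2 * K + 1) * e ^+ 2 * (L * e) * (2 * (K * e)) ^+ 2 =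
        4 * C * L * K ^+ 2 * e ^+ 5 by rewrite /C; ring.
    by rewrite subr_gt0.
  - exact: (mulr_ge0 C0 (sqr_ge0 e)).
  - by move=> x _; case: (TT x) => [->|]; [left; rewrite subrr|right].
move: gain; rewrite (twist_gain_split s1 tw cg cpsi) => gain.
have [h|h] := leP (c * e ^+ 4 / 2) (I (fun x => psi x * (g (T x) - g x))).
  exact: (win T Ti).
apply: (win Ti T) => //; move: gain h; clear; move: (I _) (I _) (c * _) => u v w; lra.
Qed.

End improving_twist.

(** * Points where the energy can be lowered *)

Section descent_point.
Variable R : realType.
Local Notation plane := (R * R)%type.

Lemma chain_rule (U : set plane) (F g1 g2 : plane -> R) (x v : plane) (d1 d2 : R) :
  open U -> U (g1 x, g2 x) -> Ck 1 U F -> is_derive x v g1 d1 -> is_derive x v g2 d2 ->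
  is_derive x v (fun y => F (g1 y, g2 y))
    (partial1 F (g1 x, g2 x) * d1 + partial2 F (g1 x, g2 x) * d2).
Proof.
move=> oU Ux CF /is_deriveP[D1 E1] /is_deriveP[D2 E2].
by have := is_derive_comp2 oU Ux CF D1 D2; rewrite E1 E2.
Qed.

Lemma derivative_nonpositive (phi : R -> R) (d r : R) : 0 < r ->
  is_derive (0 : R) 1 phi d -> (forall t : R, `|t| < r -> t * phi t <= 0) ->
  phi 0 = 0 /\ d <= 0.
Proof.
move=> r0 /is_deriveP[D E] H.
have cphi : {for 0, continuous phi}.
  by move: (D) => /derivable1_diffP /differentiable_continuous.
have phi0 : phi 0 = 0.
  apply/eqP; rewrite -normr_le0 leNgt; apply/negP => n0.
  have /cvgrPdist_lt /(_ _ n0) /nbhs_ballP[r' /= r'0 Hr] := cphi.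
  pose t := Num.min r r' / 2.
  have m0 : 0 < Num.min r r' by rewrite lt_min r0 r'0.
  have t0 : 0 < t by rewrite divr_gt0.
  have [tr tr'] : t < r /\ t < r'.
    have : t < Num.min r r' by rewrite /t ltr_pdivrMr // ltr_pMr // ltr1n.
    by rewrite lt_min => /andP[].
  have p1 : `|phi 0 - phi t| < `|phi 0|.
    by apply: Hr; rewrite -ball_normE /= sub0r normrN gtr0_norm.
  have p2 : `|phi 0 - phi (- t)| < `|phi 0|.
    by apply: Hr; rewrite -ball_normE /= sub0r opprK gtr0_norm.
  have h1 := H t; rewrite gtr0_norm // in h1; have {}h1 := h1 tr.
  have h2 := H (- t); rewrite normrN gtr0_norm // in h2; have {}h2 := h2 tr.
  have k1 : phi t <= 0 by rewrite -(pmulr_rle0 _ t0).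
  have k2 : 0 <= phi (- t) by move: h2; rewrite mulNr oppr_le0 pmulr_rge0.
  have [z0|z0] := leP 0 (phi 0).
    by move: p1; rewrite (ger0_norm z0) ltr_norml => /andP[? ?]; lra.
  by move: p2; rewrite (ltr0_norm z0) ltr_norml => /andP[? ?]; lra.
split=> //; rewrite -E.
apply: limr_le; first exact: D.
apply/nbhs_ballP; exists r => // h; rewrite -ball_normE /= sub0r normrN => hr h0.
rewrite phi0 subr0 addr0 [h *: (1 : R)]mulr1 [_ *: _]mulrC.
have hh : 0 < h ^+ 2 by rewrite exprn_even_gt0.
rewrite -(pmulr_rle0 _ hh).
have -> : h ^+ 2 * (phi h * h^-1) = h * phi h by field.
exact: H.
Qed.

Lemma jacobian_inverse (G1 G2 Z1 Z2 : plane -> R) (U : set plane) (x : plane) :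
  Cinf G1 -> Cinf G2 -> Cinf Z1 -> Cinf Z2 -> open U -> U x ->
  (forall y, U y -> (G1 (Z1 y, Z2 y), G2 (Z1 y, Z2 y)) = y) ->
  let z := (Z1 x, Z2 x) in
  [/\ partial1 G1 z * partial1 Z1 x + partial2 G1 z * partial1 Z2 x = 1,
    partial1 G1 z * partial2 Z1 x + partial2 G1 z * partial2 Z2 x = 0,
    partial1 G2 z * partial1 Z1 x + partial2 G2 z * partial1 Z2 x = 0 &
    partial1 G2 z * partial2 Z1 x + partial2 G2 z * partial2 Z2 x = 1].
Proof.
move=> CG1 CG2 CZ1 CZ2 oU Ux GZ z.
have main (G h : plane -> R) (v : plane) (z1 z2 c : R) : Cinf G ->
    (forall y, U y -> G (Z1 y, Z2 y) = h y) ->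
    is_derive x v Z1 z1 -> is_derive x v Z2 z2 -> is_derive x v h c ->
    partial1 G z * z1 + partial2 G z * z2 = c.
  move=> CG Gh D1 D2 Dh.
  have := chain_rule (@openT plane) Logic.I (CG 1%N) D1 D2.
  move=> /is_deriveP[_ <-].
  have /is_deriveP[_ <-] := @is_derive_near R U h (fun y => G (Z1 y, Z2 y)) x v c oU Ux
    (fun y Uy => esym (Gh y Uy)) Dh.
  by [].
have e1 y : U y -> G1 (Z1 y, Z2 y) = y.1 by move=> /GZ E; rewrite -[in RHS]E.
have e2 y : U y -> G2 (Z1 y, Z2 y) = y.2 by move=> /GZ E; rewrite -[in RHS]E.
have d11 := Cinf_isd1 x CZ1; have d12 := Cinf_isd2 x CZ1.
have d21 := Cinf_isd1 x CZ2; have d22 := Cinf_isd2 x CZ2.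
split.
- exact: (main _ _ _ _ _ _ CG1 e1 d11 d21 (isd1_fst x)).
- exact: (main _ _ _ _ _ _ CG1 e1 d12 d22 (isd2_fst x)).
- exact: (main _ _ _ _ _ _ CG2 e2 d11 d21 (isd1_snd x)).
- exact: (main _ _ _ _ _ _ CG2 e2 d12 d22 (isd2_snd x)).
Qed.

Lemma row_kernel_trivial (m11 m12 m21 m22 n11 n12 n21 n22 x y : R) :
  n11 * m11 + n12 * m21 = 1 -> n11 * m12 + n12 * m22 = 0 ->
  n21 * m11 + n22 * m21 = 0 -> n21 * m12 + n22 * m22 = 1 ->
  x * m11 + y * m21 = 0 -> x * m12 + y * m22 = 0 -> x = 0 /\ y = 0.
Proof.
move=> h1 h2 h3 h4 k1 k2.
have dd : (n11 * n22 - n12 * n21) * (m11 * m22 - m12 * m21) = 1.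
  transitivity ((n11 * m11 + n12 * m21) * (n21 * m12 + n22 * m22) -
    (n11 * m12 + n12 * m22) * (n21 * m11 + n22 * m21)); first by ring.
  by rewrite h1 h2 h4 mul0r subr0 mulr1.
have x0 : x * (m11 * m22 - m12 * m21) = 0.
  transitivity ((x * m11 + y * m21) * m22 - (x * m12 + y * m22) * m21); first by ring.
  by rewrite k1 k2 !mul0r subrr.
have y0 : y * (m11 * m22 - m12 * m21) = 0.
  transitivity ((x * m12 + y * m22) * m11 - (x * m11 + y * m21) * m12); first by ring.
  by rewrite k1 k2 !mul0r subrr.
split; first by rewrite -[x]mulr1 -dd mulrCA x0 mulr0.
by rewrite -[y]mulr1 -dd mulrCA y0 mulr0.
Qed.

End descent_point.

(** The vanishing of the transformed field forces the gradient [(u, v)] of [psi] to vanish, so the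
    terms [c1] to [c4] with second derivatives of the coordinates disappear. What remains is the
    trace of the Hessian of [psi] conjugated by the Jacobian, that is its Laplacian. *)
Lemma positive_divergence (R : realType)
    (p11 p12 p21 p22 u v g11 g12 g21 g22 z11 z12 z21 z22 c1 c2 c3 c4 : R) :
  z11 * u + z12 * v = 0 -> z21 * u + z22 * v = 0 ->
  c1 * u + z11 * (p11 * g11 + p12 * g21) +
    (c2 * v + z12 * (p21 * g11 + p22 * g21)) <= 0 ->
  c3 * u + z21 * (p11 * g12 + p12 * g22) +
    (c4 * v + z22 * (p21 * g12 + p22 * g22)) <= 0 ->
  g11 * z11 + g12 * z21 = 1 -> g11 * z12 + g12 * z22 = 0 ->
  g21 * z11 + g22 * z21 = 0 -> g21 * z12 + g22 * z22 = 1 ->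
  0 < p11 + p22 -> False.
Proof.
move=> A0 B0 dA dB J1 J2 J3 J4.
have u0 : u = 0.
  transitivity ((g11 * z11 + g12 * z21) * u + (g11 * z12 + g12 * z22) * v).
    by rewrite J1 J2 mul1r mul0r addr0.
  transitivity (g11 * (z11 * u + z12 * v) + g12 * (z21 * u + z22 * v)); first by ring.
  by rewrite A0 B0 !mulr0 addr0.
have v0 : v = 0.
  transitivity ((g21 * z11 + g22 * z21) * u + (g21 * z12 + g22 * z22) * v).
    by rewrite J3 J4 mul1r mul0r add0r.
  transitivity (g21 * (z11 * u + z12 * v) + g22 * (z21 * u + z22 * v)); first by ring.
  by rewrite A0 B0 !mulr0 addr0.
suff -> : p11 + p22 = (c1 * u + z11 * (p11 * g11 + p12 * g21) +
    (c2 * v + z12 * (p21 * g11 + p22 * g21))) + (c3 * u + z21 * (p11 * g12 + p12 * g22) +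
    (c4 * v + z22 * (p21 * g12 + p22 * g22))).
  by rewrite ltNge => /negP; apply; rewrite -(addr0 0) lerD.
rewrite u0 v0.
transitivity (p11 * (g11 * z11 + g12 * z21) + p12 * (g21 * z11 + g22 * z21) +
  p21 * (g11 * z12 + g12 * z22) + p22 * (g21 * z12 + g22 * z22)); last by ring.
by rewrite J1 J2 J3 J4; ring.
Qed.

(** * An interior point where the two gradients form an obtuse angle *)

Section gradients.
Variable R : realType.
Local Notation plane := (R * R)%type.
Variables G1 G2 Z1 Z2 : plane -> R.
Hypotheses (CG1 : Cinf G1) (CG2 : Cinf G2) (CZ1 : Cinf Z1) (CZ2 : Cinf Z2).
Hypothesis GD : forall y, nsq y <= 1 -> nsq (G1 y, G2 y) <= 1.
Hypothesis ZG : forall y, nsq y <= 1 -> (Z1 (G1 y, G2 y), Z2 (G1 y, G2 y)) = y.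
Hypothesis GZ : forall x, nsq x <= 1 -> (G1 (Z1 x, Z2 x), G2 (Z1 x, Z2 x)) = x.

Let p : plane := (G1 0, G2 0).

Let nsq0 : nsq (0 : plane) = 0. Proof. by rewrite /nsq /= expr0n /= addr0. Qed.

(** If the image of the centre were on the circle, the squared norm of [(G1, G2)] would be maximal
    at the centre; its gradient would vanish there, and invertibility of the Jacobian would force
    the image to be the origin. *)
Lemma image_center_interior : nsq p < 1.
Proof.
rewrite ltNge; apply/negP => p1.
pose F (y : plane) := G1 y ^+ 2 + G2 y ^+ 2.
have Fmax y : nsq y < 1 -> F y <= F 0.
  by move=> /ltW /GD y1; exact: le_trans y1 p1.
have nsqt (t : R) : t \in `]-1, 1[ -> nsq (t, 0 : R) < 1 /\ nsq (0 : R, t) < 1.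
  rewrite in_itv /= => /andP[t1 t2]; rewrite /nsq /= expr0n /= addr0 add0r.
  suff : t ^+ 2 < 1 by [].
  by rewrite -(real_normK (num_real t)) exprn_ilt1 // ltr_norml t1.
have in0 : (0 : R) \in `]-1, 1[ by rewrite in_itv /= ltrN10 ltr01.
have le11 : -1 <= 1 :> R by lra.
have zero_derive (f : R -> R) (df : R -> R) : (forall t : R, is_derive t 1 f (df t)) ->
    (forall t, t \in `]-1, 1[ -> f t <= f 0) -> df 0 = 0.
  move=> D fmax.
  have H := @derive1_at_max R f (-1) 1 0 le11 (fun t _ => (is_deriveP (D t)).1) in0 fmax.
  by have [_ <-] := is_deriveP (D 0); have [_ ->] := is_deriveP H.
have D1 (y : plane) : is_derive y (1, 0) F
    (2 * (G1 y * partial1 G1 y + G2 y * partial1 G2 y)).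
  have H1 := Cinf_isd1 y CG1; have H2 := Cinf_isd1 y CG2.
  by apply: (is_derive_eq (isdD (isdX 2 H1) (isdX 2 H2))); rewrite /= !expr1; ring.
have D2 (y : plane) : is_derive y (0, 1) F
    (2 * (G1 y * partial2 G1 y + G2 y * partial2 G2 y)).
  have H1 := Cinf_isd2 y CG1; have H2 := Cinf_isd2 y CG2.
  by apply: (is_derive_eq (isdD (isdX 2 H1) (isdX 2 H2))); rewrite /= !expr1; ring.
have E1 := zero_derive (fun t => F (t, 0)) _ (fun t => (is_derive_e1 F (t, 0) _).1 (D1 (t, 0)))
  (fun t ht => Fmax _ (nsqt t ht).1).
have E2 := zero_derive (fun t => F (0, t)) _ (fun t => (is_derive_e2 F (0, t) _).1 (D2 (0, t)))
  (fun t ht => Fmax _ (nsqt t ht).2).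
have z1 : nsq (0 : plane) < 1 by rewrite nsq0 ltr01.
have [J1 J2 J3 J4] := jacobian_inverse CZ1 CZ2 CG1 CG2 (@open_disk R 1) z1
  (fun y y1 => ZG (ltW y1)).
have half (u : R) : 2 * u = 0 -> u = 0 by move=> /eqP; rewrite mulf_eq0 pnatr_eq0 => /eqP.
have [k1 k2] := row_kernel_trivial J1 J2 J3 J4 (half _ E1) (half _ E2).
by move: p1; rewrite /nsq /p /= k1 k2 expr0n /= addr0 ler10.
Qed.

(* Otherwise, in the coordinates [y = Z x], the field [grad psi] satisfies
   [y . field <= 0], hence it vanishes at the origin and has nonpositive divergence
   there; but this divergence is the value 2 of the vorticity. *)
Lemma descent_point psi :
  dirichlet_solution (unit_disk R) (fun x => 2 - (Z1 x ^+ 2 + Z2 x ^+ 2)) psi ->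
  exists2 q, nsq q < 1 &
    partial1 psi q * partial1 (fun x => 2 - (Z1 x ^+ 2 + Z2 x ^+ 2)) q < 0 \/
    partial2 psi q * partial2 (fun x => 2 - (Z1 x ^+ 2 + Z2 x ^+ 2)) q < 0.
Proof.
move=> [[_ [_ _ Cp1 Cp2]] _ L _]; apply: contrapT => none.
have p1 := image_center_interior.
have E1 : partial1 (fun x => 2 - (Z1 x ^+ 2 + Z2 x ^+ 2)) =
    fun x => - (2 * (Z1 x * partial1 Z1 x + Z2 x * partial1 Z2 x)).
  apply: isd_partial1 => x; have H1 := Cinf_isd1 x CZ1; have H2 := Cinf_isd1 x CZ2.
  apply: (is_derive_eq (isdD (isdC x (1, 0) 2) (isdN (isdD (isdX 2 H1) (isdX 2 H2))))).
  by rewrite /= !expr1; ring.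
have E2 : partial2 (fun x => 2 - (Z1 x ^+ 2 + Z2 x ^+ 2)) =
    fun x => - (2 * (Z1 x * partial2 Z1 x + Z2 x * partial2 Z2 x)).
  apply: isd_partial2 => x; have H1 := Cinf_isd2 x CZ1; have H2 := Cinf_isd2 x CZ2.
  apply: (is_derive_eq (isdD (isdC x (0, 1) 2) (isdN (isdD (isdX 2 H1) (isdX 2 H2))))).
  by rewrite /= !expr1; ring.
rewrite E1 E2 in none.
pose A x := partial1 Z1 x * partial1 psi x + partial2 Z1 x * partial2 psi x.
pose B x := partial1 Z2 x * partial1 psi x + partial2 Z2 x * partial2 psi x.
(* [Z1 x * A x + Z2 x * B x] is minus one half of the scalar product of the gradients of the
   vorticity and of [psi]; if it is positive, one of the two coordinate products is negative. *)
have sgn x : nsq x < 1 -> Z1 x * A x + Z2 x * B x <= 0.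
  move=> x1; rewrite leNgt; apply/negP => pos; apply: none; exists x => //.
  move: pos; rewrite /A /B; clear.
  move: (partial1 psi x) (partial2 psi x) (partial1 Z1 x) (partial2 Z1 x).
  move: (partial1 Z2 x) (partial2 Z2 x) (Z1 x) (Z2 x) => c d z w u v a b H.
  case: (ltP (u * - (2 * (z * a + w * c))) 0) => h1; first by left.
  by right; nra.
have z1 : nsq (0 : plane) < 1 by rewrite nsq0 ltr01.
have [r r0 Hr] : exists2 r : R, 0 < r & forall t, `|t| < r ->
    [/\ nsq (t, 0 : R) < 1, nsq (0 : R, t) < 1, nsq (G1 (t, 0), G2 (t, 0)) < 1 &
      nsq (G1 (0, t), G2 (0, t)) < 1].
  have cN : continuous (fun y => nsq (G1 y, G2 y)).
    by apply: Cinf_continuous; apply: CinfD; apply: CinfX.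
  have /nbhs_ballP[r1 /= r10 H1] := open_nbhs_nbhs (conj (@open_disk R 1) z1).
  have /nbhs_ballP[r2 /= r20 H2] : nbhs (0 : plane) [set y | nsq (G1 y, G2 y) < 1].
    exact: (cN 0 _ (open_nbhs_nbhs (conj (@open_lt R 1) p1))).
  exists (Num.min r1 r2); first by rewrite lt_min r10.
  move=> t; rewrite lt_min => /andP[t1 t2].
  by split; [apply: H1|apply: H1|apply: H2|apply: H2]; apply/in_ball_plane;
    rewrite /= !sub0r !normrN normr0.
have CU := @open_disk R 1.
have D1 := chain_rule CU p1 Cp1 (Cinf_isd1 0 CG1) (Cinf_isd1 0 CG2).
have D2 := chain_rule CU p1 Cp2 (Cinf_isd1 0 CG1) (Cinf_isd1 0 CG2).
have D3 := chain_rule CU p1 Cp1 (Cinf_isd2 0 CG1) (Cinf_isd2 0 CG2).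
have D4 := chain_rule CU p1 Cp2 (Cinf_isd2 0 CG1) (Cinf_isd2 0 CG2).
have cr1 (F : plane -> R) (CF : Cinf F) :=
  chain_rule (@openT plane) Logic.I (CF 1%N) (Cinf_isd1 0 CG1) (Cinf_isd1 0 CG2).
have cr2 (F : plane -> R) (CF : Cinf F) :=
  chain_rule (@openT plane) Logic.I (CF 1%N) (Cinf_isd2 0 CG1) (Cinf_isd2 0 CG2).
have DA := isdD (isdM (cr1 _ (Cinf_partial1 CZ1)) D1) (isdM (cr1 _ (Cinf_partial2 CZ1)) D2).
have DB := isdD (isdM (cr2 _ (Cinf_partial1 CZ2)) D3) (isdM (cr2 _ (Cinf_partial2 CZ2)) D4).
(* On the image of the first coordinate axis [Z2] vanishes and [Z1] is [t], so only one term of the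
   sign condition remains. *)
have sA t : `|t| < r -> t * A (G1 (t, 0), G2 (t, 0)) <= 0.
  move=> /Hr[h1 _ h3 _]; have := sgn _ h3; have [-> ->] := ZG (ltW h1).
  by rewrite mul0r addr0.
have sB t : `|t| < r -> t * B (G1 (0, t), G2 (0, t)) <= 0.
  move=> /Hr[_ h2 _ h4]; have := sgn _ h4; have [-> ->] := ZG (ltW h2).
  by rewrite mul0r add0r.
have [A0 dA] := derivative_nonpositive r0 ((is_derive_e1 _ 0 _).1 DA) sA.
have [B0 dB] := derivative_nonpositive r0 ((is_derive_e2 _ 0 _).1 DB) sB.
have Zp : (Z1 p, Z2 p) = 0 by apply: ZG; rewrite nsq0.
have [J1 J2 J3 J4] := jacobian_inverse CG1 CG2 CZ1 CZ2 CU p1 (fun x x1 => GZ (ltW x1)).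
have Lp := L p p1; move: Zp (Zp) => -[Zp1 Zp2] Zp.
rewrite Zp in J1 J2 J3 J4; rewrite Zp1 Zp2 /laplacian /= in Lp.
apply: (positive_divergence A0 B0 dA dB J1 J2 J3 J4).
by rewrite Lp expr0n /= !addr0 subr0 ltr0n.
Qed.

End gradients.

(** * The paraboloid and its orbit *)

Section no_minimizer.
Variable R : realType.
Local Notation plane := (R * R)%type.
Local Notation D := (closure (unit_disk R)).

(** The constant 2 keeps the vorticity between 1 and 2 on the disk and throughout the orbit: the
    lower bound makes stream functions negative inside, as the cutoff argument requires, and gives a
    positive boundary value. *)
Definition paraboloid (x : plane) : R := 2 - nsq x.

Lemma Cinf_paraboloid : Cinf paraboloid.
Proof. by apply: CinfB; [exact: Cinf_cst|exact: Cinf_nsq]. Qed.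

Lemma mem_closed_disk (x : plane) : D x <-> nsq x <= 1.
Proof. by rewrite closure_unit_diskE. Qed.

Lemma zero_on_closure (f : plane -> R) : continuous f ->
  (forall x, nsq x < 1 -> f x = 0) -> forall x, D x -> f x = 0.
Proof.
move=> cf f0 x Dx.
have cl : closed [set y | f y = 0].
  by have := closed_comp (fun y _ => cf y) (@closed_eq R 0); rewrite /preimage /=; exact.
by have := closure_subset (f0 : unit_disk R `<=` [set y | f y = 0]) Dx; rewrite -(closure_id _).1.
Qed.

Lemma critical_point_paraboloid (x : plane) :
  critical_point (unit_disk R) paraboloid x <-> x = 0.
Proof.
have d1 (y : plane) : is_derive y (1, 0) paraboloid (- (2 * y.1)).
  by rewrite /paraboloid /nsq; isd; rewrite /=; ring.
have d2 (y : plane) : is_derive y (0, 1) paraboloid (- (2 * y.2)).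
  by rewrite /paraboloid /nsq; isd; rewrite /=; ring.
split=> [[Dx [g [[Cg gE] g1 g2]]]|->]; last first.
  split; first by apply/mem_closed_disk; rewrite /nsq /= expr0n /= addr0 ler01.
  exists paraboloid; split; first by split; [exact: Cinf_paraboloid|].
    by rewrite (isd_partial1 d1) /= mulr0 oppr0.
  by rewrite (isd_partial2 d2) /= mulr0 oppr0.
have gU y : nsq y < 1 -> paraboloid y = g y by move=> /ltW /mem_closed_disk /gE.
have Z1 : partial1 g x + 2 * x.1 = 0.
  apply: (@zero_on_closure (fun y => partial1 g y + 2 * y.1)) => // [|y y1].
    apply: Cinf_continuous; apply: CinfD; first exact: Cinf_partial1.
    by apply: CinfZ; exact: Cinf_fst.
  have := is_derive_near (@open_disk R 1) y1 gU (d1 y) => /is_deriveP[_ E].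
  by rewrite [partial1 g y]E addNr.
have Z2 : partial2 g x + 2 * x.2 = 0.
  apply: (@zero_on_closure (fun y => partial2 g y + 2 * y.2)) => // [|y y1].
    apply: Cinf_continuous; apply: CinfD; first exact: Cinf_partial2.
    by apply: CinfZ; exact: Cinf_snd.
  have := is_derive_near (@open_disk R 1) y1 gU (d2 y) => /is_deriveP[_ E].
  by rewrite [partial2 g y]E addNr.
rewrite g1 add0r in Z1; rewrite g2 add0r in Z2.
have half (u : R) : 2 * u = 0 -> u = 0 by move=> /eqP; rewrite mulf_eq0 pnatr_eq0 => /eqP.
by move: (half _ Z1) (half _ Z2); case: (x) => a c /= -> ->.
Qed.

Lemma dirichlet_solution_eq (w w' psi : plane -> R) : (forall x, D x -> w x = w' x) ->
  dirichlet_solution (unit_disk R) w psi -> dirichlet_solution (unit_disk R) w' psi.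
Proof.
move=> ww' [h1 h2 h3 h4]; split=> // x x1; rewrite h3 // ww' //.
by apply/mem_closed_disk; exact: ltW.
Qed.

(** Existence excludes the default value of [inv_laplacian]. An element of the orbit is controlled
    only on the closed disk, so it is replaced by a function [g] smooth on the whole plane. *)
Lemma inv_laplacian_solution (w g : plane -> R) : Cinf g -> (forall x, D x -> w x = g x) ->
  dirichlet_solution (unit_disk R) g (inv_laplacian (unit_disk R) w).
Proof.
move=> Cg wg; apply: (dirichlet_solution_eq wg); rewrite /inv_laplacian.
have [psi sol] := dirichlet_existence Cg.
apply: (@xgetPex _ (cst 0) [set psi | dirichlet_solution (unit_disk R) w psi]).
by exists psi; apply: dirichlet_solution_eq sol => x /wg.
Qed.

Lemma paraboloid_no_minimizer (omega : plane -> R) :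
  ~ smooth_energy_minimizer (unit_disk R) paraboloid omega.
Proof.
move=> [_ orb mini]; have [eta [[[hom inj sur] [[G1 [CG1 G1E]] [G2 [CG2 G2E]]]
  [[Z1 [CZ1 Z1E]] [Z2 [CZ2 Z2E]]]] vol] omE] := orb.
have beta : set_bij D D eta by [].
have [zhom _ _] := bijpinv_bij (fun=> point) beta.
have GE y : D y -> (G1 y, G2 y) = eta y by move=> Dy; rewrite G1E // G2E //=; case: (eta y).
have ZE y : D y -> (Z1 y, Z2 y) = pinv D eta y.
  by move=> Dy; rewrite Z1E // Z2E //=; case: (pinv D eta y).
have GD y : nsq y <= 1 -> nsq (G1 y, G2 y) <= 1.
  by move=> /mem_closed_disk Dy; apply/mem_closed_disk; rewrite GE //; exact: hom.
have ZD y : nsq y <= 1 -> nsq (Z1 y, Z2 y) <= 1.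
  by move=> /mem_closed_disk Dy; apply/mem_closed_disk; rewrite ZE //; exact: zhom.
have ZG y : nsq y <= 1 -> (Z1 (G1 y, G2 y), Z2 (G1 y, G2 y)) = y.
  move=> y1; have Dy := (mem_closed_disk y).2 y1; rewrite ZE; last by apply/mem_closed_disk; exact: GD.
  by rewrite GE // pinvKV // inE.
have GZ y : nsq y <= 1 -> (G1 (Z1 y, Z2 y), G2 (Z1 y, Z2 y)) = y.
  move=> y1; have Dy := (mem_closed_disk y).2 y1; rewrite GE; last by apply/mem_closed_disk; exact: ZD.
  by rewrite ZE // (surjpK _ sur) // inE.
pose g x := 2 - (Z1 x ^+ 2 + Z2 x ^+ 2).
have Cg : Cinf g by apply: CinfB; [exact: Cinf_cst|apply: CinfD; exact: CinfX].
have omg x : D x -> omega x = g x by move=> Dx; rewrite omE //= -ZE.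
have solpsi := inv_laplacian_solution Cg omg.
have [q q1 neg] := descent_point CG1 CG2 CZ1 CZ2 GD ZG GZ solpsi.
have [s [T [Ti [s1 tw Iw Inu]]]] := improving_twist Cg solpsi q1 neg.
(* Acting by the inverse twist puts [omega \o T] into the orbit. *)
have orb' := coadjoint_orbit_twist s1 (twist_sym tw) orb.
have [_ [CT _] _ out] := tw.
have TD x : D x -> D (T x) := @twist_disk R s T Ti x s1 tw.
have omT x : D x -> (omega \o T) x = g (T x) by move=> /TD /omg.
have solnu := inv_laplacian_solution (Cinf_map_comp Cg CT) omT.
have b12 x : nsq x < 1 -> 1 <= g (T x) <= 2.
  move=> /ltW /mem_closed_disk /TD /mem_closed_disk /ZD; rewrite /g /nsq /= => h.
  have := addr_ge0 (sqr_ge0 (Z1 (T x))) (sqr_ge0 (Z2 (T x))).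
  by move: h; move: (_ + _) => u *; apply/andP; split; lra.
have cg := @Cinf_continuous R g Cg.
have cgT := @Cinf_continuous R _ (Cinf_map_comp Cg CT).
have wE x : s < nsq x -> g (T x) = g x by move=> /out ->.
have := dirichlet_integral_decreases ltr01 cg cgT b12 s1 wE Iw (Inu _ solnu) solpsi solnu.
rewrite ltNge => /negP; apply.
by have := mini _ orb'; rewrite /energy lee_pmul2l.
Qed.

End no_minimizer.

Theorem theoremA1 (R : realType) :
  exists omega0 : R * R -> R,
    [/\ smooth (unit_disk R) omega0,
        (forall x, closure (unit_disk R) x -> 0 <= omega0 x),
        (exists! p, critical_point (unit_disk R) omega0 p),
        (exists2 c : R, 0 < c &
           forall x, (closure (unit_disk R) `\` unit_disk R) x -> omega0 x = c)
      & ~ exists omega, smooth_energy_minimizer (unit_disk R) omega0 omega].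
Proof.
exists (@paraboloid R); split.
- by exists (@paraboloid R); split; [exact: Cinf_paraboloid|].
- by move=> x /mem_closed_disk x1; rewrite /paraboloid; lra.
- exists 0; split; first exact/critical_point_paraboloid.
  by move=> x /critical_point_paraboloid.
- exists 1 => // x /boundary_unit_diskE x1.
  by rewrite /paraboloid x1; lra.
- by move=> [omega]; exact: paraboloid_no_minimizer.
Qed.
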